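(* Let $M$ be a connected smooth Riemannian $m$-manifold without boundary, let $$\mathsf F(M):=\{\Psi : \Psi\in C^2(M)\cap L^\infty(M)\cap L^2(M),\ \Delta\Psi\in L^2(M)\},$$ and let $D(m):=(2+\sqrt m)^2$. If $M$ admits a sequence of Laplacian cut-off functions and satisfies $\mathrm{Ric}\ge -C$ for some constant $C>0$, then $$|d\Psi|\in\bigcap_{q\in[2,4]}L^q(M)\quad\text{for any }\Psi\in\mathsf F(M).$$ More precisely, in this situation, for all $\Psi\in\mathsf F(M)$ one has $$\|d\Psi\|_2^2=\langle\Psi,(-\Delta)\Psi\rangle,\qquad \|d\Psi\|_4^4\le D(m)\,\|\Psi\|_\infty^2\left(\|\Delta\Psi\|_2^2+C\,\|d\Psi\|_2^2\right).$$
   Context: $\Delta$ is the (negative) Laplace-Beltrami operator, so $-\Delta=d^\dagger d$. Functions are complex-valued and tensorial data are complexified; $L^q$-spaces and norms $\|\cdot\|_q$ are taken with respect to the Riemannian volume measure $\mu$ (for 1-forms, using the pointwise norm induced by the metric), and $\langle\cdot,\cdot\rangle$ is the $L^2$ scalar product. A sequence of Laplacian cut-off functions on $M$ is a sequence $(\chi_n)\subset C^\infty_c(M)$ such that: (C1) $0\le\chi_n(x)\le1$ for all $n\in\mathbb N$, $x\in M$; (C2) for every compact $K\subset M$ there is $n_0(K)\in\mathbb N$ with $\chi_n|_K=1$ for all $n\ge n_0(K)$; (C3) $\sup_{x\in M}|d\chi_n(x)|_x\to0$ as $n\to\infty$; (C4) $\sup_{x\in M}|\Delta\chi_n(x)|\to0$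 as $n\to\infty$. *)

(* Defs.v *)
From HB Require Import structures.
From mathcomp Require Import all_boot all_order all_algebra.
From mathcomp Require Import all_classical all_reals all_analysis.
From mathcomp Require Export complex.

Set Implicit Arguments.
Unset Strict Implicit.
Unset Printing Implicit Defensive.

Import Order.TTheory GRing.Theory Num.Theory.
Import numFieldNormedType.Exports.
Export Normc.

Local Open Scope classical_set_scope.
Local Open Scope complex_scope.
Local Open Scope ring_scope.

(* [Re] and [Im] alone are the C-valued operators of a numClosedFieldType. *)
Local Notation cRe := (@complex.Re _).
Local Notation cIm := (@complex.Im _).

Section Calculus.
Context {R : realType} {m : nat}.
Implicit Types (O : set 'rV[R]_m) (y : 'rV[R]_m).

Definition pd (j : 'I_m) (f : 'rV[R]_m -> R) y : R :=
  'D_(delta_mx 0 j) f y.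

Definition cpd (j : 'I_m) (f : 'rV[R]_m -> R[i]) y : R[i] :=
  pd j (cRe \o f) y +i* pd j (cIm \o f) y.

(* C^k on O, which is meant to be open: all iterated partial derivatives of
   order < k exist, and all those of order <= k are continuous, on O. *)
Definition Ck (k : nat) O (f : 'rV[R]_m -> R) : Prop :=
  forall s : seq 'I_m, (size s <= k)%N ->
    (forall y, O y -> {for y, continuous (foldr pd f s)}) /\
    ((size s < k)%N -> forall (j : 'I_m) y, O y ->
      derivable (foldr pd f s) y (delta_mx 0 j)).

Definition Csmooth O (f : 'rV[R]_m -> R) : Prop := forall k, Ck k O f.

End Calculus.

(* The iterated integral of f over R^m in the coordinates y_0, ..., y_(m-1);
   for Borel f >= 0 it is, by Tonelli, the integral of f against Lebesgue
   measure on R^m. *)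
Fixpoint leb_integral {R : realType} (m : nat) :
    ('rV[R]_m -> \bar R) -> \bar R :=
  match m with
  | 0 => fun f => f 0
  | n.+1 => fun f => (\int[@lebesgue_measure R]_t
      leb_integral (fun v : 'rV[R]_n => f (row_mx (t%:M : 'rV_1) v)))%E
  end.

(* A Riemannian metric on a smooth m-manifold without boundary, given through
   an atlas: [chart_map a] maps the open set [chart_dom a] homeomorphically onto
   an open subset of R^m, with inverse [chart_inv a], and [metric_mx a y] is the
   Gram matrix (g_ij) at the point with coordinates y in the chart a.
   [chart_at x] is a distinguished chart around x; it is used below to evaluate
   at x expressions which do not depend on the chart.  The base point of M only
   encodes that M is nonempty. *)
Record riemannian (R : realType) (m : nat) (M : ptopologicalType) := Riemannian {
  chart : Type;
  chart_dom : chart -> set M;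
  chart_map : chart -> M -> 'rV[R]_m;
  chart_inv : chart -> 'rV[R]_m -> M;
  chart_at : M -> chart;
  metric_mx : chart -> 'rV[R]_m -> 'M[R]_m;
  manifold_hausdorff : hausdorff_space M;
  manifold_countable : @second_countable M;
  chart_dom_open : forall a, open (chart_dom a);
  chart_atP : forall x, chart_dom (chart_at x) x;
  chart_map_open : forall a, open (chart_map a @` chart_dom a);
  chart_mapK : forall a x, chart_dom a x -> chart_inv a (chart_map a x) = x;
  chart_map_continuous : forall a x, chart_dom a x -> {for x, continuous (chart_map a)};
  chart_inv_continuous : forall a y, (chart_map a @` chart_dom a) y ->
    {for y, continuous (chart_inv a)};
  transition_smooth : forall a b (j : 'I_m),
    Csmooth (chart_map a @` (chart_dom a `&` chart_dom b))
            (fun y => chart_map b (chart_inv a y) 0 j);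
  metric_mx_smooth : forall a (i j : 'I_m),
    Csmooth (chart_map a @` chart_dom a) (fun y => metric_mx a y i j);
  metric_mx_sym : forall a y, (chart_map a @` chart_dom a) y ->
    (metric_mx a y)^T = metric_mx a y;
  metric_mx_pos : forall a y, (chart_map a @` chart_dom a) y ->
    forall v : 'rV[R]_m, v != 0 -> 0 < (v *m metric_mx a y *m v^T) 0 0;
  metric_mx_transition : forall a b y, (chart_map a @` (chart_dom a `&` chart_dom b)) y ->
    let J := \matrix_(i < m, k < m)
               pd i (fun z => chart_map b (chart_inv a z) 0 k) y in
    metric_mx a y = J *m metric_mx b (chart_map b (chart_inv a y)) *m J^T
}.

Definition borel (M : ptopologicalType) := g_sigma_algebraType (@open M).

Section Geometry.
Context {R : realType} {m : nat} {M : ptopologicalType}.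
Variable G : riemannian R m M.
Implicit Types (a : chart G) (y : 'rV[R]_m) (x : M) (f : M -> R[i]).

Definition chart_range a : set 'rV[R]_m := chart_map a @` chart_dom a.

Definition ginv a y : 'M[R]_m := invmx (metric_mx a y).

Definition vol_density a y : R := Num.sqrt (\det (metric_mx a y)).

Definition riemannian_volume (mu : {measure set (borel M) -> \bar R}) : Prop :=
  forall a (A : set (borel M)), measurable A -> A `<=` chart_dom a ->
    mu A = leb_integral (fun y =>
      (\1_(chart_map a @` A) y * vol_density a y)%:E).

Definition christoffel a (k i j : 'I_m) y : R :=
  2^-1 * \sum_(l < m) ginv a y k l *
    (pd i (fun z => metric_mx a z j l) y + pd j (fun z => metric_mx a z i l) y
     - pd l (fun z => metric_mx a z i j) y).

(* The components R^l_{kij} of R(e_i, e_j) e_k = R^l_{kij} e_l, where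
   R(X, Y) = [nabla_X, nabla_Y] - nabla_[X, Y]. *)
Definition curvature a (l k i j : 'I_m) y : R :=
  pd i (christoffel a l j k) y - pd j (christoffel a l i k) y
  + \sum_(p < m) (christoffel a l i p y * christoffel a p j k y
                  - christoffel a l j p y * christoffel a p i k y).

(* Ric(Y, Z) is the trace of X |-> R(X, Y) Z. *)
Definition ricci a y : 'M[R]_m :=
  \matrix_(j < m, k < m) \sum_(i < m) curvature a i k i j y.

(* Ric >= c as quadratic forms, i.e. Ric(v, v) >= c g(v, v). *)
Definition ricci_ge (c : R) : Prop :=
  forall a y, chart_range a y -> forall v : 'rV[R]_m,
    c * (v *m metric_mx a y *m v^T) 0 0 <= (v *m ricci a y *m v^T) 0 0.

Definition Ck_fun (k : nat) f : Prop :=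
  forall a, Ck k (chart_range a) (cRe \o (f \o chart_inv a)) /\
            Ck k (chart_range a) (cIm \o (f \o chart_inv a)).

Definition smooth_fun f : Prop := forall k, Ck_fun k f.

(* 1-forms on the domain of a chart are represented by their components. *)
Definition ext_d a f y : 'rV[R[i]]_m := \row_(j < m) cpd j (f \o chart_inv a) y.

(* d^dagger w =
     - |g|^(-1/2) \sum_j partial_j (|g|^(1/2) \sum_k g^jk w_k) *)
Definition codiff a (w : 'rV[R]_m -> 'rV[R[i]]_m) y : R[i] :=
  - ((vol_density a y)^-1%:C * \sum_(j < m) cpd j (fun z =>
      (vol_density a z)%:C * \sum_(k < m) (ginv a z j k)%:C * w z 0 k) y).

Definition laplacian f x : R[i] :=
  let a := chart_at G x in - codiff a (ext_d a f) (chart_map a x).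

(* |df|_x, for the Hermitian extension of the metric to complex 1-forms *)
Definition d_norm f x : R :=
  let a := chart_at G x in let y := chart_map a x in let w := ext_d a f y in
  Num.sqrt (cRe (\sum_(j < m) \sum_(k < m)
    (ginv a y j k)%:C * w 0 j * (w 0 k)^*)).

Definition compactly_supported f : Prop :=
  compact (closure [set x | f x != 0]).

(* In the order of R[i], the condition 0 <= z <= 1 says that z is real and
   lies in [0, 1]. *)
Record laplacian_cutoff (chi : nat -> M -> R[i]) : Prop := LaplacianCutoff {
  cutoff_smooth : forall n, smooth_fun (chi n);
  cutoff_support : forall n, compactly_supported (chi n);
  cutoff_bounds : forall n x, 0 <= chi n x <= 1;
  cutoff_one : forall K : set M, compact K ->
    exists n0 : nat, forall n, (n0 <= n)%N -> forall x, K x -> chi n x = 1;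
  cutoff_d : ereal_sup [set (d_norm (chi n) x)%:E | x in [set: M]]
               @[n --> \oo] --> 0%E;
  cutoff_laplacian :
    ereal_sup [set (normc (laplacian (chi n) x))%:E | x in [set: M]]
      @[n --> \oo] --> 0%E
}.

Variable mu : {measure set (borel M) -> \bar R}.

Definition Lp_norm (p : \bar R) f : \bar R :=
  'N[mu]_p [(fun x => (normc (f x))%:E)]%E.

Definition in_Lp (p : \bar R) f : Prop :=
  [/\ measurable_fun [set: borel M] (cRe \o f : borel M -> R),
      measurable_fun [set: borel M] (cIm \o f : borel M -> R) &
      (Lp_norm p f < +oo)%E].

Definition L2_dot (f h : M -> R[i]) : R[i] :=
  let F : borel M -> R[i] := fun x => (f x)^* * h x in
  (\int[mu]_x cRe (F x)) +i* (\int[mu]_x cIm (F x)).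

Definition d_Lp_norm (p : \bar R) f : \bar R :=
  'N[mu]_p [(fun x => (d_norm f x)%:E)]%E.

Record class_F f : Prop := ClassF {
  class_F_C2 : Ck_fun 2 f;
  class_F_Loo : in_Lp +oo f;
  class_F_L2 : in_Lp 2%:E f;
  class_F_laplacian : in_Lp 2%:E (laplacian f)
}.

End Geometry.

Definition dim_const {R : realType} (m : nat) : R := (2 + Num.sqrt m%:R) ^+ 2.

(* Main.v *)
(* Write a compactly supported C^2 function as u + iv and put F = |du|^2 + |dv|^2.  Green's formula
   with the test functions F u and F v gives
     \int F^2 = - \int [F (u Lap u + v Lap v) + <dF, u du + v dv>].
   Since |dF| <= 2 (|Hess u| |du| + |Hess v| |dv|) and (Lap u)^2 <= m |Hess u|^2, the integrand is at
   most (2 + sqrt m) M F |Hess| <= 1/2 (2 + sqrt m)^2 M^2 |Hess|^2 + 1/2 F^2 when u^2 + v^2 <= M^2, and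
   the integrated Bochner formula bounds \int |Hess|^2 by \int |Lap|^2 + C F.  A general Psi is reached
   by applying this to chi_n Psi: the test function chi_n^2 u in Green's formula shows that |dPsi| is in
   L^2, which allows dominated convergence on the right, and Fatou on the left.

   All functions are only C^2, so Bochner's formula cannot be derived by differentiating three times.
   In a chart it is obtained in weak form from the identity
     \int d_i f d_j g = \int d_j f d_i g  for compactly supported C^1 functions,
   which also yields the symmetry of second derivatives.  Green's formula in turn implies that the
   coordinate expression of the Laplacian does not depend on the chart. *)

Require Import Defs.
From HB Require Import structures.
From mathcomp Require Import all_boot all_order all_algebra.
From mathcomp Require Import all_classical all_reals all_analysis.
From mathcomp Require Import measurable_realfun ess_sup_inf.
From mathcomp Require Import complex.
From mathcomp Require Import ring lra.

Set Implicit Arguments.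
Unset Strict Implicit.
Unset Printing Implicit Defensive.

Import Order.TTheory GRing.Theory Num.Theory.
Import numFieldNormedType.Exports.

Local Open Scope classical_set_scope.
Local Open Scope complex_scope.
Local Open Scope ring_scope.

(** * Lebesgue measure on row vectors *)

(** Absorbing half of $\int F^2$ is legitimate only once this integral is known to be finite.
    Compact support guarantees that, which is why the $L^4$ estimate precedes the removal of the
    cut-offs. The weight $F$ is merely $C^1$, so it may enter Green's formula only through the test
    function; the formula is therefore proved for $C^1$ test functions, and bump functions and
    partitions of unity of class $C^1$ suffice. Using the same $F$ against $u$ and against $v$ keeps
    the constant of the real case: the mixed term $\langle d|du|^2, d|dv|^2\rangle$ is controlled by
    Cauchy-Schwarz without losing a factor. The volume is given only through iterated integrals in
    charts, while limit theorems need a measure on $R^m$; [nu] supplies one. The estimate also needs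
    $|\Psi|\le\|\Psi\|_\infty$ at every point, which follows from the essential bound because $\Psi$
    is continuous and the volume density is positive. *)

Section Borel.
Context {R : realType}.
Local Notation mR := (measurableTypeR R).

Lemma borel_open (M : ptopologicalType) (U : set (borel M)) :
  @open M U -> measurable U.
Proof. exact: sub_sigma_algebra. Qed.

Lemma borel_fun (M : ptopologicalType) (D : set M) (f : M -> R) : open D ->
  (forall x, D x -> {for x, continuous f}) ->
  measurable_fun (D : set (borel M)) (f : borel M -> R).
Proof.
move=> oD cf; apply: (measurability _ (RGenOpens.measurableE R)).
move=> _ [_ [a [b ->]] <-].
apply: borel_open; rewrite openE => x [Dx fx].
apply: filterI; first exact: open_nbhs_nbhs.
apply: (cf _ Dx); apply: open_nbhs_nbhs; split => //; exact: interval_open.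
Qed.

Lemma borel_map (M N : ptopologicalType) (D : set M) (f : M -> N) : open D ->
  (forall x, D x -> {for x, continuous f}) ->
  measurable_fun (D : set (borel M)) (f : borel M -> borel N).
Proof.
move=> oD cf; apply: (@measurability _ _ (borel M) (borel N) D f (@open N)) => //.
move=> _ [U oU <-].
apply: borel_open; rewrite openE => x [Dx fx].
apply: filterI; first exact: open_nbhs_nbhs.
by apply: (cf _ Dx); exact: open_nbhs_nbhs.
Qed.

Lemma measurable_ballR (x r : R) : measurable (ball x r : set mR).
Proof.
have : measurable (ball x r : set R) by apply: open_measurable; exact: ball_open.
exact.
Qed.

Lemma measurable_comp_borel d1 d2 (T1 : measurableType d1) (T2 : measurableType d2)
    (f : T2 -> \bar R) (g : T1 -> T2) :
  measurable_fun setT f -> measurable_fun setT g ->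
  measurable_fun setT (fun x => f (g x)).
Proof. move=> mf mg; exact: (measurableT_comp mf mg). Qed.

Definition mkrow (n : nat) (p : R * 'rV[R]_n) : 'rV[R]_n.+1 :=
  row_mx (p.1%:M : 'rV_1) p.2.

Lemma mkrow_ball n (p q : R * 'rV[R]_n) e : ball p e q ->
  ball (mkrow p) e (mkrow q).
Proof.
case=> h1 h2; have e0 : 0 < e.
  by apply: le_lt_trans h1; rewrite normr_ge0.
split => // i j; rewrite /mkrow !mxE; case: splitP => k kj.
  by rewrite !mxE !ord1 eqxx !mulr1n.
by case: h2 => _ h2; exact: h2.
Qed.

Lemma mkrow_continuous n : continuous (@mkrow n).
Proof.
move=> p; apply/cvg_ballP => e e0; rewrite nearE.
apply: (@filterS _ (nbhs p)); last exact: (@nbhsx_ballx R (R * 'rV[R]_n)%type p e e0).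
by move=> q; exact: mkrow_ball.
Qed.

(** This compares the product sigma-algebra with the Borel one: an open set of $R^{n+1}$ is a
    countable union of products of balls with rational centres and radii $1/(k+1)$. *)
Lemma measurable_mkrow n :
  measurable_fun [set: mR * borel 'rV[R]_n]
    (@mkrow n : mR * borel 'rV[R]_n -> borel 'rV[R]_n.+1).
Proof.
apply: (@measurability _ _ _ (borel 'rV[R]_n.+1) _ _ (@open 'rV[R]_n.+1)) => // => _ [U oU <-]; rewrite setTI.
pose rect (k : rat * 'rV[rat]_n * nat) : set (mR * borel 'rV[R]_n) :=
  ball (ratr k.1.1 : R) (k.2.+1%:R^-1) `*` ball (map_mx ratr k.1.2 : 'rV[R]_n) (k.2.+1%:R^-1).
rewrite [X in measurable X](_ : _ =
  \bigcup_(k in [set k | rect k `<=` @mkrow n @^-1` U]) rect k); last first.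
  apply/seteqP; split => [p Up|p [k kU kp]]; last exact: kU.
  have : nbhs p (@mkrow n @^-1` U).
    by apply: mkrow_continuous; exact: open_nbhs_nbhs.
  move=> /nbhs_ballP[e /= e0 eU].
  (* Two points of a rational ball are joined through its centre at the cost of two radii, hence
     [e / 2]. *)
  have [k ke] : exists k : nat, k.+1%:R^-1 < e / 2.
    have /cvgrPdist_lt := @cvg_harmonic R.
    move=> /(_ (e / 2)) [|N _ hN]; first by rewrite divr_gt0.
    exists N; have /= := hN N (leqnn _).
    by rewrite sub0r normrN ger0_norm // invr_ge0.
  have k0 : 0 < k.+1%:R^-1 :> R by rewrite invr_gt0.
  have dens (x : R) : exists q : rat, `|ratr q - x| < k.+1%:R^-1.
    have lt2 : x - k.+1%:R^-1 < x + k.+1%:R^-1.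
      by rewrite ltrBlDr -addrA ltrDl addr_gt0.
    have [q] := rat_in_itvoo lt2.
    rewrite in_itv /= => /andP[h1 h2]; exists q.
    by rewrite ltr_norml ltrBrDr ltrBlDr addrC h1 addrC.
  have [q hq] := dens p.1.
  have [w hw] := choice (fun j => dens (p.2 0 j)).
  have wE : ball (map_mx ratr (\row_j w j) : 'rV[R]_n) (k.+1%:R^-1) p.2.
    split => // i j; rewrite !mxE ord1; exact: hw.
  exists (q, \row_j w j, k); last first.
    by split.
  move=> z [/= z1 z2]; apply: eU; apply: (@le_ball _ _ _ (k.+1%:R^-1 + k.+1%:R^-1)).
    by apply: ltW; rewrite [ltRHS]splitr ltrD.
  split; apply: ball_triangle; [| exact: z1| |exact: z2].
    by apply: ball_sym.
  exact: ball_sym.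
rewrite bigcup_mkcond; apply: countable_bigcupT_measurable.
  exact: countableP.
move=> k; case: ifP => // _; apply: measurableX.
  exact: measurable_ballR.
apply: borel_open; exact: ball_open.
Qed.

(** The open sup-norm ball in coordinates, a form that splits off the first coordinate; in dimension
    0 it is the whole space for every [r]. *)
Definition cube n (y : 'rV[R]_n) (r : R) : set 'rV[R]_n :=
  [set z | forall j, `|z 0 j - y 0 j| < r].

Lemma cube_mkrow n (t : R) (y : 'rV[R]_n) (r : R) :
  @mkrow n @^-1` cube (mkrow (t, y)) r = ball t r `*` cube y r.
Proof.
apply/seteqP; split=> -[s z] /=.
  move=> h; split=> [|j] /=.
    have := h (@lshift 1 n ord0).
    by rewrite /mkrow !(@row_mxEl _ 1 1 n) !mxE eqxx !mulr1n distrC.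
  by have := h (@rshift 1 n j); rewrite /mkrow !(@row_mxEr _ 1 1 n).
case=> /= h1 h2 j; rewrite /mkrow !mxE; case: splitP => k kj.
  by rewrite !mxE !ord1 eqxx !mulr1n distrC.
exact: h2.
Qed.

Lemma mkrow_split n (y : 'rV[R]_n.+1) :
  exists t v, y = mkrow (t, v).
Proof.
exists (@lsubmx _ 1 1 n y 0 0), (@rsubmx _ 1 1 n y).
by rewrite /mkrow /= -mx11_scalar -[LHS](@hsubmxK _ 1 1 n).
Qed.

Lemma open_cube n (y : 'rV[R]_n) r : open (cube y r).
Proof.
rewrite openE => z hz; rewrite /interior.
apply: (@filter_forall _ _ (fun (j : 'I_n) (w : 'rV[R]_n) => `|w 0 j - y 0 j| < r) _ (nbhs_filter z)) => j.
  have cj : {for z, continuous (fun w : 'rV[R]_n => `|w 0 j - y 0 j|)}.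
    apply: (@continuous_comp _ _ _ (fun z : 'rV[R]_n => z 0 j - y 0 j) (fun r => `|r|)); last exact: norm_continuous.
    apply: continuousB; last exact: cst_continuous.
    exact: coord_continuous.
exact: (cvgr_lt _ cj).
Qed.

Definition mkrowm n : {mfun (mR * borel 'rV[R]_n)%type >-> borel 'rV[R]_n.+1} :=
  HB.pack (@mkrow n : (mR * borel 'rV[R]_n)%type -> borel 'rV[R]_n.+1)
    (isMeasurableFun.Build _ _ _ _ _ (@measurable_mkrow n)).

Section pushm.
Local Open Scope ereal_scope.
Context d1 d2 (T1 : measurableType d1) (T2 : measurableType d2)
  (m : {measure set T1 -> \bar R}) (f : {mfun T1 >-> T2}).

Definition pushm : set T2 -> \bar R := pushforward m f.

Let pushm0 : pushm set0 = 0. Proof. exact: measure0. Qed.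
Let pushm_ge0 A : 0 <= pushm A. Proof. exact: measure_ge0. Qed.
Let pushm_sigma_additive : semi_sigma_additive pushm.
Proof. exact: measure_semi_sigma_additive. Qed.

HB.instance Definition _ := isMeasure.Build _ _ _ pushm
  pushm0 pushm_ge0 pushm_sigma_additive.
End pushm.

Definition splitrow n (y : 'rV[R]_n.+1) : R * 'rV[R]_n :=
  (@lsubmx _ 1 1 n y 0 0, @rsubmx _ 1 1 n y).

Lemma mkrowK n : cancel (@mkrow n) (@splitrow n).
Proof.
by case=> t v; rewrite /splitrow /mkrow /= (@row_mxKl _ 1 1 n) (@row_mxKr _ 1 1 n) mxE eqxx mulr1n.
Qed.

Lemma measurable_splitrow n :
  measurable_fun [set: borel 'rV[R]_n.+1] (@splitrow n : borel 'rV[R]_n.+1 -> mR * borel 'rV[R]_n).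
Proof.
have m1 : measurable_fun [set: borel 'rV[R]_n.+1] ((fun y : 'rV[R]_n.+1 => @lsubmx _ 1 1 n y 0 0) : borel 'rV[R]_n.+1 -> R).
  apply: (@borel_fun 'rV[R]_n.+1 setT); first exact: openT.
  move=> y _; apply: (@continuous_comp _ _ _ (fun y : 'rV[R]_n.+1 => @lsubmx _ 1 1 n y) (fun A : 'M[R]_1 => A 0 0)).
    exact: differentiable_continuous (differentiable_lsubmx _).
  exact: coord_continuous.
have m2 : measurable_fun [set: borel 'rV[R]_n.+1] ((fun y : 'rV[R]_n.+1 => @rsubmx _ 1 1 n y) : borel 'rV[R]_n.+1 -> borel 'rV[R]_n).
  apply: (@borel_map 'rV[R]_n.+1 'rV[R]_n setT); first exact: openT.
  by move=> y _; exact: differentiable_continuous (differentiable_rsubmx _).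
by apply/measurable_fun_pairP; split; [exact: m1|exact: m2].
Qed.

Section nu_step.
Local Open Scope ereal_scope.
Context (n : nat) (m : {sigma_finite_measure set (borel 'rV[R]_n) -> \bar R}).

Let leb : {sigma_finite_measure set (mR) -> \bar R} := [the {sigma_finite_measure set _ -> \bar R} of @lebesgue_measure R].

Definition nu_step : set (borel 'rV[R]_n.+1) -> \bar R :=
  pushm (product_measure1 leb m) (@mkrowm n).

HB.instance Definition _ := Measure.on nu_step.

Let nu_step_sigma_finite : sigma_finite setT nu_step.
Proof.
have [G TG Goo] : sigma_finite setT (product_measure1 leb m).
  have /sigma_finiteP[F [TF ndF Foo]] := sigma_finiteT leb.
  have /sigma_finiteP[G [TG ndG Goo]] := sigma_finiteT m.
  exists (fun n => F n `*` G n).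
    rewrite -setXTT TF TG predeqE => -[x y]; split.
      move=> [/= [k _ Fnx] [l _ Gky]]; exists (maxn k l) => //; split.
      - by move: x Fnx; exact/subsetPset/ndF/leq_maxl.
      - by move: y Gky; exact/subsetPset/ndG/leq_maxr.
    by move=> [k _ []/= ? ?]; split; exists k.
  move=> k; have [? ?] := Foo k; have [? ?] := Goo k.
  split; first exact: measurableX.
  by rewrite product_measure1E// lte_mul_pinfty// ge0_fin_numE.
exists (fun k => @splitrow n @^-1` G k).
  apply/esym; rewrite -preimage_bigcup -TG; exact: preimage_setT.
move=> k; have [mG Gk] := Goo k; split.
  by rewrite -[X in measurable X]setTI; exact: measurable_splitrow.
rewrite /nu_step /pushm /pushforward /= -comp_preimage.
rewrite (_ : @splitrow n \o @mkrow n = id) //.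
by apply/funext => z /=; exact: mkrowK.
Qed.

HB.instance Definition _ := @Measure_isSigmaFinite.Build _ _ _ nu_step nu_step_sigma_finite.

End nu_step.

Local Open Scope ereal_scope.

(** Lebesgue measure on $R^n$ as an iterated product: [leb_integral] is only a functional, and
    dominated convergence, Fatou and linearity need a measure behind it. Sigma-finiteness is carried
    along for Tonelli's theorem. *)
Fixpoint nu n : {sigma_finite_measure set (borel 'rV[R]_n) -> \bar R} :=
  match n with
  | 0 => [the {sigma_finite_measure set (borel 'rV[R]_0) -> \bar R} of
           (\d_(0%R : borel 'rV[R]_0))]
  | n.+1 => [the {sigma_finite_measure set (borel 'rV[R]_n.+1) -> \bar R} of nu_step (nu n)]
  end.

Lemma measurable_mkrow2 n t : measurable_fun [set: borel 'rV[R]_n]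
  ((fun v => mkrow (t, v)) : borel 'rV[R]_n -> borel 'rV[R]_n.+1).
Proof.
apply: borel_map; first exact: openT.
move=> v _; apply: (@continuous_comp _ _ _ (fun v : 'rV[R]_n => (t, v))); last exact: mkrow_continuous.
by apply: (@cvg_pair _ _ _ (nbhs v) (nbhs t) (nbhs v) _ _ _ (fun=> t) id); [exact: cvg_cst|exact: cvg_id].
Qed.

(** Induction on [n]: the pushforward turns the left side into an integral over a product, and
    Tonelli splits off the first coordinate. *)
Lemma integral_nu n (f : 'rV[R]_n -> \bar R) :
  @measurable_fun _ _ (borel 'rV[R]_n) (\bar R) setT f ->
  (forall y, 0 <= f y) ->
  \int[nu n]_y f y = leb_integral f.
Proof.
elim: n f => [|n IH] f mf f0.
  rewrite /= integral_dirac //.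
  by rewrite diracT mul1e.
transitivity (\int[@lebesgue_measure R \x nu n]_p f (mkrow p)).
  exact: (@ge0_integral_pushforward _ _ _ _ _ _ (@measurable_mkrow n) (product_measure1 lebesgue_measure (nu n)) setT).
rewrite fubini_tonelli1 //=; last first.
  exact: (measurable_comp_borel mf (@measurable_mkrow n)).
apply: eq_integral => t _; rewrite /fubini_F IH //.
exact: (measurable_comp_borel mf (@measurable_mkrow2 n _)).
Qed.

Lemma nu_cube n (y : 'rV[R]_n) (r : R) : (0 < r)%R ->
  nu n (cube y r) = ((r *+ 2) ^+ n)%:E.
Proof.
move=> r0; elim: n y => [|n IH] y.
  by rewrite /= diracE expr0 mem_set // => -[].
have [t [v ->]] := mkrow_split y.
rewrite /= /nu_step /pushm /pushforward /= cube_mkrow product_measure1E; last 2 first.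
- exact: measurable_ballR.
- by apply: borel_open; exact: open_cube.
transitivity (lebesgue_measure (ball t r) * nu n (cube v r)); first by [].
by rewrite lebesgue_measure_ball ?ltW // [X in _ * X]IH exprS EFinM.
Qed.

Lemma measurable_shiftR (s : R) :
  measurable_fun [set: mR] (fun t : mR => t + s : mR)%R.
Proof.
have : measurable_fun [set: R] (fun t : R => t + s)%R by exact: measurable_funD.
exact.
Qed.

(** The translated measure agrees with Lebesgue measure on half-open intervals, and these determine
    it. *)
Lemma lebesgue_shift (s : R) (A : set mR) : measurable A ->
  lebesgue_measure ((fun t => t + s)%R @^-1` A) = lebesgue_measure A :> \bar R.
Proof.
move=> mA; have ms := measurable_shiftR s.
pose f : {mfun mR >-> mR} := HB.pack (fun t : mR => t + s : mR)%R (isMeasurableFun.Build _ _ _ _ _ ms).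
apply/esym; rewrite (@lebesgue_measure_unique _ (pushm lebesgue_measure f)) //= => _ [[a b]] _ <-.
rewrite /pushm /pushforward /=.
have -> : (fun t => t + s)%R @^-1` [set` `]a, b]%R] = [set` `]a - s, b - s]%R].
  by apply/seteqP; split => x /=; rewrite !in_itv /= ltrBlDr lerBrDr.
rewrite !lebesgue_measure_itv /= !lte_fin ltrD2r.
by case: ifP => // _; rewrite -!EFinB opprB addrA subrK.
Qed.

(** Induction on the dimension: the inner integral absorbs the shift [v] of the last coordinates,
    the outer one the shift [s] of the first. Measurability of the inner integral in [t] is part of
    Tonelli's theorem. *)
Lemma leb_integral_shift n (f : 'rV[R]_n -> \bar R) w :
  @measurable_fun _ _ (borel 'rV[R]_n) (\bar R) setT f ->
  (forall y, 0 <= f y) ->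
  leb_integral (fun y => f (y + w)%R) = leb_integral f.
Proof.
elim: n f w => [|n IH] f w mf f0.
  by rewrite /=; congr f; apply/rowP; case.
have [s [v ->]] := mkrow_split w.
pose g t := leb_integral (fun v => f (mkrow (t, v))).
have gE t : g t = \int[nu n]_v f (mkrow (t, v)).
  rewrite integral_nu //.
  exact: (measurable_comp_borel mf (@measurable_mkrow2 n _)).
have mg : @measurable_fun _ _ mR (\bar R) setT g.
  rewrite (_ : g = fun t => \int[nu n]_v f (mkrow (t, v))); last by apply/funext.
  apply: (@measurable_fun_fubini_tonelli_F _ _ mR (borel 'rV[R]_n) R (nu n) (fun p => f (mkrow p))) => //.
  exact: (measurable_comp_borel mf (@measurable_mkrow n)).
have g0 t : 0 <= g t by rewrite gE integral_ge0.
transitivity (\int[@lebesgue_measure R]_t g (t + s)%R).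
  apply: eq_integral => t _; rewrite /g -(IH (fun z => f (mkrow ((t + s)%R, z))) v) //; last first.
    exact: (measurable_comp_borel mf (@measurable_mkrow2 n _)).
  congr leb_integral; apply/funext => z; congr f.
  rewrite /mkrow /= (@add_row_mx _ 1 1 n).
  rewrite (_ : t%:M + s%:M = (t + s)%:M)%R //.
  by apply/matrixP => i j; rewrite !mxE !ord1 eqxx !mulr1n.
transitivity (\int[pushforward lebesgue_measure (fun t : mR => t + s : mR)%R]_t g t).
  by rewrite (ge0_integral_pushforward (measurable_shiftR s)).
transitivity (\int[@lebesgue_measure R]_t g t); last by [].
apply: eq_measure_integral; first exact: measurable_shiftR.
by move=> ? A mA _; exact: (lebesgue_shift s mA).
Qed.

Lemma nu_shift n (f : 'rV[R]_n -> \bar R) w :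
  @measurable_fun _ _ (borel 'rV[R]_n) (\bar R) setT f ->
  (forall y, 0 <= f y) ->
  \int[nu n]_y f (y + w)%R = \int[nu n]_y f y.
Proof.
move=> mf f0; rewrite !integral_nu //; first exact: leb_integral_shift.
apply: (measurable_comp_borel mf); apply: borel_map; first exact: openT.
move=> v _; apply: continuousD => //; exact: cst_continuous.
Qed.

End Borel.

(** * C^1 calculus in several variables *)

Section continuous.
Context {R : realType}.

Lemma near_continuous (T U : topologicalType) (f g : T -> U) (y : T) :
  (\near y, f y = g y) -> {for y, continuous f} -> {for y, continuous g}.
Proof.
move=> fg cf; rewrite /continuous_at /prop_for -(nbhs_singleton fg).
by apply: cvg_trans cf; apply: near_eq_cvg; exact: fg.
Qed.

Lemma continuous_fsum (T : topologicalType) (I : Type) (r : seq I) (P : pred I)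
    (F : I -> T -> R) (y : T) :
  (forall i, {for y, continuous (F i)}) ->
  {for y, continuous (fun z => \sum_(i <- r | P i) F i z)}.
Proof.
move=> h; elim: r => [|i r IH].
  apply: (@near_continuous _ _ (fun=> 0)); last exact: cst_continuous.
  by apply: nearW => z; rewrite big_nil.
apply: (@near_continuous _ _ (fun z => if P i then F i z + \sum_(j <- r | P j) F j z
   else \sum_(j <- r | P j) F j z)); first by apply: nearW => z; rewrite big_cons.
by case: (P i); [exact: (continuousD (h i) IH)|exact: IH].
Qed.

Lemma continuous_rV (T : topologicalType) (n : nat) (F : T -> 'rV[R]_n) (y : T) :
  (forall k, {for y, continuous (fun z => F z 0 k)}) -> {for y, continuous F}.
Proof.
move=> h; apply/cvg_ballP => e e0; rewrite nearE.
apply: (@filterS _ (nbhs y) _ (fun z => forall k, ball (F y 0 k) e (F z 0 k))).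
  by move=> z hz; split => // i k; rewrite ord1.
apply: (@filter_forall _ _ _ _ (nbhs_filter y)) => k.
by have /cvg_ballP := h k; exact.
Qed.

Section pointwise.
Context {T : topologicalType}.
Implicit Types (f g : T -> R) (y : T).

Lemma cts_cst (c : R) y : {for y, continuous (fun=> c : R)}.
Proof. exact: cst_continuous. Qed.

Lemma ctsD f g y : {for y, continuous f} -> {for y, continuous g} ->
  {for y, continuous (fun z => f z + g z)}.
Proof. exact: continuousD. Qed.

Lemma ctsB f g y : {for y, continuous f} -> {for y, continuous g} ->
  {for y, continuous (fun z => f z - g z)}.
Proof. exact: continuousB. Qed.

Lemma ctsM f g y : {for y, continuous f} -> {for y, continuous g} ->
  {for y, continuous (fun z => f z * g z)}.
Proof. exact: continuousM. Qed.

Lemma ctsZ (c : R) g y : {for y, continuous g} ->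
  {for y, continuous (fun z => c * g z)}.
Proof. by move=> cg; apply: ctsM => //; exact: cts_cst. Qed.

Lemma cts_comp (U : topologicalType) (g : T -> U) (f : U -> R) y :
  {for y, continuous g} -> {for g y, continuous f} ->
  {for y, continuous (fun z => f (g z))}.
Proof. exact: (@continuous_comp _ _ _ g f). Qed.

End pointwise.
End continuous.

Section C1.
Context {R : realType} {m : nat}.
Local Notation V := 'rV[R]_m.
Local Notation e_ j := (delta_mx 0 j : 'rV[R]_m).
Implicit Types (O : set V) (f g : V -> R) (y z : V).

(** [Ck 1] in a form without lists of indices. As in [Ck], openness of [O] is not built in; it is
    assumed wherever an identity valid only on [O] gets differentiated. *)
Record C1 O f : Prop := MkC1 {
  C1_continuous : forall y, O y -> {for y, continuous f};
  C1_derivable : forall y j, O y -> derivable f y (e_ j);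
  C1_pd_continuous : forall y j, O y -> {for y, continuous (pd j f)} }.

Arguments C1_continuous {O f} _ {y} _.
Arguments C1_derivable {O f} _ {y} j _.
Arguments C1_pd_continuous {O f} _ {y} j _.

Lemma C1_Ck1 O f : Ck 1 O f -> C1 O f.
Proof.
move=> h; have [h0 h1] := h [::] isT; split; first exact: h0.
  by move=> y j; exact: (h1 isT j).
by move=> y j; have [h2 _] := h [:: j] isT; exact: h2.
Qed.

Lemma C1_Ck2 O f : Ck 2 O f -> C1 O f /\ forall j, C1 O (pd j f).
Proof.
move=> h; split.
  apply: C1_Ck1 => s hs; have [h0 h1] := h s (leqW hs); split => // s1.
  by apply: h1; exact: leq_trans s1 _.
move=> j; apply: C1_Ck1 => s hs.
(* [foldr pd f] applies the last index of the list first, so differentiating [pd j f] along [s]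
   corresponds to [rcons s j]. *)
have hs' : (size (rcons s j) <= 2)%N by rewrite size_rcons.
have [h0 h1] := h (rcons s j) hs'.
by rewrite foldr_rcons size_rcons in h0 h1; split.
Qed.

Lemma C1_sub O O' f : O' `<=` O -> C1 O f -> C1 O' f.
Proof.
move=> sO h; split=> [y /sO|y j /sO|y j /sO].
- exact: C1_continuous h _.
- exact: C1_derivable h _ _.
- exact: C1_pd_continuous h _ _.
Qed.

Lemma open_near O f g y : open O -> {in O, f =1 g} -> O y -> \near y, f y = g y.
Proof.
move=> oO fg Oy; apply: filterS (open_nbhs_nbhs (conj oO Oy)) => z Oz.
by apply: fg; rewrite inE.
Qed.

Lemma pd_eq O f g y j : open O -> {in O, f =1 g} -> O y -> pd j f y = pd j g y.
Proof. by move=> oO fg Oy; apply: near_eq_derive; exact: open_near Oy. Qed.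

Lemma C1_eq O f g : open O -> {in O, f =1 g} -> C1 O f -> C1 O g.
Proof.
move=> oO fg h; split=> [y Oy|y j Oy|y j Oy].
- by apply: near_continuous (C1_continuous h Oy); exact: open_near Oy.
- have E : \near y, f y = g y by exact: open_near Oy.
  exact: (near_eq_derivable E (C1_derivable h j Oy)).
- apply: near_continuous (C1_pd_continuous h j Oy).
  by apply: open_near Oy => // z; rewrite inE => Oz; exact: pd_eq Oz.
Qed.

Lemma pdD f g y j : derivable f y (e_ j) -> derivable g y (e_ j) ->
  pd j (fun z => f z + g z) y = pd j f y + pd j g y.
Proof. exact: deriveD. Qed.

Lemma pdB f g y j : derivable f y (e_ j) -> derivable g y (e_ j) ->
  pd j (fun z => f z - g z) y = pd j f y - pd j g y.
Proof. exact: deriveB. Qed.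

Lemma pdM f g y j : derivable f y (e_ j) -> derivable g y (e_ j) ->
  pd j (fun z => f z * g z) y = pd j f y * g y + f y * pd j g y.
Proof. by move=> hf hg; rewrite /pd (deriveM hf hg) addrC mulrC. Qed.

Lemma pd_cst (c : R) y j : pd j (fun=> c) y = 0.
Proof. exact: derive_cst. Qed.

Lemma derivable_fsum (I : Type) (r : seq I) (P : pred I) (F : I -> V -> R) y v :
  (forall i, derivable (F i) y v) ->
  derivable (fun z => \sum_(i <- r | P i) F i z) y v.
Proof.
move=> h; elim: r => [|i r IH].
  by under eq_fun do rewrite big_nil; exact: derivable_cst.
under eq_fun do rewrite big_cons.
by case: (P i); [exact: (derivableD (h i) IH)|exact: IH].
Qed.

Lemma pd_sum (I : Type) (r : seq I) (P : pred I) (F : I -> V -> R) y j :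
  (forall i, derivable (F i) y (e_ j)) ->
  pd j (fun z => \sum_(i <- r | P i) F i z) y = \sum_(i <- r | P i) pd j (F i) y.
Proof.
move=> h; elim: r => [|i r IH].
  by under eq_fun do rewrite big_nil; rewrite big_nil pd_cst.
under eq_fun do rewrite big_cons; rewrite big_cons.
case: (P i); last exact: IH.
by rewrite (pdD (h i)) ?IH //; exact: derivable_fsum.
Qed.

Lemma C1_cst O (c : R) : C1 O (fun=> c).
Proof.
split=> [y _|y j _|y j _].
- exact: cst_continuous.
- exact: derivable_cst.
- have -> : pd j (fun=> c) = fun=> 0 :> R by apply/funext => z; exact: pd_cst.
  exact: cst_continuous.
Qed.

Lemma C1D O f g : open O -> C1 O f -> C1 O g -> C1 O (fun z => f z + g z).
Proof.
move=> oO hf hg; split=> [y Oy|y j Oy|y j Oy].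
- exact: continuousD (C1_continuous hf Oy) (C1_continuous hg Oy).
- by apply: derivableD; [exact: (C1_derivable hf j Oy)|exact: (C1_derivable hg j Oy)].
- apply: (@near_continuous _ _ (fun z => pd j f z + pd j g z)).
    apply: open_near Oy => // z; rewrite inE => Oz.
    by rewrite (pdD (C1_derivable hf j Oz) (C1_derivable hg j Oz)).
  exact: continuousD (C1_pd_continuous hf j Oy) (C1_pd_continuous hg j Oy).
Qed.

Lemma C1M O f g : open O -> C1 O f -> C1 O g -> C1 O (fun z => f z * g z).
Proof.
move=> oO hf hg; split=> [y Oy|y j Oy|y j Oy].
- exact: continuousM (C1_continuous hf Oy) (C1_continuous hg Oy).
- by apply: derivableM; [exact: (C1_derivable hf j Oy)|exact: (C1_derivable hg j Oy)].
- apply: (@near_continuous _ _ (fun z => pd j f z * g z + f z * pd j g z)).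
    apply: open_near Oy => // z; rewrite inE => Oz.
    by rewrite (pdM (C1_derivable hf j Oz) (C1_derivable hg j Oz)).
  apply: continuousD.
    exact: continuousM (C1_pd_continuous hf j Oy) (C1_continuous hg Oy).
  exact: continuousM (C1_continuous hf Oy) (C1_pd_continuous hg j Oy).
Qed.

Lemma C1N O f : open O -> C1 O f -> C1 O (fun z => - f z).
Proof.
move=> oO h; have -> : (fun z => - f z) = (fun z => (- 1) * f z).
  by apply/funext => z; rewrite mulN1r.
exact: (C1M oO (C1_cst _ _) h).
Qed.

Lemma C1B O f g : open O -> C1 O f -> C1 O g -> C1 O (fun z => f z - g z).
Proof. by move=> oO hf hg; exact: (C1D oO hf (C1N oO hg)). Qed.

Lemma C1_sum O (I : Type) (r : seq I) (P : pred I) (F : I -> V -> R) : open O ->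
  (forall i, C1 O (F i)) -> C1 O (fun z => \sum_(i <- r | P i) F i z).
Proof.
move=> oO h; elim: r => [|i r IH].
  by under eq_fun do rewrite big_nil; exact: C1_cst.
under eq_fun do rewrite big_cons.
by case: (P i); [exact: (C1D oO (h i) IH)|exact: IH].
Qed.

Lemma C1_prod O (I : Type) (r : seq I) (P : pred I) (F : I -> V -> R) : open O ->
  (forall i, C1 O (F i)) -> C1 O (fun z => \prod_(i <- r | P i) F i z).
Proof.
move=> oO h; elim: r => [|i r IH].
  by under eq_fun do rewrite big_nil; exact: C1_cst.
under eq_fun do rewrite big_cons.
by case: (P i); [exact: (C1M oO (h i) IH)|exact: IH].
Qed.

Lemma derive_coord (j : 'I_m) z v : is_derive z v (fun z : V => z 0 j) (v 0 j).
Proof.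
have E : \forall h \near 0^', (v 0 j : R) = h^-1 *: ((h *: v + z) 0 j - z 0 j).
  near=> h; rewrite !mxE addrK scalerA mulVf ?scale1r //.
  by near: h; exact: nbhs_dnbhs_neq.
have c : h^-1 *: ((h *: v + z) 0 j - z 0 j) @[h --> 0^'] --> (v 0 j : R).
  by apply: (cvg_trans (near_eq_cvg E)); exact: cvg_cst.
by apply: DeriveDef; [apply/cvg_ex; exists (v 0 j)|exact: cvg_lim].
Unshelve. all: by end_near. Qed.

Lemma pd_coord (i j : 'I_m) z : pd i (fun z : V => z 0 j) z = (i == j)%:R.
Proof.
by rewrite /pd; have [_ ->] := derive_coord j z (e_ i); rewrite mxE eqxx eq_sym.
Qed.

Lemma C1_coord O (j : 'I_m) : C1 O (fun z => z 0 j).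
Proof.
split=> [y _|y i _|y i _].
- exact: coord_continuous.
- by have [] := derive_coord j y (e_ i).
- have -> : pd i (fun z : V => z 0 j) = fun=> (i == j)%:R.
    by apply/funext => z; exact: pd_coord.
  exact: cst_continuous.
Qed.

Lemma derivable_lineE f z v t : derivable f (t *: v + z) v ->
  is_derive t (1 : R) (fun s : R => f (s *: v + z)) ('D_v f (t *: v + z)).
Proof.
move=> h.
have E : (fun h : R => h^-1 *: ((fun s => f (s *: v + z)) (h *: 1 + t) - f (t *: v + z))) =
         (fun h : R => h^-1 *: (f (h *: v + (t *: v + z)) - f (t *: v + z))).
  by apply/funext => s /=; rewrite addrA scalerDl [s *: 1]mulr1.
by apply: DeriveDef; rewrite /derivable /derive /= E.
Qed.

(** The one-variable mean value theorem along a coordinate line. Locating [c] only by its absolute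
    value spares later uses the case distinction on the sign of [s]. *)
Lemma pd_MVT f z j (s : R) : (forall t, `|t| <= `|s| -> derivable f (t *: e_ j + z) (e_ j)) ->
  exists2 c, `|c| <= `|s| & f (s *: e_ j + z) - f z = s * pd j f (c *: e_ j + z).
Proof.
move=> h; pose g (t : R) : R := f (t *: e_ j + z).
have dg (t : R) : `|t| <= `|s| -> is_derive t (1 : R) g (pd j f (t *: e_ j + z)).
  by move=> ts; apply: derivable_lineE; exact: h.
have cg a b : `|a| <= `|s| -> `|b| <= `|s| -> {within `[a, b], continuous g}.
  move=> sa sb; apply: derivable_within_continuous => t; rewrite in_itv /= => /andP[ta tb].
  suff ts : `|t| <= `|s| by have [] := dg t ts.
  by move: sa sb; rewrite !ler_norml => /andP[a1 a2] /andP[b1 b2]; apply/andP; split; lra.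
have g0 : g 0 = f z by rewrite /g scale0r add0r.
have [s0|s0] := leP 0 s.
  have [|//|c] := @MVT_segment _ g (fun t => pd j f (t *: e_ j + z)) 0 s s0.
  - move=> t; rewrite in_itv /= => /andP[t0 ts]; apply: dg.
    by rewrite !ger0_norm // ltW.
  - by apply: cg => //; rewrite normr0.
  rewrite in_itv /= => /andP[c0 cs] E; exists c; first by rewrite !ger0_norm.
  by rewrite -g0 -/(g s) E subr0 mulrC.
have [|//|c] := @MVT_segment _ g (fun t => pd j f (t *: e_ j + z)) s 0 (ltW s0).
- move=> t; rewrite in_itv /= => /andP[t0 ts]; apply: dg.
  by rewrite !ltr0_norm // lerN2 ltW.
- by apply: cg => //; rewrite normr0.
rewrite in_itv /= => /andP[c0 cs] E; exists c.
  by rewrite ler0_norm // ltr0_norm // lerN2.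
by rewrite -g0 -/(g s) -opprB E sub0r mulrN opprK mulrC.
Qed.

(** * Total differentiability of C^1 functions *)

Section differentiable.

(** The increment telescopes along a path changing one coordinate at a time; the mean value theorem
    and continuity of the partial derivatives control each leg. *)
Lemma C1_increment O f y (eps : R) : open O -> C1 O f -> O y -> 0 < eps ->
  \forall h \near (0 : V), `|f (h + y) - f y - \sum_j h 0 j * pd j f y| <= eps * `|h|.
Proof.
(* There are [m] legs, each with error [d * |h|]; dividing by [m.+1] covers [m = 0]. *)
move=> oO hf Oy e0; pose d := eps / m.+1%:R.
have d0 : 0 < d by rewrite divr_gt0.
have : \forall z \near y, O z /\ forall j, `|pd j f z - pd j f y| < d.
  apply: filterI; first exact: open_nbhs_nbhs.
  apply: (@filter_forall _ _ (fun (j : 'I_m) (z : V) => `|pd j f z - pd j f y| < d) _ (nbhs_filter y)) => j.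
  have /cvgrPdist_lt /(_ d d0) := C1_pd_continuous hf j Oy.
  by apply: filterS => z; rewrite distrC.
move=> /nbhs_ballP[r /= r0 hr].
have hr' z : `|z| < r -> O (z + y) /\ forall j, `|pd j f (z + y) - pd j f y| < d.
  move=> zr; apply: hr; rewrite mx_norm_ball /ball_ /=.
  by rewrite opprD addrCA subrr addr0 normrN.
apply/nbhs_ballP; exists r => //= h; rewrite mx_norm_ball /ball_ /= sub0r normrN => hr1.
(* [hk k] keeps the first [k] coordinates of [h]; all intermediate points have norm at most that of
   [h] and stay in the ball. *)
pose hk k : V := \row_j (if (j < k)%N then h 0 j else 0).
have hkm : hk m = h by apply/rowP => j; rewrite mxE ltn_ord.
have hk0 : hk 0%N = 0 by apply/rowP => j; rewrite !mxE.
have normle (z : V) : (forall j, `|z 0 j| <= `|h|) -> `|z| <= `|h|.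
  move=> hz; rewrite [leLHS]/Num.norm /= mx_normrE; apply: bigmax_le => // -[i j] _ /=.
  by rewrite ord1.
have hcoord j : `|h 0 j| <= `|h|.
  by rewrite [leRHS]/Num.norm /= mx_normrE; exact: (le_bigmax _ (fun i : 'I_1 * 'I_m => `|h i.1 i.2|) (0, j)).
have hkS (j : 'I_m) c : c *: e_ j + hk j = \row_k (if (k < j)%N then h 0 k else if k == j then c else 0).
  apply/rowP => k; rewrite !mxE eqxx /=; case: ltngtP => kj.
  - by rewrite (_ : k == j = false) ?mulr0 ?add0r //; apply/eqP => E; rewrite E ltnn in kj.
  - by rewrite (_ : k == j = false) ?mulr0 ?add0r //; apply/eqP => E; rewrite E ltnn in kj.
  - by rewrite (_ : k == j) ?mulr1 ?addr0 //; apply/eqP/val_inj.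
have small (j : 'I_m) c : `|c| <= `|h 0 j| -> `|c *: e_ j + hk j| < r.
  move=> hc; apply: le_lt_trans hr1; apply: normle => k; rewrite hkS mxE.
  case: ifP => // _; case: eqP => [_|_]; last by rewrite normr0.
  exact: le_trans hc (hcoord _).
have step (j : 'I_m) : `|f (hk j.+1 + y) - f (hk j + y) - h 0 j * pd j f y| <= d * `|h|.
  have E : hk j.+1 = h 0 j *: e_ j + hk j.
    rewrite hkS; apply/rowP => k; rewrite !mxE ltnS leq_eqVlt orbC.
    case: ltngtP => //= kj; last first.
      have -> : k = j by apply/val_inj.
      by rewrite eqxx.
    by rewrite (_ : k == j = false) //; apply/eqP => E; rewrite E ltnn in kj.
  have [|c hc Ec] := @pd_MVT f (hk j + y) j (h 0 j).
    by move=> t ht; rewrite addrA; apply: (C1_derivable hf); have [] := hr' _ (small j t ht).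
  rewrite E -[h 0 j *: _ + _ + y]addrA Ec -mulrBr normrM mulrC ler_pM //.
  by rewrite addrA; have [_ /(_ j) /ltW] := hr' _ (small j c hc).
have tele : f (h + y) - f y = \sum_(j < m) (f (hk j.+1 + y) - f (hk j + y)).
  rewrite -(big_mkord xpredT (fun j => f (hk j.+1 + y) - f (hk j + y))) telescope_sumr //.
  by rewrite hkm hk0 add0r.
rewrite tele -sumrB; apply: le_trans (ler_norm_sum _ _ _) _.
apply: (@le_trans _ _ (\sum_(j < m) d * `|h|)); first by apply: ler_sum => j _; exact: step.
rewrite sumr_const card_ord -mulr_natl mulrA ler_wpM2r // /d mulrCA ger_pMr //.
by rewrite ler_pdivrMr // mul1r ler_nat.
Qed.

Definition grad_lin f y (h : V) : R := \sum_j h 0 j * pd j f y.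

Lemma grad_lin_linear f y : linear (grad_lin f y).
Proof.
move=> a u v; rewrite /grad_lin scaler_sumr -big_split /=; apply: eq_bigr => j _.
by rewrite !mxE mulrDl -mulrA.
Qed.

HB.instance Definition _ f y :=
  GRing.isLinear.Build R V R *:%R (grad_lin f y) (grad_lin_linear f y).

Lemma C1_differentiable O f y : open O -> C1 O f -> O y ->
  differentiable f y /\ 'd f y = grad_lin f y :> (V -> R).
Proof.
move=> oO hf Oy.
have cg : continuous (grad_lin f y).
  move=> z; apply: continuous_fsum => j; apply: continuousM.
    exact: coord_continuous.
  exact: cst_continuous.
have E : f \o shift y = cst (f y) + grad_lin f y +o_ (0 : V) id.
  apply/eqaddoP => _/posnumP[e].
  have e0 : 0 < e%:num :> R by [].
  apply: filterS (C1_increment oO hf Oy e0) => h hh.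
  by apply: le_trans hh; rewrite !fctE /= opprD addrA.
have dE := diff_unique cg E; split; last exact: dE.
by apply/diff_locallyP; rewrite dE.
Qed.
End differentiable.

Lemma C1_comp1 O f (g dg : R -> R) : open O -> C1 O f ->
  (forall t, (f @` O) t -> is_derive t (1 : R) g (dg t)) ->
  (forall t, (f @` O) t -> {for t, continuous dg}) ->
  C1 O (fun z => g (f z)) /\
  forall y j, O y -> pd j (fun z => g (f z)) y = dg (f y) * pd j f y.
Proof.
move=> oO hf hg hdg.
have dg1 y : O y -> differentiable g (f y).
  by move=> Oy; apply/derivable1_diffP; have [] := hg (f y); first by exists y.
have dc y : O y -> differentiable (fun z => g (f z)) y.
  by move=> Oy; apply: differentiable_comp; [case: (C1_differentiable oO hf Oy)|exact: dg1].
have E y j : O y -> pd j (fun z => g (f z)) y = dg (f y) * pd j f y.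
  move=> Oy; have [d1 _] := C1_differentiable oO hf Oy.
  rewrite /pd (deriveE _ (dc y Oy)) (_ : (fun z => g (f z)) = g \o f) //.
  rewrite (diff_comp d1 (dg1 y Oy)) /= -(deriveE _ d1).
  rewrite -[X in 'd g _ X]mulr1 -[X in 'd g _ X]/(_ *: (1 : R)) linearZ /=.
  rewrite -(deriveE _ (dg1 y Oy)); have [_ ->] := hg (f y) ltac:(by exists y).
  by rewrite mulrC.
split => //; split=> [y Oy|y j Oy|y j Oy].
- exact: differentiable_continuous (dc y Oy).
- exact: diff_derivable (dc y Oy).
- apply: (@near_continuous _ _ (fun z => dg (f z) * pd j f z)).
    by apply: open_near Oy => // z; rewrite inE => Oz; rewrite E.
  apply: continuousM; last exact: (C1_pd_continuous hf j Oy).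
  apply: (@continuous_comp _ _ _ f dg); first exact: (C1_continuous hf Oy).
  by apply: hdg; exists y.
Qed.

Lemma C1V O f : open O -> C1 O f -> (forall y, O y -> f y != 0) ->
  C1 O (fun z => (f z)^-1).
Proof.
move=> oO hf f0; apply: (proj1 (@C1_comp1 O f (fun t => t^-1) (fun t => - (t^-1 * t^-1)) oO hf _ _)).
  move=> _ [y Oy <-]; apply: is_derive_eq; first by apply: is_deriveV; exact: f0.
  by rewrite [_ *: _]mulr1 -exprVn expr2.
move=> _ [y Oy <-]; apply: continuousN.
by apply: continuousM; apply: inv_continuous; exact: f0.
Qed.

(** The chain rule needs total differentials, as partial derivatives alone do not compose; the
    differential of [tau] is assembled from [C1_increment] for its coordinates. *)
Lemma C1_comp O O' f (tau : V -> V) : open O -> open O' ->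
  (forall y, O y -> O' (tau y)) -> (forall k, C1 O (fun y => tau y 0 k)) -> C1 O' f ->
  C1 O (fun y => f (tau y)) /\
  forall y j, O y -> pd j (fun y => f (tau y)) y =
    \sum_k pd j (fun y => tau y 0 k) y * pd k f (tau y).
Proof.
move=> oO oO' OO' ht hf.
have dt y : O y -> differentiable tau y.
  move=> Oy; pose dtau (h : V) : V := \row_k grad_lin (fun y => tau y 0 k) y h.
  have dl : linear dtau.
    move=> a u v; apply/rowP => k; rewrite !mxE; exact: grad_lin_linear.
  pose dL : {linear V -> V} := HB.pack dtau (GRing.isLinear.Build _ _ _ _ _ dl).
  have cg : continuous dL.
    move=> z; apply: continuous_rV => k.
    rewrite (_ : (fun w : V => dL w 0 k) = (fun w : V => grad_lin (fun y => tau y 0 k) y w)); last first.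
      by apply/funext => w; rewrite mxE.
    apply: continuous_fsum => j; apply: continuousM; last exact: cst_continuous.
    exact: coord_continuous.
  have E : tau \o shift y = cst (tau y) + dL +o_ (0 : V) id.
    apply/eqaddoP => _/posnumP[e].
    have H : \forall h \near nbhs (0 : V), forall k : 'I_m, `|tau (h + y) 0 k - tau y 0 k - \sum_j h 0 j * pd j (fun y => tau y 0 k) y| <= e%:num * `|h|.
      apply: (@filter_forall _ _ _ _ (nbhs_filter (0 : V))) => k.
      have e0 : 0 < e%:num :> R by [].
      exact: (C1_increment oO (ht k) Oy e0).
    apply: filterS H => h hh; rewrite [leLHS]/Num.norm /= mx_normrE; apply: bigmax_le.
      by rewrite mulr_ge0.
    move=> [i k] _ /=; rewrite ord1 !mxE; apply: le_trans (hh k).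
    by rewrite opprD addrA.
  apply/diff_locallyP; rewrite (diff_unique cg E); split; [exact: cg|exact: E].
have E y j : O y -> pd j (fun y => f (tau y)) y =
    \sum_k pd j (fun y => tau y 0 k) y * pd k f (tau y).
  move=> Oy; have [d1 E1] := C1_differentiable oO' hf (OO' y Oy).
  have d2 := dt y Oy.
  rewrite /pd (_ : (fun y => f (tau y)) = f \o tau) // deriveE; last exact: differentiable_comp.
  rewrite (diff_comp d2 d1) /= E1 /grad_lin -deriveE //; apply: eq_bigr => k _.
  rewrite derive_mx; last exact: diff_derivable.
  by rewrite mxE.
split => //; split=> [y Oy|y j Oy|y j Oy].
- apply: differentiable_continuous; apply: differentiable_comp; first exact: dt.
  by case: (C1_differentiable oO' hf (OO' y Oy)).
- apply: diff_derivable; apply: differentiable_comp; first exact: dt.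
  by case: (C1_differentiable oO' hf (OO' y Oy)).
- apply: (@near_continuous _ _ (fun y => \sum_k pd j (fun y => tau y 0 k) y * pd k f (tau y))).
    by apply: open_near Oy => // z; rewrite inE => Oz; rewrite E.
  apply: continuous_fsum => k; apply: continuousM.
    exact: (C1_pd_continuous (ht k) j Oy).
  apply: (@continuous_comp _ _ _ tau (pd k f)).
    exact: differentiable_continuous (dt y Oy).
  exact: (C1_pd_continuous hf k (OO' y Oy)).
Qed.

End C1.

Arguments C1_continuous {R m O f} _ {y} _.
Arguments C1_derivable {R m O f} _ {y} j _.
Arguments C1_pd_continuous {R m O f} _ {y} j _.

(** * Bump functions *)

Section bump.
Context {R : realType}.

(** A quadratic error bound forces the derivative. It handles [sqpos] at its breakpoint without
    one-sided limits. *)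
Lemma is_derive_quadratic (f : R -> R) (t a C : R) :
  (forall h, `|f (t + h) - f t - a * h| <= C * h ^+ 2) -> is_derive t (1 : R) f a.
Proof.
move=> hf.
(* The constant is enlarged to a positive one so that [e] can be divided by it. *)
have C0 : 0 < Num.max C 0 + 1 by rewrite ltr_pwDr // le_max lexx orbT.
have CC : C <= Num.max C 0 + 1 by rewrite ler_wpDr // le_max lexx.
have c : h^-1 *: (f (h *: (1 : R) + t) - f t) @[h --> 0^'] --> a.
  apply/cvgrPdist_lt => e e0; near=> h.
  have h0 : h != 0 by near: h; exact: nbhs_dnbhs_neq.
  have aux (b k d : R) : k != 0 -> b - k^-1 * d = - (k^-1 * (d - b * k)) by move=> k0; field.
  have -> : a - h^-1 *: (f (h *: (1 : R) + t) - f t) =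
      - (h^-1 * (f (t + h) - f t - a * h)).
    by rewrite [h *: _]mulr1 [h + t]addrC -aux.
  rewrite normrN normrM normfV mulrC ltr_pdivrMr ?normr_gt0 //.
  apply: le_lt_trans (hf h) _.
  rewrite -(real_normK (num_real h)) expr2 mulrA ltr_pM2r ?normr_gt0 //.
  apply: (@le_lt_trans _ _ ((Num.max C 0 + 1) * `|h|)); first by rewrite ler_wpM2r.
  rewrite -ltr_pdivlMl // mulrC.
  by near: h; apply: dnbhs0_lt; rewrite divr_gt0.
by apply: DeriveDef; [apply/cvg_ex; exists a|exact: cvg_lim].
Unshelve. all: by end_near. Qed.

Definition sqpos (s : R) : R := Num.max 0 s ^+ 2.

Lemma sqpos_derive s : is_derive s (1 : R) sqpos (2 * Num.max 0 s).
Proof.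
apply: (@is_derive_quadratic _ _ _ 1) => h; rewrite /sqpos mul1r ler_norml.
by case: (leP 0 s) => hs; case: (leP 0 (s + h)) => hsh; apply/andP; split; nra.
Qed.

Lemma maxr0_continuous : continuous (fun s : R => 2 * Num.max 0 s).
Proof.
move=> s; apply: cvgM; first exact: cvg_cst.
by apply: (@continuous_max _ _ (fun=> 0) id); [exact: cst_continuous|move=> ?; exact: cvg_id].
Qed.

(** A transition from 0 to 1 over the unit interval. Test functions need only be $C^1$, so the
    squared positive part replaces the usual $e^{-1/s}$. *)
Definition step (s : R) : R := sqpos s / (sqpos s + sqpos (1 - s)).

Lemma step_den s : 0 < sqpos s + sqpos (1 - s).
Proof.
rewrite /sqpos; case: (leP 0 s) => hs; case: (leP 0 (1 - s)) => hs1; nra.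
Qed.

Lemma step0 s : s <= 0 -> step s = 0.
Proof. by move=> s0; rewrite /step /sqpos max_l // expr0n mul0r. Qed.

Lemma step1 s : 1 <= s -> step s = 1.
Proof.
move=> s1; rewrite /step /sqpos max_r ?(le_trans ler01) // max_l ?subr_le0 //.
by rewrite expr0n addr0 divff // sqrf_eq0; apply/eqP => E; rewrite E ler10 in s1.
Qed.

Lemma step_gt0 s : 0 < s -> 0 < step s.
Proof.
move=> s0; rewrite /step divr_gt0 ?step_den // /sqpos max_r ?ltW //.
by rewrite exprn_gt0.
Qed.

Lemma step_ge0 s : 0 <= step s.
Proof.
have [s0|s0] := leP s 0; [by rewrite step0|exact/ltW/step_gt0].
Qed.

Lemma step_le1 s : step s <= 1.
Proof. by rewrite /step ler_pdivrMr ?step_den // mul1r lerDl sqr_ge0. Qed.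

Context {m : nat}.
Local Notation V := 'rV[R]_m.

(** The Euclidean square is used because it is differentiable, whereas the norm on matrices is the
    sup norm. *)
Definition sqdist (y z : V) : R := \sum_j (z 0 j - y 0 j) ^+ 2.

Lemma C1_step (O : set V) (f : V -> R) : open O -> C1 O f -> C1 O (fun z => step (f z)).
Proof.
move=> oO hf.
have sq (g : V -> R) : C1 O g -> C1 O (fun z => sqpos (g z)).
  move=> hg; apply: (proj1 (@C1_comp1 _ _ O g sqpos (fun s => 2 * Num.max 0 s) oO hg _ _)).
    by move=> t _; exact: sqpos_derive.
  by move=> t _; exact: maxr0_continuous.
have s1 : C1 O (fun z => sqpos (1 - f z)) by apply: sq; apply: C1B => //; exact: C1_cst.
have s0 := sq _ hf.
apply: (C1M oO s0); apply: (C1V oO (C1D oO s0 s1)) => y _.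
by rewrite gt_eqF // step_den.
Qed.

Lemma C1_sqdist (O : set V) y : open O -> C1 O (sqdist y).
Proof.
move=> oO; apply: C1_sum => // j.
have h : C1 O (fun z : V => z 0 j - y 0 j).
  by apply: C1B => //; [exact: C1_coord|exact: C1_cst].
exact: (C1M oO h h).
Qed.

Lemma sqdist_self y : sqdist y y = 0.
Proof. by rewrite /sqdist big1 // => j _; rewrite subrr expr0n. Qed.

Lemma sqdist_ball y z r : 0 < r -> sqdist y z < r ^+ 2 -> ball y r z.
Proof.
move=> r0 h; split => // i j; rewrite ord1 /ball /= distrC.
rewrite -(ltr_pXn2r (_ : (0 < 2)%N)) ?nnegrE ?normr_ge0 ?ltW //.
apply: le_lt_trans h; rewrite real_normK ?num_real // /sqdist (bigD1 j) //= lerDl.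
by apply: sumr_ge0 => k _; exact: sqr_ge0.
Qed.

Lemma sqdist_continuous y : continuous (sqdist y).
Proof. by move=> z; apply: (C1_continuous (@C1_sqdist setT y openT)). Qed.

Lemma open_sqdist y (a : R) : open [set z | sqdist y z < a].
Proof.
apply: (@open_comp _ _ (sqdist y) [set t | t < a]); last exact: open_lt.
by move=> z _; exact: sqdist_continuous.
Qed.

Lemma closed_sqdist y (a : R) : closed [set z | sqdist y z <= a].
Proof.
apply: (@closed_comp _ _ (sqdist y) [set t | t <= a]); last exact: closed_le.
by move=> z _; exact: sqdist_continuous.
Qed.

Lemma compact_sqdist y (a : R) : compact [set z | sqdist y z <= a].
Proof.
apply: bounded_closed_compact; last exact: closed_sqdist.
(* With $r\ge1$ and $a<r$ one has $a<r\le r^2$, so no square root of [a] is needed. *)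
pose r := Num.max a 0 + 1.
have r1 : 1 <= r by rewrite lerDr le_max lexx orbT.
exists (`|y| + r); split; first exact: num_real.
move=> M hM z hz /=; apply: le_trans (ltW hM).
have : ball y r z.
  apply: sqdist_ball; first by lra.
  apply: le_lt_trans hz _; apply: (@lt_le_trans _ _ r); last by rewrite ler_eXnr.
  by rewrite /r ltr_pwDr // le_max lexx.
rewrite mx_norm_ball /ball_ /= => hb.
by rewrite -[z](subrK y) addrC (le_trans (ler_normD _ _)) // lerD2l distrC ltW.
Qed.

(** The argument of [step] is at least 1 up to distance $r$ and nonpositive from distance
    $\sqrt2\,r$ on; this is the origin of the bound [2 * r ^+ 2] on all supports. *)
Definition bump (y : V) (r : R) (z : V) : R := step (2 - sqdist y z / r ^+ 2).

Lemma C1_bump O y r : open O -> C1 O (bump y r).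
Proof.
move=> oO; apply: C1_step => //; apply: C1B => //; first exact: C1_cst.
by apply: C1M => //; [exact: C1_sqdist|exact: C1_cst].
Qed.

Lemma bump1 y r z : 0 < r -> sqdist y z <= r ^+ 2 -> bump y r z = 1.
Proof.
move=> r0 h; apply: step1; rewrite lerBrDr -lerBrDl.
by rewrite ler_pdivrMr ?exprn_gt0 // (le_trans h) //; lra.
Qed.

Lemma bump_supp y r z : 0 < r -> bump y r z != 0 -> sqdist y z < 2 * r ^+ 2.
Proof.
move=> r0; apply: contraNT; rewrite -leNgt => h; apply/eqP/step0.
by rewrite subr_le0 ler_pdivlMr ?exprn_gt0.
Qed.

Lemma bump_ge0 y r z : 0 <= bump y r z. Proof. exact: step_ge0. Qed.
End bump.

(** * Extension by zero *)

Section glue.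
Context {R : realType} {m : nat}.
Local Notation V := 'rV[R]_m.

Lemma C1_setU (O1 O2 : set V) f : C1 O1 f -> C1 O2 f -> C1 (O1 `|` O2) f.
Proof.
move=> h1 h2; split=> [y|y j|y j] [] Oy.
- exact: (C1_continuous h1 Oy).
- exact: (C1_continuous h2 Oy).
- exact: (C1_derivable h1 j Oy).
- exact: (C1_derivable h2 j Oy).
- exact: (C1_pd_continuous h1 j Oy).
- exact: (C1_pd_continuous h2 j Oy).
Qed.

(** The open sets [O] and the complement of [K] cover the space, and on the second one [f] is
    zero. *)
Lemma C1_ext (O K : set V) f : open O -> closed K -> K `<=` O ->
  (forall z, ~ K z -> f z = 0) -> C1 O f -> C1 setT f.
Proof.
move=> oO cK KO f0 hf; apply: (@C1_sub _ _ (O `|` ~` K)).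
  by move=> z _; have [/KO|] := pselect (K z); [left|right].
apply: C1_setU => //; apply: (@C1_eq _ _ _ (fun=> 0)).
- exact: closed_openC.
- by move=> z; rewrite inE => /f0.
- exact: C1_cst.
Qed.

Lemma continuous_ext (T : topologicalType) (O K : set T) (f : T -> R) :
  open O -> closed K -> K `<=` O ->
  (forall z, ~ K z -> f z = 0) -> (forall z, O z -> {for z, continuous f}) ->
  continuous f.
Proof.
move=> oO cK KO f0 hf z; have [/KO/hf//|Kz] := pselect (K z).
apply: (@near_continuous _ _ (fun=> 0)); last exact: cst_continuous.
apply: filterS (open_nbhs_nbhs (conj (closed_openC cK) Kz)) => w Kw.
by rewrite f0.
Qed.

Lemma pd_supp (K : set V) f j z : closed K -> (forall z, ~ K z -> f z = 0) ->
  ~ K z -> pd j f z = 0.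
Proof.
move=> cK f0 Kz; rewrite -(pd_cst 0 z j).
apply: (@pd_eq _ _ (~` K)) => //; first exact: closed_openC.
by move=> w; rewrite inE => /f0.
Qed.

End glue.

Section integrable_EFin.
Context d (T : measurableType d) {R : realType} (mu : {measure set T -> \bar R}).
Implicit Types f g : T -> R.
Local Notation intg f := (mu.-integrable setT (EFin \o f)).

Lemma integrable_EFinD f g : intg f -> intg g -> intg (fun x => f x + g x).
Proof. by move=> h1 h2; exact: (integrableD measurableT h1 h2). Qed.

Lemma integrable_EFinB f g : intg f -> intg g -> intg (fun x => f x - g x).
Proof. by move=> h1 h2; exact: (integrableB measurableT h1 h2). Qed.

Lemma integrable_EFinZ (c : R) f : intg f -> intg (fun x => c * f x).
Proof. by move=> h; exact: (integrableZl measurableT c h). Qed.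

End integrable_EFin.

(** Guarantees that a bump function of radius [r / 2], supported in radius $\sqrt2\,r/2$, fits
    strictly inside radius [r]. *)
Lemma half_sq (R : realFieldType) (r : R) : 0 < r -> 2 * (r / 2) ^+ 2 < r ^+ 2.
Proof.
move=> r0; have -> : 2 * (r / 2) ^+ 2 = r ^+ 2 / 2 by field.
by rewrite ltr_pdivrMr // ltr_pMr ?exprn_gt0 // ltr1n.
Qed.

(** * Integration by parts *)

Section integral.
Context {R : realType} {m : nat}.
Local Notation V := 'rV[R]_m.
Local Notation nu := (@nu R m).
Implicit Types f g F : V -> R.

(** Compact support expressed by a radius, which is easy to adjust under shifts and derivatives. *)
Definition bdsupp f := exists r : R, forall y, r <= `|y| -> f y = 0.

Lemma norm_cube (r : R) : 0 < r -> [set y : V | `|y| < r] = cube 0 r.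
Proof.
move=> r0; apply/seteqP; split => y /= hy.
  move=> j; rewrite mxE subr0; apply: le_lt_trans hy.
  rewrite [leRHS]/Num.norm /= mx_normrE.
  exact: (le_bigmax _ (fun i : 'I_1 * 'I_m => `|y i.1 i.2|) (0, j)).
rewrite [ltLHS]/Num.norm /= mx_normrE bigmax_lt // => -[i j] _ /=.
by have := hy j; rewrite ord1 mxE subr0.
Qed.

Lemma continuous_borel f : continuous f -> @measurable_fun _ _ (borel V) R setT f.
Proof. by move=> cf; apply: (@borel_fun _ V setT); [exact: openT|move=> y _; exact: cf]. Qed.

Lemma continuous_borel_EFin f : continuous f ->
  @measurable_fun _ _ (borel V) (\bar R) setT (EFin \o f).
Proof. by move=> cf; apply/measurable_EFinP; exact: continuous_borel. Qed.

Lemma bdsupp_bounded f : continuous f -> bdsupp f ->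
  exists2 M : R, 0 <= M & forall y, `|f y| <= M.
Proof.
move=> cf [r hr].
pose K := [set y : V | `|y| <= Num.max 0 r].
have cK : compact K.
  apply: bounded_closed_compact.
    exists (Num.max 0 r); split; first exact: num_real.
    by move=> M hM y hy; apply: le_trans (ltW hM).
  apply: (@closed_comp _ _ (fun y : V => `|y|) [set t | t <= Num.max 0 r]); last exact: closed_le.
  by move=> z _; exact: norm_continuous.
have K0 : K 0 by rewrite /K /= normr0 le_max lexx.
have cnf : continuous (fun y => `|f y|).
  by move=> y; apply: (@continuous_comp _ _ _ f (fun r => `|r|)); [exact: cf|exact: norm_continuous].
have [||c cK' hc] := @compact_EVT_max _ R (fun y => `|f y|) K _ cK.
- by exists 0.
- exact: continuous_subspaceT.
exists `|f c| => // y.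
have [Ky|Ky] := leP `|y| (Num.max 0 r); first by apply: hc; rewrite inE.
by rewrite hr ?normr0 // (le_trans _ (ltW Ky)) // le_max lexx orbT.
Qed.

Lemma cube_integrable (r M : R) : 0 < r ->
  nu.-integrable setT (fun y => (M * \1_(cube 0 r) y)%:E).
Proof.
move=> r0; under eq_fun do rewrite EFinM; apply: integrableZl => //.
have mc : measurable (cube 0 r : set (borel V)) by apply: borel_open; exact: open_cube.
apply/integrableP; split; first by apply/measurable_EFinP; exact: measurable_indic.
under eq_integral do rewrite /= ger0_norm //.
by rewrite integral_indic // setIT; rewrite [X in (X < _)%E](nu_cube 0 r0) ltry.
Qed.

Lemma bd_integrable f (r M : R) : continuous f -> 0 < r ->
  (forall y, `|f y| <= M) -> (forall y, r <= `|y| -> f y = 0) ->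
  nu.-integrable setT (EFin \o f).
Proof.
move=> cf r0 hM hr.
apply: le_integrable (cube_integrable M r0) => //; first exact: continuous_borel_EFin.
move=> y _ /=; rewrite lee_fin -norm_cube // indicE.
have [yr|yr] := ltP `|y| r.
  by rewrite mem_set // mulr1; apply: le_trans (hM y) (ler_norm _).
by rewrite hr // normr0.
Qed.

Lemma cc_integrable f : continuous f -> bdsupp f -> nu.-integrable setT (EFin \o f).
Proof.
move=> cf bf; have [M M0 hM] := bdsupp_bounded cf bf; have [r hr] := bf.
apply: (@bd_integrable _ (Num.max r 1) M) => //; first by rewrite lt_max ltr01 orbT.
by move=> y; rewrite ge_max => /andP[/hr].
Qed.

Lemma shift_continuous (w : V) : continuous (fun y : V => y + w).
Proof. by move=> y; apply: (@continuousD _ _ _ id (fun=> w)); [exact: cvg_id|exact: cst_continuous]. Qed.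

Lemma cts_shift f w : continuous f -> continuous (fun y : V => f (y + w)).
Proof.
by move=> cf y; apply: (cts_comp (g := fun y : V => y + w)); [exact: shift_continuous|exact: cf].
Qed.

Lemma Rintegral_shift f w : continuous f ->
  (\int[nu]_y f (y + w))%R = (\int[nu]_y f y)%R.
Proof.
move=> cf; have mf := continuous_borel_EFin cf.
rewrite /Rintegral; congr fine.
rewrite integralE [RHS]integralE; congr (_ - _)%E.
  rewrite -[RHS](@nu_shift _ _ ((EFin \o f)^\+)%E w) //; last exact: measurable_funepos.
  by apply: eq_integral => y _; rewrite !funeposE.
rewrite -[RHS](@nu_shift _ _ ((EFin \o f)^\-)%E w) //; last exact: measurable_funeneg.
by apply: eq_integral => y _; rewrite !funenegE.
Qed.

Lemma C1_shift f w : C1 setT f ->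
  C1 setT (fun y => f (y + w)) /\ forall j y, pd j (fun y => f (y + w)) y = pd j f (y + w).
Proof.
move=> hf.
have E k : (fun y : V => (y + w) 0 k) = (fun y => y 0 k + w 0 k).
  by apply/funext => y; rewrite mxE.
have hk k : C1 setT (fun y : V => (y + w) 0 k).
  by rewrite E; apply: C1D; [exact: openT|exact: C1_coord|exact: C1_cst].
have [h1 h2] := @C1_comp _ _ setT setT f (fun y => y + w) openT openT (fun _ _ => I) hk hf.
have pdk j y k : pd j (fun y : V => y 0 k + w 0 k) y = (j == k)%:R.
  rewrite pdD; [|exact: (C1_derivable (C1_coord setT k) j I)|exact: (C1_derivable (C1_cst setT _) j I)].
  by rewrite pd_coord pd_cst addr0.
split => // j y; rewrite h2 // (bigD1 j) //= big1 => [|k kj].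
  by rewrite E pdk eqxx mul1r addr0.
by rewrite E pdk eq_sym (negbTE kj) mul0r.
Qed.

Lemma pd_bdsupp f j : bdsupp f -> bdsupp (pd j f).
Proof.
(* The extra 1 leaves a neighbourhood of [y] on which [f] vanishes. *)
move=> [r hr]; exists (r + 1) => y hy.
rewrite -(pd_cst 0 y j); apply: near_eq_derive.
have : \forall z \near y, r < `|z|.
  have cn : {for y, continuous (fun z : V => `|z|)} by exact: norm_continuous.
  by apply: (cvgr_gt _ cn); apply: lt_le_trans hy; rewrite ltrDl.
by apply: filterS => z /ltW; exact: hr.
Qed.

(* Dominated convergence of difference quotients; the bounded factor a is not assumed
   compactly supported so that a = 1 can be used. *)
Lemma dq_cvg (a f : V -> R) (M : R) (j : 'I_m) (h : R^nat) :
  continuous a -> (forall y, `|a y| <= M) -> C1 setT f -> bdsupp f ->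
  (forall n, h n != 0) -> (forall n, `|h n| <= 1) -> h @ \oo --> (0 : R) ->
  (\int[nu]_y (a y * ((h n)^-1 * (f (y + h n *: delta_mx 0 j) - f y))))%R @[n --> \oo]
    --> (\int[nu]_y (a y * pd j f y))%R.
Proof.
move=> ca aM hf bf hn0 hn1 hh.
have cpf : continuous (pd j f) by move=> y; exact: (C1_pd_continuous hf j I).
have cf : continuous f by move=> y; exact: (C1_continuous hf I).
have [L L0 hL] := bdsupp_bounded cpf (pd_bdsupp j bf).
(* A shift has norm at most 1 and $r'-1\ge r$, so outside the cube of half-side [r'] both terms of
   the difference quotient vanish. *)
have [r hr] := bf; pose r' := Num.max r 1 + 2.
have r'0 : 0 < r' by rewrite ltr_pwDr // le_max ler01 orbT.
have rr' : r <= r' - 1 by rewrite /r' -addrA ler_wpDr ?le_max ?lexx //; lra.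
have M0 : 0 <= M by apply: le_trans (aM 0).
pose D n y := a y * ((h n)^-1 * (f (y + h n *: delta_mx 0 j) - f y)).
have cD n : continuous (D n).
  move=> y; apply: (ctsM (ca y)); apply: ctsZ; apply: ctsB (cf y).
  exact: cts_shift.
have ej (s : R) : `|s *: delta_mx 0 j : V| <= `|s|.
  rewrite normrZ ler_piMr // [leLHS]/Num.norm /= mx_normrE; apply: bigmax_le => // -[i k] _.
  by rewrite !mxE; case: (_ && _); rewrite ?normr1 ?normr0.
have Dle n y : `|D n y| <= (M * L) * \1_(cube 0 r') y.
  rewrite -norm_cube // indicE; have [yr|yr] := ltP `|y| r'.
    rewrite mem_set // mulr1 /D normrM ler_pM // normrM normfV.
    rewrite mulrC ler_pdivrMr ?normr_gt0 //.
    have [|c hc] := @pd_MVT _ _ f y j (h n).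
      by move=> t _; exact: (C1_derivable hf j I).
    by rewrite [_ + y]addrC => ->; rewrite normrM mulrC ler_wpM2r.
  rewrite memNset ?mulr0 /D; last by move=> /=; rewrite ltNge yr.
  rewrite (hr y) ?(le_trans rr') //; last by apply: le_trans yr; lra.
  rewrite (hr (y + _)) ?subr0 ?mulr0 ?normr0 // (le_trans rr') //.
  rewrite lerBlDr; apply: le_trans yr _.
  rewrite -{1}(addrK (h n *: delta_mx 0 j : V) y).
  apply: le_trans (ler_normB _ _) _; rewrite lerD2l.
  exact: le_trans (ej _) (hn1 n).
have Dcvg y : D n y @[n --> \oo] --> a y * pd j f y.
  apply: cvgM; first exact: cvg_cst.
  have h0 : h n @[n --> \oo] --> (0 : R)^'.
    move=> A hA; have H := hh _ hA.
    apply: (@filterS nat \oo _ (fun n => h n != 0 -> A (h n)) (fun n => A (h n)) _ H) => n.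
    by apply; exact: hn0.
  have := C1_derivable hf j (I : [set: V] y); rewrite /derivable => /cvg_ex[l hl].
  have lE : pd j f y = l by apply: cvg_lim.
  rewrite lE.
  have E : (fun n => (h n)^-1 * (f (y + h n *: delta_mx 0 j) - f y)) =
     (fun t => t^-1 *: (f (t *: delta_mx 0 j + y) - f y)) \o h.
    by apply/funext => n; rewrite /= [y + _]addrC.
  by rewrite E; apply: cvg_comp hl.
have mD n : @measurable_fun _ _ (borel V) (\bar R) setT (fun y => (D n y)%:E).
  exact: (continuous_borel_EFin (cD n)).
have mL : @measurable_fun _ _ (borel V) (\bar R) setT (fun y => (a y * pd j f y)%:E).
  by apply: continuous_borel_EFin => y; exact: (ctsM (ca y) (cpf y)).
have [iL _ H] : [/\ nu.-integrable setT (fun y => (a y * pd j f y)%:E),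
    (\int[nu]_x `|(D n x)%:E - (a x * pd j f x)%:E| @[n --> \oo] --> 0)%E
  & (\int[nu]_x (D n x)%:E @[n --> \oo] --> \int[nu]_x (a x * pd j f x)%:E)%E].
  apply: (@dominated_convergence _ _ R nu setT measurableT (fun n y => (D n y)%:E) _ _ mD mL _ (cube_integrable (M * L) r'0)).
    by apply: aeW => y _; apply/fine_cvgP; split; [exact: nearW|exact: Dcvg].
  by apply: aeW => y n _; rewrite lee_fin; exact: Dle.
by apply: fine_cvg; rewrite fineK //; exact: integrable_fin_num.
Qed.

Lemma bdsupp_shift f w : bdsupp f -> bdsupp (fun y : V => f (y + w)).
Proof.
move=> [r hr]; exists (r + `|w|) => y hy.
apply: hr; rewrite -lerBrDr in hy; apply: le_trans hy _.
by rewrite lerBlDr -{1}(addrK w y) ler_normB.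
Qed.

(** By translation invariance every difference quotient of [f] has integral 0, and these integrals
    converge to that of the derivative. *)
Lemma integral_pd f j : C1 setT f -> bdsupp f -> (\int[nu]_y pd j f y)%R = 0.
Proof.
move=> hf bf.
have cf : continuous f by move=> y; exact: (C1_continuous hf I).
pose h : R^nat := fun n => n.+1%:R^-1.
have c : continuous (fun _ : V => 1 : R) by move=> ?; exact: cst_continuous.
have H := @dq_cvg (fun=> 1) f 1 j h c (fun y => ltac:(by rewrite normr1)) hf bf.
have := H (fun n => ltac:(by rewrite invr_neq0)) (fun n => ltac:(by rewrite ger0_norm ?invr_ge0 // invf_le1 // ler1n)) (@cvg_harmonic R).
under eq_Rintegral do rewrite mul1r.
move=> /cvg_lim <- //; apply: cvg_lim => //; apply: cvg_near_cst; apply: nearW => n.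
transitivity (\int[nu]_y ((h n)^-1 * (f (y + h n *: delta_mx 0 j) - f y)))%R.
  by apply: eq_Rintegral => y _; rewrite mul1r.
have i1 := cc_integrable cf bf.
have i2 : nu.-integrable setT (EFin \o (fun y => f (y + h n *: delta_mx 0 j))).
  apply: cc_integrable.
    exact: cts_shift.
  exact: bdsupp_shift.
rewrite RintegralZl //; last exact: integrable_EFinB.
by rewrite RintegralB // Rintegral_shift // subrr mulr0.
Qed.

Lemma bdsuppMl f g : bdsupp f -> bdsupp (fun y => f y * g y).
Proof. by move=> [r hr]; exists r => y /hr ->; rewrite mul0r. Qed.

Lemma C1_cts f : C1 setT f -> continuous f.
Proof. by move=> hf y; exact: (C1_continuous hf I). Qed.

Lemma C1_pd_cts f j : C1 setT f -> continuous (pd j f).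
Proof. by move=> hf y; exact: (C1_pd_continuous hf j I). Qed.

Arguments C1_pd_cts {f} j _.

Lemma integral_by_parts f g j : C1 setT f -> C1 setT g -> bdsupp f ->
  (\int[nu]_y (pd j f y * g y))%R = - (\int[nu]_y (f y * pd j g y))%R.
Proof.
move=> hf hg bf; apply/eqP; rewrite -subr_eq0 opprK -RintegralD //; last 2 first.
- apply: cc_integrable; last exact/bdsuppMl/pd_bdsupp.
  by move=> y; apply: ctsM; [exact: C1_pd_cts|exact: C1_cts].
- apply: cc_integrable; last exact/bdsuppMl.
  by move=> y; apply: ctsM; [exact: C1_cts|exact: C1_pd_cts].
apply/eqP; rewrite -[RHS](@integral_pd (fun y => f y * g y) j).
- apply: eq_Rintegral => y _; rewrite pdM //.
    exact: (C1_derivable hf j I).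
  exact: (C1_derivable hg j I).
- exact: (C1M openT hf hg).
- exact: bdsuppMl.
Qed.

(* The null-Lagrangian identity for merely C^1 functions: one derivative is replaced by a
   difference quotient, the other one integrated by parts. *)
Lemma null_lagrangian f g i j : C1 setT f -> C1 setT g -> bdsupp f -> bdsupp g ->
  (\int[nu]_y (pd i f y * pd j g y))%R = (\int[nu]_y (pd j f y * pd i g y))%R.
Proof.
move=> hf hg bf bg.
have [Mf _ hMf] := bdsupp_bounded (C1_pd_cts i hf) (pd_bdsupp i bf).
have [Mg _ hMg] := bdsupp_bounded (C1_pd_cts i hg) (pd_bdsupp i bg).
pose h : R^nat := fun n => n.+1%:R^-1.
have h0 n : h n != 0 by rewrite invr_neq0.
have h1 n : `|h n| <= 1 by rewrite ger0_norm ?invr_ge0 // invf_le1 // ler1n.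
have L1 := dq_cvg (C1_pd_cts i hf) hMf hg bg h0 h1 (@cvg_harmonic R) (j := j).
(* Moving the shift from [g] to [f] reverses its direction, so the quotients of [f] are taken with
   step [- h n]. The two sequences of integrals then coincide term by term. *)
have L2 : (\int[nu]_y (pd i g y * ((- h n)^-1 * (f (y + (- h n) *: delta_mx 0 j) - f y))))%R @[n --> \oo]
    --> (\int[nu]_y (pd i g y * pd j f y))%R.
  apply: (dq_cvg (C1_pd_cts i hg) hMg hf bf).
  - by move=> n; rewrite oppr_eq0.
  - by move=> n; rewrite normrN.
  - by rewrite -oppr0; apply: cvgN; exact: cvg_harmonic.
transitivity (\int[nu]_y (pd i g y * pd j f y))%R; last by apply: eq_Rintegral => y _; rewrite mulrC.
have /cvg_lim <- // := L1; have /cvg_lim <- // := L2; congr (limn _).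
apply/funext => n; pose w : V := h n *: delta_mx 0 j.
have [hgw pgw] := C1_shift w hg.
have ii (a b : V -> R) : continuous a -> continuous b -> bdsupp a ->
    nu.-integrable setT (EFin \o (fun y => a y * b y)).
  by move=> ca cb ba; apply: cc_integrable; [move=> y; exact: (ctsM (ca y) (cb y))|exact: bdsuppMl].
have bi := pd_bdsupp i bf.
have cif := C1_pd_cts i hf.
have cig := C1_pd_cts i hg.
have cgw := C1_cts hgw.
have cg := C1_cts hg.
have cf := C1_cts hf.
transitivity ((h n)^-1 * ((\int[nu]_y (pd i f y * g (y + w)))%R - (\int[nu]_y (pd i f y * g y))%R)).
  rewrite -RintegralB //; [|exact: ii..].
  rewrite -RintegralZl //; last by apply: integrable_EFinB; exact: ii.
  by apply: eq_Rintegral => y _; rewrite mulrCA mulrBr.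
rewrite (integral_by_parts i hf hgw bf) (integral_by_parts i hf hg bf).
transitivity ((- h n)^-1 * ((\int[nu]_y (f (y - w) * pd i g y))%R - (\int[nu]_y (f y * pd i g y))%R)).
  have -> : (\int[nu]_y (f (y - w) * pd i g y) = \int[nu]_y (f y * pd i (fun z => g (z + w)%R) y))%R.
    rewrite -[LHS](@Rintegral_shift _ w); last first.
      by move=> y; apply: ctsM; [exact: cts_shift|exact: cig].
    by apply: eq_Rintegral => y _; rewrite addrK pgw.
  by rewrite -opprD mulrN invrN mulNr.
have cfw : continuous (fun y : V => f (y - w)) by exact: cts_shift.
have bfw : bdsupp (fun y : V => f (y - w)) by exact: bdsupp_shift.
rewrite -RintegralB //; [|exact: ii..].
rewrite -RintegralZl //; last by apply: integrable_EFinB; exact: ii.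
by apply: eq_Rintegral => y _; rewrite -mulrBl scaleNr mulrA [RHS]mulrC.
Qed.

Lemma bdsupp_compact (K : set V) f : compact K -> (forall y, ~ K y -> f y = 0) -> bdsupp f.
Proof.
move=> /compact_bounded [M [_ hM]] hf; exists (M + 2) => y hy; apply: hf => Ky.
have M1 : M < M + 1 by rewrite ltrDl.
have := hM _ M1 y Ky => /=; lra.
Qed.

(** Near [y] the function exceeds half its value there, and [nu_cube] shows that a cube has positive
    measure. *)
Lemma integral_gt0 f y : continuous f -> bdsupp f -> (forall z, 0 <= f z) -> 0 < f y ->
  (0 < \int[nu]_z f z)%R.
Proof.
move=> cf bf f0 fy.
have : \forall z \near y, f y / 2 < f z.
  by apply: (cvgr_gt _ (cf y)); rewrite ltr_pdivrMr // ltr_pMr // ltr1n.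
move=> /nbhs_ballP[r /= r0 hr].
have mc : measurable (cube y r : set (borel V)) by apply: borel_open; exact: open_cube.
have icube : nu.-integrable setT (EFin \o (fun z => f y / 2 * \1_(cube y r) z)).
  rewrite (_ : EFin \o _ = (fun z => (f y / 2)%:E * (\1_(cube y r) z)%:E)%E) //.
  apply: integrableZl => //.
  apply/integrableP; split; first by apply/measurable_EFinP; exact: measurable_indic.
  under eq_integral do rewrite /= ger0_norm //.
  by rewrite integral_indic // setIT; rewrite [X in (X < _)%E](nu_cube y r0) ltry.
apply: (@lt_le_trans _ _ (\int[nu]_z (f y / 2 * \1_(cube y r) z))%R).
  rewrite /Rintegral; under eq_integral do rewrite EFinM.
  rewrite ge0_integralZl_EFin //; last 2 first.
  - by apply/measurable_EFinP; exact: measurable_indic.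
  - by rewrite divr_ge0 // ltW.
  rewrite integral_indic // setIT; rewrite [X in fine (_ * X)](nu_cube y r0) /=.
  by rewrite mulr_gt0 ?divr_gt0 // exprn_gt0 // mulrn_wgt0.
apply: le_Rintegral => //; first exact: cc_integrable.
move=> z _; rewrite indicE; have [zc|zc] := boolP (z \in cube y r).
  rewrite mulr1 ltW //; apply: hr; rewrite inE in zc; split => // i j.
  by rewrite ord1 /ball /= distrC; exact: zc.
by rewrite mulr0.
Qed.

(** If the mixed derivatives differed at [y], their difference would have a constant sign nearby and
    a nonzero integral against a bump function [psi]. Integrating by parts, that integral is a null
    Lagrangian of [psi] and a truncation of [f], hence zero. *)
Lemma clairaut (O : set V) f i j y : open O -> C1 O f -> (forall k, C1 O (pd k f)) -> O y ->
  pd i (pd j f) y = pd j (pd i f) y.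
Proof.
move=> oO hf hpf Oy.
have sym a b : ~ (pd a (pd b f) y < pd b (pd a f) y); last first.
  by apply/eqP; rewrite eq_le; apply/andP; split; rewrite leNgt; apply/negP; exact: sym.
move=> lt.
have : \forall z \near y, O z /\ pd a (pd b f) z < pd b (pd a f) z.
  apply: filterI; first exact: open_nbhs_nbhs.
  have c : {for y, continuous (fun z => pd b (pd a f) z - pd a (pd b f) z)}.
    by apply: ctsB; [exact: (C1_pd_continuous (hpf a) b Oy)|exact: (C1_pd_continuous (hpf b) a Oy)].
  have : 0 < pd b (pd a f) y - pd a (pd b f) y by rewrite subr_gt0.
  by move=> /(cvgr_gt _ c); apply: filterS => z; rewrite subr_gt0.
move=> /nbhs_ballP[r0 /= r00 hr].
pose r := r0 / 2.
have r_gt0 : 0 < r by rewrite divr_gt0.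
have inball z : sqdist y z <= 2 * r ^+ 2 -> ball y r0 z.
  move=> hz; apply: sqdist_ball => //; apply: le_lt_trans hz _; exact: half_sq.
(* Two radii: the support of [psi], of radius $\sqrt2\,s<r$, lies in the open set where the
   truncation [eta] is 1. *)
pose s := r / 2; have s0 : 0 < s by rewrite divr_gt0.
have sr' : 2 * s ^+ 2 < r ^+ 2 by exact: half_sq.
have sr := ltW sr'.
have r2 : r ^+ 2 <= 2 * r ^+ 2 by rewrite ler_peMl ?sqr_ge0 // ler1n.
have sball z : sqdist y z <= 2 * s ^+ 2 -> ball y r0 z.
  by move=> hz; apply: inball; apply: le_trans hz (le_trans sr r2).
pose psi := bump y s; pose eta := bump y r.
have psiy : 0 < psi y.
  by rewrite /psi bump1 // sqdist_self sqr_ge0.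
have psi_ge0 z : 0 <= psi z by exact: bump_ge0.
have lt' : 0 < pd b (pd a f) y - pd a (pd b f) y by rewrite subr_gt0.
have hpsi : C1 setT psi by exact/C1_bump/openT.
have psi0 z : ~ sqdist y z <= 2 * s ^+ 2 -> psi z = 0.
  move=> hz; apply/eqP; apply: contrapT => /negP /(bump_supp s0) /ltW; exact: hz.
have bpsi : bdsupp psi by exact: (@bdsupp_compact [set z | sqdist y z <= 2 * s ^+ 2] psi (@compact_sqdist _ _ y _) psi0).
have eta0 z : ~ sqdist y z <= 2 * r ^+ 2 -> eta z * f z = 0.
  move=> hz; rewrite (_ : eta z = 0) ?mul0r //.
  apply/eqP; apply: contrapT => /negP /(bump_supp r_gt0) /ltW; exact: hz.
pose g z := eta z * f z.
have hg : C1 setT g.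
  apply: (C1_ext oO (@closed_sqdist _ _ y (2 * r ^+ 2)) _ eta0).
    by move=> z hz; have [] := hr z (inball z hz).
  by apply: C1M => //; exact: C1_bump.
have bg : bdsupp g by exact: (@bdsupp_compact [set z | sqdist y z <= 2 * r ^+ 2] _ (@compact_sqdist _ _ y _) eta0).
have gf z k : sqdist y z <= 2 * s ^+ 2 -> pd k g z = pd k f z.
  move=> hz; apply: near_eq_derive.
  have : \forall w \near z, sqdist y w < r ^+ 2.
    apply: open_nbhs_nbhs; split; first exact: open_sqdist.
    exact: le_lt_trans hz sr'.
  by apply: filterS => w /ltW hw; rewrite /g /eta bump1 // mul1r.
(* On the support of [psi] the derivatives of [g] and [f] agree, so [g] may be traded for
   [eta z * pd l f z], which is globally $C^1$ and can be integrated by parts. *)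
have E k l : (\int[nu]_z (pd k psi z * pd l g z))%R = - (\int[nu]_z (psi z * pd k (pd l f) z))%R.
  transitivity (\int[nu]_z (pd k psi z * (eta z * pd l f z)))%R.
    apply: eq_Rintegral => z _; have [hz|hz] := pselect (sqdist y z <= 2 * s ^+ 2).
      by rewrite gf // /eta bump1 ?mul1r // (le_trans hz).
    by rewrite (pd_supp k (@closed_sqdist _ _ y (2 * s ^+ 2)) psi0 hz) !mul0r.
  have hel : C1 setT (fun z => eta z * pd l f z).
    apply: (C1_ext oO (@closed_sqdist _ _ y (2 * r ^+ 2))).
    - by move=> z hz; have [] := hr z (inball z hz).
    - move=> z hz; rewrite (_ : eta z = 0) ?mul0r //.
      apply/eqP; apply: contrapT => /negP /(bump_supp r_gt0) /ltW; exact: hz.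
    - by apply: C1M => //; exact: C1_bump.
  rewrite (integral_by_parts k hpsi hel bpsi); apply: (congr1 -%R); apply: eq_Rintegral => z _.
  have [hz|hz] := pselect (sqdist y z <= 2 * s ^+ 2); last by rewrite psi0 // !mul0r.
  congr (_ * _); apply: near_eq_derive.
  have : \forall w \near z, sqdist y w < r ^+ 2.
    apply: open_nbhs_nbhs; split; first exact: open_sqdist.
    exact: le_lt_trans hz sr'.
  by apply: filterS => w /ltW hw; rewrite /eta bump1 // mul1r.
have := null_lagrangian a b hpsi hg bpsi bg; rewrite !E => /oppr_inj H.
have cD : continuous (fun z => psi z * (pd b (pd a f) z - pd a (pd b f) z)).
  apply: (continuous_ext oO (@closed_sqdist _ _ y (2 * s ^+ 2))).
  - by move=> z /sball/hr[].
  - by move=> z /psi0 ->; rewrite mul0r.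
  - move=> z Oz; apply: ctsM; first exact: C1_cts.
    by apply: ctsB; [exact: (C1_pd_continuous (hpf a) b Oz)|exact: (C1_pd_continuous (hpf b) a Oz)].
have ii k l : nu.-integrable setT (EFin \o (fun z => psi z * pd k (pd l f) z)).
  apply: cc_integrable; last exact: bdsuppMl.
  apply: (continuous_ext oO (@closed_sqdist _ _ y (2 * s ^+ 2))).
  - by move=> z /sball/hr[].
  - by move=> z /psi0 ->; rewrite mul0r.
  - by move=> z Oz; apply: ctsM; [exact: C1_cts|exact: (C1_pd_continuous (hpf l) k Oz)].
have := @integral_gt0 _ y cD (bdsuppMl _ bpsi).
rewrite (_ : Rintegral _ _ _ = 0) ?ltxx => [H2|]; last first.
  transitivity (\int[nu]_z (psi z * pd b (pd a f) z) - \int[nu]_z (psi z * pd a (pd b f) z))%R.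
    by rewrite -(RintegralB measurableT (ii b a) (ii a b)); apply: eq_Rintegral => z _; rewrite mulrBr.
  by apply/eqP; rewrite subr_eq0; apply/eqP; exact: (esym H).
suff : false by [].
apply: H2; last exact: (mulr_gt0 psiy lt').
move=> z; have [hz|hz] := pselect (sqdist y z <= 2 * s ^+ 2); last by rewrite (psi0 z hz) mul0r.
apply: (mulr_ge0 (psi_ge0 z)); rewrite subr_ge0; apply: ltW.
exact: (proj2 (hr z (sball z hz))).
Qed.

End integral.

(** * Traces of symmetric matrices *)

Section linear_algebra.
Context {R : realType}.

Definition posdef n (A : 'M[R]_n) := forall v : 'rV_n, v != 0 -> 0 < (v *m A *m v^T) 0 0.

(** Cholesky factorization by induction on the size: [E] is the Schur complement of the corner entry
    [s]. *)
Lemma posdef_factor n (A : 'M[R]_n) : A^T = A -> posdef A -> exists (P : 'M[R]_n), A = P^T *m P.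
Proof.
elim: n A => [|n IH] A sA pA.
  by exists 0; apply/matrixP => -[].
pose a := @ulsubmx _ 1 n 1 n A; pose b := @ursubmx _ 1 n 1 n A.
pose c := @dlsubmx _ 1 n 1 n A; pose D := @drsubmx _ 1 n 1 n A.
have AE : A = @block_mx _ 1 n 1 n a b c D by rewrite (@submxK _ 1 n 1 n).
have [aT cE DT] : [/\ a^T = a, c = b^T & D^T = D].
  move: sA; rewrite AE (@tr_block_mx _ 1 n 1 n) => /(@eq_block_mx _ 1 n 1 n) [h1 h2 h3 h4].
  by split => //; rewrite -h3.
pose s := a 0 0.
have aE : a = s%:M by rewrite [LHS]mx11_scalar.
have quad (x : R) (v : 'rV_n) :
    ((row_mx x%:M v : 'rV_(1 + n)) *m A *m (row_mx x%:M v : 'rV_(1 + n))^T) 0 0 =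
    x ^+ 2 * s + x * (b *m v^T) 0 0 + x * (v *m b^T) 0 0 + (v *m D *m v^T) 0 0.
  rewrite AE (@mul_row_block _ 1 1 n 1 n) (@tr_row_mx _ 1 1 n) (@mul_row_col _ 1 1 n 1) cE aE.
  rewrite tr_scalar_mx !mul_scalar_mx !mul_mx_scalar mulmxDl -!scalemxAl !mxE.
  by rewrite eqxx mulr1n; ring.
have s0 : 0 < s.
  have := pA (row_mx 1%:M 0 : 'rV_(1 + n)); rewrite quad trmx0 !mulmx0 mul0mx !mxE.
  rewrite expr1n mul1r !mulr0 !addr0; apply; apply/eqP => /(congr1 (@lsubmx _ 1 1 n)).
  rewrite row_mxKl linear0 => /matrixP /(_ 0 0); rewrite !mxE eqxx => /eqP.
  by rewrite oner_eq0.
have sn0 : s != 0 by rewrite gt_eqF.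
pose E := D - s^-1 *: (b^T *m b).
have ET : E^T = E by rewrite linearB /= linearZ /= trmx_mul trmxK DT.
have pE : posdef E.
  (* For fixed [v], this first coordinate minimizes the quadratic form of [A], and the minimum is
     the form of [E]. *)
  move=> v v0; have := pA (row_mx (- s^-1 * (v *m b^T) 0 0)%:M v : 'rV_(1 + n)).
  rewrite quad; have -> : (b *m v^T) 0 0 = (v *m b^T) 0 0.
    by rewrite !mxE; apply: eq_bigr => k _; rewrite !mxE mulrC.
  set t := (v *m b^T) 0 0.
  have -> : (v *m E *m v^T) 0 0 = (v *m D *m v^T) 0 0 - s^-1 * (t * t).
    rewrite /E mulmxBr mulmxBl -scalemxAr -scalemxAl !mulmxA -[v *m b^T *m b *m v^T]mulmxA.
    rewrite mxE [X in _ + X]mxE [X in _ + - X]mxE; congr (_ - _ * _).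
    rewrite [v *m b^T]mx11_scalar mul_scalar_mx mxE; congr (_ * _).
    by rewrite /t !mxE; apply: eq_bigr => k _; rewrite !mxE mulrC.
  have -> : (- s^-1 * t) ^+ 2 * s + - s^-1 * t * t + - s^-1 * t * t = - (s^-1 * (t * t)) by field.
  rewrite addrC; apply; apply/eqP => /(congr1 (@rsubmx _ 1 1 n)).
  by rewrite row_mxKr linear0 => v00; rewrite v00 eqxx in v0.
have [Q EQ] := IH E ET pE.
pose r := Num.sqrt s.
have r2 : r * r = s by rewrite -expr2 sqr_sqrtr // ltW.
have r0 : r != 0 by rewrite sqrtr_eq0 -ltNge.
exists (@block_mx _ 1 n 1 n r%:M (r^-1 *: b) 0 Q).
rewrite AE (@tr_block_mx _ 1 n 1 n) (@mulmx_block _ 1 n 1 n 1 n) tr_scalar_mx trmx0.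
rewrite !mul0mx !mulmx0 !addr0 -EQ /E -scalar_mxM r2 aE [(r^-1 *: b)^T]linearZ /=.
rewrite mul_scalar_mx mul_mx_scalar !scalerA !mulfV // !scale1r cE.
by rewrite -scalemxAl -scalemxAr scalerA -invfM r2 addrC subrK.
Qed.

Lemma sum_sqr_ge0 (I : finType) (F : I -> R) : 0 <= \sum_i F i ^+ 2.
Proof. by apply: sumr_ge0 => i _; exact: sqr_ge0. Qed.

Lemma cauchy_schwarz (I : finType) (F H : I -> R) :
  (\sum_i F i * H i) ^+ 2 <= (\sum_i F i ^+ 2) * (\sum_i H i ^+ 2).
Proof.
set a := \sum_i F i ^+ 2; set b := \sum_i H i ^+ 2; set c := \sum_i F i * H i.
have key t : 0 <= a * t ^+ 2 - 2 * c * t + b.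
  have -> : a * t ^+ 2 - 2 * c * t + b = \sum_i (F i * t - H i) ^+ 2.
    rewrite /a /b /c mulr_suml mulr_sumr mulr_suml -sumrB -big_split /=.
    by apply: eq_bigr => i _; ring.
  exact: sum_sqr_ge0.
have a0 : 0 <= a by exact: sum_sqr_ge0.
have [a00|an0] := eqVneq a 0.
  have b0 : 0 <= b by exact: sum_sqr_ge0.
  have [->|c0] := eqVneq c 0; first by rewrite expr0n a00 mul0r.
  (* With [a = 0] the polynomial is affine; this argument makes it equal to -1. *)
  have := key ((b + 1) / (2 * c)); rewrite a00 mul0r add0r.
  have -> : - (2 * c * ((b + 1) / (2 * c))) + b = - 1 by field.
  by rewrite lerNr oppr0 ler10.
have ap : 0 < a by rewrite lt_def an0.
have := key (c / a).
have -> : a * (c / a) ^+ 2 - 2 * c * (c / a) + b = (a * b - c ^+ 2) / a by field.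
by rewrite pmulr_lge0 ?invr_gt0 // subr_ge0.
Qed.

Lemma mxtrace_sq n (B : 'M[R]_n) : B^T = B -> \tr (B *m B) = \sum_i \sum_j B i j ^+ 2.
Proof.
move=> sB; apply: eq_bigr => i _; rewrite mxE; apply: eq_bigr => j _.
by rewrite -[in X in _ * X]sB mxE expr2.
Qed.

(** Cauchy-Schwarz between the diagonal of [B] and the constant vector 1. This is where the
    dimension, and hence $\sqrt m$, enters the final constant. *)
Lemma mxtrace_le n (B : 'M[R]_n) : B^T = B -> (\tr B) ^+ 2 <= n%:R * \tr (B *m B).
Proof.
move=> sB; rewrite mxtrace_sq //.
have := cauchy_schwarz (fun=> 1 : R) (fun i => B i i).
under eq_bigr do rewrite mul1r; move=> /le_trans; apply.
under eq_bigr do rewrite expr1n.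
rewrite sumr_const card_ord ler_wpM2l //; apply: ler_sum => i _.
by rewrite (bigD1 i) //= lerDl; apply: sumr_ge0 => j _; exact: sqr_ge0.
Qed.

(** The trace is the squared Frobenius norm, which dominates the squared operator norm. *)
Lemma mulmx_norm_le n (B : 'M[R]_n) (v : 'rV[R]_n) : B^T = B ->
  (v *m B *m (v *m B)^T) 0 0 <= \tr (B *m B) * (v *m v^T) 0 0.
Proof.
move=> sB; rewrite mxtrace_sq // !mxE mulr_suml.
have -> : \sum_i (\sum_j B i j ^+ 2) * (\sum_j v 0 j * v^T j 0) =
  \sum_j (\sum_i v 0 i ^+ 2) * (\sum_i B i j ^+ 2).
  rewrite -mulr_suml exchange_big mulrC mulr_sumr; apply: eq_bigr => j _.
  by congr (_ * _); apply: eq_bigr => i _; rewrite mxE expr2.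
apply: ler_sum => j _; rewrite [(_^T) _ _]mxE -expr2 mxE; exact: cauchy_schwarz.
Qed.

(* With S a symmetric matrix (a Hessian) and N = P^T P the inverse metric, S N is similar
   to the symmetric matrix P S P^T as far as traces are concerned. *)
Lemma hess_trace_le n (S N P : 'M[R]_n) : S^T = S -> N = P^T *m P ->
  [/\ 0 <= \tr (S *m N *m (S *m N)),
   (\tr (S *m N)) ^+ 2 <= n%:R * \tr (S *m N *m (S *m N)) &
  forall w : 'rV_n, (w *m N *m S *m N *m (w *m N *m S)^T) 0 0 <=
     \tr (S *m N *m (S *m N)) * (w *m N *m w^T) 0 0].
Proof.
move=> sS NP; pose B := P *m S *m P^T.
have sB : B^T = B by rewrite /B !trmx_mul trmxK sS mulmxA.
have t1 : \tr (S *m N) = \tr B by rewrite NP mulmxA mxtrace_mulC mulmxA.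
have t2 : \tr (S *m N *m (S *m N)) = \tr (B *m B).
  by rewrite NP !mulmxA mxtrace_mulC /B !mulmxA.
split; last 1 first.
move=> w; rewrite t2.
have sN : N^T = N by rewrite NP trmx_mul trmxK.
have -> : w *m N *m S *m N *m (w *m N *m S)^T = (w *m P^T) *m B *m ((w *m P^T) *m B)^T.
  by rewrite /B NP !trmx_mul !trmxK sS !mulmxA.
have -> : w *m N *m w^T = (w *m P^T) *m (w *m P^T)^T.
  by rewrite trmx_mul trmxK NP !mulmxA.
  exact: mulmx_norm_le.
- by rewrite t2 mxtrace_sq //; apply: sumr_ge0 => i _; exact: sum_sqr_ge0.
- by rewrite t1 t2 mxtrace_le.
Qed.

Lemma psd_factor n (N P : 'M[R]_n) (w : 'rV[R]_n) : N = P^T *m P -> 0 <= (w *m N *m w^T) 0 0.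
Proof.
move=> NP; have -> : w *m N *m w^T = (w *m P^T) *m (w *m P^T)^T.
  by rewrite trmx_mul trmxK NP !mulmxA.
by rewrite mxE; apply: sumr_ge0 => j _; rewrite [X in _ * X]mxE -expr2 sqr_ge0.
Qed.

Lemma psd_cauchy_schwarz n (N P : 'M[R]_n) (v w : 'rV[R]_n) : N = P^T *m P ->
  (v *m N *m w^T) 0 0 ^+ 2 <= (v *m N *m v^T) 0 0 * (w *m N *m w^T) 0 0.
Proof.
move=> NP; have E (a b : 'rV_n) : (a *m N *m b^T) 0 0 = \sum_j (a *m P^T) 0 j * (b *m P^T) 0 j.
  rewrite NP !mulmxA -mulmxA -[P *m b^T]trmxK trmx_mul trmxK mxE.
  by apply: eq_bigr => j _; rewrite [(_^T) _ _]mxE.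
rewrite !E; under [X in _ <= X * _]eq_bigr do rewrite -expr2.
under [X in _ <= _ * X]eq_bigr do rewrite -expr2.
exact: cauchy_schwarz.
Qed.

End linear_algebra.

(** * Derivatives of determinants and of inverse matrices *)

Section matrix_calculus.
Context {R : realType} {m : nat}.
Local Notation V := 'rV[R]_m.
Local Notation e_ j := (delta_mx 0 j : 'rV[R]_m).

Lemma derivable_prod (I : eqType) (r : seq I) (F : I -> V -> R) y v :
  (forall i, derivable (F i) y v) -> derivable (fun z => \prod_(i <- r) F i z) y v.
Proof.
move=> h; elim: r => [|i r IH].
  by under eq_fun do rewrite big_nil; exact: derivable_cst.
under eq_fun do rewrite big_cons.
exact: (derivableM (h i) IH).
Qed.

Lemma pd_prod (I : eqType) (r : seq I) (F : I -> V -> R) y j : uniq r ->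
  (forall i, derivable (F i) y (e_ j)) ->
  pd j (fun z => \prod_(i <- r) F i z) y =
  \sum_(k <- r) pd j (F k) y * \prod_(i <- r | i != k) F i y.
Proof.
move=> + h; elim: r => [_|i r IH /= /andP[ir ur]].
  by under eq_fun do rewrite big_nil; rewrite big_nil pd_cst.
under eq_fun do rewrite big_cons; rewrite big_cons.
rewrite (pdM (h i) (derivable_prod h)) IH // big_cons eqxx /=; congr (_ * _ + _).
  rewrite big_seq_cond [RHS]big_seq_cond; apply: eq_bigl => k.
  by case: (boolP (k \in r)) => //= kr; apply/esym/negP => /eqP E; rewrite -E kr in ir.
rewrite mulr_sumr; apply: eq_big_seq => k kr.
rewrite big_cons; case: eqP => [E|_] /=; first by rewrite E kr in ir.
by rewrite mulrCA.
Qed.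

Definition pdmx (n p : nat) (j : 'I_m) (A : V -> 'M[R]_(n, p)) (y : V) : 'M[R]_(n, p) :=
  \matrix_(i, k) pd j (fun z => A z i k) y.

(** Jacobi's formula. Differentiating the Leibniz expansion replaces one row at a time by its
    derivative; expanding along that row gives a diagonal entry of the product with the adjugate. *)
Lemma pd_det n (A : V -> 'M[R]_n) j y : (forall i k, derivable (fun z => A z i k) y (e_ j)) ->
  pd j (fun z => \det (A z)) y = \tr (pdmx j A y *m \adj (A y)).
Proof.
move=> h.
have E (i : 'I_n) : \det (\matrix_(a, b) (if a == i then pdmx j A y a b else A y a b)) =
    (pdmx j A y *m \adj (A y)) i i.
  rewrite (expand_det_row _ i) mxE; apply: eq_bigr => k _.
  rewrite [X in X * _]mxE eqxx [X in _ = _ * X]mxE; congr (_ * _); rewrite /cofactor; congr (_ * \det _).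
  by apply/matrixP => a b; rewrite !mxE eq_sym (negbTE (neq_lift _ _)).
rewrite /mxtrace -(eq_bigr _ (fun i _ => E i)) /determinant.
rewrite pd_sum => [|s]; last first.
  apply: derivableM; first exact: derivable_cst.
  by apply: derivable_prod => i; exact: h.
rewrite exchange_big /=; apply: eq_bigr => s _.
rewrite pdM; [|exact: derivable_cst|by apply: derivable_prod => i; exact: h].
rewrite pd_cst mul0r add0r -mulr_sumr; congr (_ * _).
rewrite pd_prod ?index_enum_uniq //; apply: eq_bigr => i _.
rewrite [RHS](bigD1 i) //= !mxE eqxx; congr (_ * _).
by apply: eq_bigr => k /negbTE ki; rewrite !mxE ki.
Qed.

Lemma C1_det O n (A : V -> 'M[R]_n) : open O -> (forall i k, C1 O (fun z => A z i k)) ->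
  C1 O (fun z => \det (A z)).
Proof.
move=> oO h; apply: C1_sum => // s; apply: C1M => //; first exact: C1_cst.
exact: C1_prod.
Qed.

Lemma C1_adj O n (A : V -> 'M[R]_n) i k : open O -> (forall i k, C1 O (fun z => A z i k)) ->
  C1 O (fun z => \adj (A z) i k).
Proof.
move=> oO h; have -> : (fun z => \adj (A z) i k) = (fun z => cofactor (A z) k i).
  by apply/funext => z; rewrite mxE.
apply: C1M => //; first exact: C1_cst.
apply: C1_det => // a b.
have -> : (fun z => (row' k (col' i (A z))) a b) = (fun z => A z (lift k a) (lift i b)).
  by apply/funext => z; rewrite !mxE.
exact: h.
Qed.

Lemma C1_invmx O n (A : V -> 'M[R]_n) : open O -> (forall i k, C1 O (fun z => A z i k)) ->
  (forall y, O y -> A y \in unitmx) -> forall i k, C1 O (fun z => invmx (A z) i k).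
Proof.
move=> oO h uA i k.
apply: (@C1_eq _ _ _ (fun z => (\det (A z))^-1 * \adj (A z) i k)) => //.
  by move=> z; rewrite inE => Oz; rewrite /invmx uA // [RHS]mxE.
apply: C1M => //; last exact: C1_adj.
apply: C1V => //; first exact: C1_det.
by move=> y Oy; rewrite -unitfE -unitmxE uA.
Qed.

Lemma pdmxM n p q j (A : V -> 'M[R]_(n, p)) (B : V -> 'M[R]_(p, q)) y :
  (forall i k, derivable (fun z => A z i k) y (e_ j)) ->
  (forall i k, derivable (fun z => B z i k) y (e_ j)) ->
  pdmx j (fun z => A z *m B z) y = pdmx j A y *m B y + A y *m pdmx j B y.
Proof.
move=> hA hB; apply/matrixP => i k; rewrite !mxE.
have -> : (fun z => (A z *m B z) i k) = (fun z => \sum_l A z i l * B z l k).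
  by apply/funext => z; rewrite mxE.
rewrite pd_sum => [|l]; last exact: (derivableM (hA _ _) (hB _ _)).
rewrite -big_split /=; apply: eq_bigr => l _.
by rewrite (pdM (hA _ _) (hB _ _)) !mxE.
Qed.

End matrix_calculus.

(** * Riemannian geometry in a chart *)

Section chart.
Context {R : realType} {m : nat}.
Local Notation V := 'rV[R]_m.
Local Notation e_ j := (delta_mx 0 j : 'rV[R]_m).
Context (O : set V) (oO : open O) (g : V -> 'M[R]_m).
Hypothesis C1g : forall i j, C1 O (fun z => g z i j).
Hypothesis C1dg : forall i j k, C1 O (pd k (fun z => g z i j)).
Hypothesis gsym : forall y, O y -> (g y)^T = g y.
Hypothesis gpos : forall y, O y -> posdef (g y).
Implicit Types (y z : V) (i j k l : 'I_m).

(** This and the next definitions repeat those of the statement for an arbitrary matrix field [g],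
    in the same shape, so that for [metric_mx a] they agree by conversion. *)
Definition gi y : 'M[R]_m := invmx (g y).
Definition vol y : R := Num.sqrt (\det (g y)).
Definition Gam k i j y : R :=
  2^-1 * \sum_(l < m) gi y k l *
    (pd i (fun z => g z j l) y + pd j (fun z => g z i l) y
     - pd l (fun z => g z i j) y).
(** The contracted Christoffel symbol, which is the logarithmic derivative of [vol] by [pd_vol]. *)
Definition gam i y : R := \sum_k Gam k k i y.
Definition gradv (u : V -> R) i y : R := \sum_j gi y i j * pd j u y.
Definition Hess (u : V -> R) i j y : R := pd i (pd j u) y - \sum_k Gam k i j y * pd k u y.
(** The component $(\nabla_i X)^j$ of the covariant derivative of the vector field [X]. *)
Definition nab (X : 'I_m -> V -> R) i j y : R := pd i (X j) y + \sum_k Gam j i k y * X k y.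
Definition pair (u v : V -> R) y : R := \sum_i pd i u y * gradv v i y.
Definition lap (u : V -> R) y : R :=
  (vol y)^-1 * \sum_j pd j (fun z => vol z * gradv u j z) y.

Lemma posdef_unit n (A : 'M[R]_n) : posdef A -> A \in unitmx.
Proof.
move=> pA; rewrite -row_free_unit -kermx_eq0; apply/eqP/row_matrixP => i; rewrite row0.
apply/eqP; apply: contraT => v0; have := pA _ v0.
have -> : row i (kermx A) *m A = 0 by rewrite -row_mul mulmx_ker row0.
by rewrite mul0mx mxE ltxx.
Qed.

Lemma g_unit y : O y -> g y \in unitmx.
Proof. by move=> Oy; apply: posdef_unit; exact: gpos. Qed.

Lemma gi_sym y : O y -> (gi y)^T = gi y.
Proof. by move=> Oy; rewrite /gi trmx_inv gsym. Qed.

Lemma giC y i j : O y -> gi y i j = gi y j i.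
Proof. by move=> Oy; rewrite -[in LHS](gi_sym Oy) mxE. Qed.

Lemma gi_pos y : O y -> posdef (gi y).
Proof.
move=> Oy v v0; have u := g_unit Oy.
have -> : v *m gi y *m v^T = (v *m gi y) *m g y *m (v *m gi y)^T.
  by rewrite trmx_mul gi_sym // -!mulmxA (mulmxA (gi y) (g y)) /gi mulVmx // mul1mx.
apply: gpos => //; apply: contraNneq v0 => h.
by rewrite -[v]mulmx1 -(mulVmx u) mulmxA -/(gi y) h mul0mx.
Qed.

Lemma gi_factor y : O y -> exists P : 'M[R]_m, gi y = P^T *m P.
Proof. by move=> Oy; apply: posdef_factor; [exact: gi_sym|exact: gi_pos]. Qed.

Lemma det_gt0 y : O y -> 0 < \det (g y).
Proof.
move=> Oy; have [P E] := posdef_factor (gsym Oy) (gpos Oy).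
have := g_unit Oy; rewrite unitmxE unitfE E det_mulmx det_tr => h.
by rewrite -expr2 lt_def sqr_ge0 andbT expr2.
Qed.

Lemma vol_gt0 y : O y -> 0 < vol y.
Proof. by move=> Oy; rewrite /vol sqrtr_gt0 det_gt0. Qed.

Lemma C1_gi i j : C1 O (fun z => gi z i j).
Proof. exact: (C1_invmx oO C1g (fun y => @g_unit y)). Qed.

Lemma is_derive_sqrtr (t : R) : 0 < t -> is_derive t (1 : R) Num.sqrt (2 * Num.sqrt t)^-1.
Proof. by move=> t0; exact: is_derive1_sqrt. Qed.

Lemma vol_C1_aux : C1 O (fun z => vol z) /\
  forall y j, O y -> pd j (fun z => vol z) y = (2 * vol y)^-1 * pd j (fun z => \det (g z)) y.
Proof.
apply: (@C1_comp1 _ _ O (fun z => \det (g z)) Num.sqrt (fun t => (2 * Num.sqrt t)^-1)) => //.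
- exact: C1_det.
- by move=> _ [y Oy <-]; apply: is_derive_sqrtr; exact: det_gt0.
- move=> _ [y Oy <-].
  apply: (@continuous_comp _ _ _ (fun t => 2 * Num.sqrt t) (fun t => t^-1)).
    by apply: ctsZ; exact: sqrt_continuous.
  by apply: inv_continuous; rewrite mulf_neq0 // gt_eqF // sqrtr_gt0 det_gt0.
Qed.

Lemma C1_vol : C1 O (fun z => vol z). Proof. by case: vol_C1_aux. Qed.

Lemma C1_Gam k i j : C1 O (Gam k i j).
Proof.
apply: C1M => //; first exact: C1_cst.
apply: C1_sum => // l; apply: C1M => //; first exact: C1_gi.
by apply: C1B => //; apply: C1D.
Qed.

Lemma C1_gam i : C1 O (gam i).
Proof. by apply: C1_sum => // k; exact: C1_Gam. Qed.

Lemma gC y i j : O y -> g y i j = g y j i.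
Proof. by move=> Oy; rewrite -[in LHS](gsym Oy) mxE. Qed.

Lemma dgC y i j k : O y -> pd k (fun z => g z i j) y = pd k (fun z => g z j i) y.
Proof. by move=> Oy; apply: (pd_eq k oO) => // z; rewrite inE => /gC. Qed.

Lemma Gam_sym k i j y : O y -> Gam k i j y = Gam k j i y.
Proof.
move=> Oy; rewrite /Gam; congr (_ * _); apply: eq_bigr => l _; congr (_ * _).
by rewrite [pd l _ _]dgC // [X in X - _]addrC.
Qed.

Lemma Gam_low p i j y : O y -> \sum_l g y p l * Gam l i j y =
  2^-1 * (pd i (fun z => g z j p) y + pd j (fun z => g z i p) y - pd p (fun z => g z i j) y).
Proof.
move=> Oy; pose D l := pd i (fun z => g z j l) y + pd j (fun z => g z i l) y - pd l (fun z => g z i j) y.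
transitivity (2^-1 * \sum_q (g y *m gi y) p q * D q).
  rewrite mulr_sumr; under [RHS]eq_bigr do rewrite mxE mulr_suml mulr_sumr.
  rewrite exchange_big /=; apply: eq_bigr => l _.
  rewrite /Gam mulrCA mulr_sumr; rewrite mulr_sumr; apply: eq_bigr => q _.
  by rewrite -/(D q); ring.
rewrite /gi mulmxV ?g_unit //; congr (_ * _).
rewrite (bigD1 p) //= big1 => [|q qp]; first by rewrite mxE eqxx mul1r addr0.
by rewrite mxE eq_sym (negbTE qp) mul0r.
Qed.

Definition Gmx k y : 'M[R]_m := \matrix_(l, i) Gam l k i y.

(** Compatibility of the Levi-Civita connection with the metric, in matrix form: adding two lowered
    Christoffel symbols cancels all but one derivative of [g]. *)
Lemma dg_Gmx k y : O y -> pdmx k g y = (Gmx k y)^T *m g y + g y *m Gmx k y.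
Proof.
move=> Oy; apply/matrixP => i j; rewrite [RHS]mxE.
have -> : ((Gmx k y)^T *m g y) i j = \sum_l g y j l * Gam l k i y.
  by rewrite mxE; apply: eq_bigr => l _; rewrite !mxE mulrC gC.
have -> : (g y *m Gmx k y) i j = \sum_l g y i l * Gam l k j y.
  by rewrite mxE; apply: eq_bigr => l _; rewrite !mxE.
rewrite !Gam_low // mxE [pd k (fun z => g z j i) _]dgC // [pd j _ _]dgC // [pd i (fun z => g z k j) y]dgC //.
by rewrite [pd i (fun z => g z j k) y]dgC // [pd j (fun z => g z i k) y]dgC //; field.
Qed.

Lemma dgi_Gmx k y : O y -> pdmx k gi y = - (gi y *m (Gmx k y)^T + Gmx k y *m gi y).
Proof.
move=> Oy.
have : pdmx k (fun z => gi z *m g z) y = 0.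
  apply/matrixP => i j; rewrite !mxE.
  rewrite (@pd_eq _ _ O _ (fun=> (1%:M : 'M[R]_m) i j)) ?pd_cst //.
  by move=> z; rewrite inE => Oz; rewrite /gi mulVmx // g_unit.
rewrite pdmxM; [|by move=> i j; exact: (C1_derivable (C1_gi i j) k Oy)|by move=> i j; exact: (C1_derivable (C1g i j) k Oy)].
move=> /eqP; rewrite addr_eq0 => /eqP h.
have u := g_unit Oy.
rewrite -[LHS]mulmx1 -(mulmxV u) mulmxA h mulNmx dg_Gmx // -/(gi y); congr (- _).
rewrite -mulmxA mulmxDl -!mulmxA mulmxV // mulmx1 mulmxDr; congr (_ + _).
by rewrite mulmxA /gi mulVmx // mul1mx.
Qed.

(** By Jacobi's formula and [dg_Gmx], the derivative of the determinant is $2\det g$ times the trace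
    of [Gmx k], and that trace is [gam k]. *)
Lemma pd_vol k y : O y -> pd k (fun z => vol z) y = vol y * gam k y.
Proof.
move=> Oy; have [_ ->] := vol_C1_aux; last exact: Oy.
rewrite pd_det; last by move=> i j; exact: (C1_derivable (C1g i j) k Oy).
have u := g_unit Oy; have d0 := det_gt0 Oy.
have -> : \adj (g y) = \det (g y) *: gi y.
  by rewrite /gi /invmx u scalerA mulfV ?scale1r // gt_eqF.
rewrite -scalemxAr mxtraceZ dg_Gmx // mulmxDl mxtraceD -mulmxA mulmxV // mulmx1.
rewrite -mulmxA mxtrace_mulC -mulmxA /gi mulVmx // mulmx1 mxtrace_tr.
have -> : \tr (Gmx k y) = gam k y by apply: eq_bigr => l _; rewrite mxE Gam_sym.
have v0 := vol_gt0 Oy.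
have -> : \det (g y) = vol y ^+ 2 by rewrite sqr_sqrtr // ltW.
by field; rewrite gt_eqF.
Qed.

Section function.
Context (u : V -> R).
Hypothesis C1u : C1 O u.
Hypothesis C1du : forall k, C1 O (pd k u).

Lemma C1_gradv i : C1 O (gradv u i).
Proof. by apply: C1_sum => // j; apply: C1M => //; exact: C1_gi. Qed.

Lemma Hess_sym i j y : O y -> Hess u i j y = Hess u j i y.
Proof.
move=> Oy; rewrite /Hess (clairaut i j oO C1u C1du Oy); congr (_ - _).
by apply: eq_bigr => k _; rewrite Gam_sym.
Qed.

Lemma pd_gi i j l y : O y -> pd i (fun z => gi z j l) y =
  - (\sum_p gi y j p * Gam l i p y + \sum_p Gam j i p y * gi y p l).
Proof.
move=> Oy; have /matrixP /(_ j l) := dgi_Gmx i Oy; rewrite !mxE => ->.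
by congr (- (_ + _)); apply: eq_bigr => p _; rewrite !mxE.
Qed.

(** Raising an index commutes with the covariant derivative: differentiating [gi] produces two
    Christoffel terms, one cancelled by that in [nab], the other completing the Hessian. *)
Lemma nab_gradv i j y : O y -> nab (gradv u) i j y = \sum_l Hess u i l y * gi y l j.
Proof.
move=> Oy; rewrite /nab /gradv pd_sum => [|l]; last first.
  by apply: derivableM; [exact: (C1_derivable (C1_gi j l) i Oy)|exact: (C1_derivable (C1du l) i Oy)].
transitivity (\sum_l (- (\sum_p gi y j p * Gam l i p y * pd l u y)
   - (\sum_p Gam j i p y * (gi y p l * pd l u y)) + gi y j l * pd i (pd l u) y)
   + \sum_k Gam j i k y * \sum_l gi y k l * pd l u y).
  congr (_ + _); apply: eq_bigr => l _; rewrite pdM; last 2 first.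
  - exact: (C1_derivable (C1_gi j l) i Oy).
  - exact: (C1_derivable (C1du l) i Oy).
  rewrite pd_gi // mulNr mulrDl opprD !mulr_suml; congr (_ - _ + _).
  by apply: eq_bigr => p _; rewrite mulrA.
rewrite big_split /= sumrB.
rewrite [X in _ - X + _ + _]exchange_big /=.
under [X in _ - X + _ + _]eq_bigr do rewrite -mulr_sumr.
rewrite addrAC subrK addrC sumrN.
under [X in _ - X]eq_bigr do rewrite -/(index_enum _).
rewrite [X in _ - X]exchange_big /= -sumrB; apply: eq_bigr => l _.
rewrite /Hess mulrBl [pd i (pd l u) y * _]mulrC giC //; congr (_ - _).
by rewrite mulr_suml; apply: eq_bigr => p _; ring.
Qed.

(** Differentiating the density in the divergence produces [gam], the Christoffel part of the trace
    of [nab]. *)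
Lemma lap_nab y : O y -> lap u y = \sum_j nab (gradv u) j j y.
Proof.
move=> Oy; have v0 := vol_gt0 Oy; have vn : vol y != 0 by rewrite gt_eqF.
rewrite /lap.
transitivity (\sum_j (pd j (gradv u j) y + gam j y * gradv u j y)).
  rewrite mulr_sumr; apply: eq_bigr => j _; rewrite pdM; last 2 first.
  - exact: (C1_derivable C1_vol j Oy).
  - exact: (C1_derivable (C1_gradv j) j Oy).
  by rewrite pd_vol //; field.
rewrite /nab !big_split /=; congr (_ + _).
rewrite exchange_big /=; apply: eq_bigr => k _; rewrite -mulr_suml; congr (_ * _).
Qed.

Lemma pd_pair i y : O y -> pd i (pair u u) y = 2 * \sum_j Hess u i j y * gradv u j y.
Proof.
move=> Oy; rewrite /pair pd_sum => [|l]; last first.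
  by apply: derivableM; [exact: (C1_derivable (C1du l) i Oy)|exact: (C1_derivable (C1_gradv l) i Oy)].
transitivity (\sum_l (pd i (pd l u) y * gradv u l y + pd l u y * pd i (gradv u l) y)).
  apply: eq_bigr => l _; rewrite pdM //.
    exact: (C1_derivable (C1du l) i Oy).
  exact: (C1_derivable (C1_gradv l) i Oy).
(* The Christoffel terms subtracted in [Hess] and added in [nab] cancel in the sum, so partial
   derivatives may be replaced by covariant ones. *)
transitivity (\sum_l (Hess u i l y * gradv u l y + pd l u y * nab (gradv u) i l y)).
  rewrite !big_split /= /Hess /nab.
  under [X in _ = X + _]eq_bigr do rewrite mulrBl mulr_suml.
  under [X in _ = _ + X]eq_bigr do rewrite mulrDr mulr_sumr.
  rewrite sumrB big_split /= addrACA -[LHS]addr0; congr (_ + _).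
  apply/esym; rewrite addrC; apply/eqP; rewrite subr_eq0; apply/eqP.
  rewrite exchange_big /=; apply: eq_bigr => k _; apply: eq_bigr => l _; by rewrite mulrCA mulrA mulrAC.
rewrite big_split /= mulr2n mulrDl !mul1r; congr (_ + _).
under eq_bigr do rewrite nab_gradv // mulr_sumr.
rewrite exchange_big /=; apply: eq_bigr => k _; rewrite /gradv mulr_sumr.
by apply: eq_bigr => l _; ring.
Qed.

(** For a gradient field this is the squared norm of the Hessian, written as $\mathrm{tr}(\nabla
    X\,\nabla X)$ because that expression occurs in Bochner's formula. *)
Definition nab2 (X : 'I_m -> V -> R) y := \sum_i \sum_j nab X i j y * nab X j i y.

(** Both constants come from [hess_trace_le]: [m] from comparing a trace with a Frobenius norm, 4
    from squaring $d|du|^2=2\,\mathrm{Hess}\,u(\nabla u,\cdot)$. *)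
Lemma hess_bounds y : O y ->
  [/\ 0 <= nab2 (gradv u) y, lap u y ^+ 2 <= m%:R * nab2 (gradv u) y &
   pair (pair u u) (pair u u) y <= 4 * (nab2 (gradv u) y * pair u u y)].
Proof.
move=> Oy; have [P NP] := gi_factor Oy.
pose S : 'M[R]_m := \matrix_(i, j) Hess u i j y.
have sS : S^T = S by apply/matrixP => i j; rewrite !mxE Hess_sym.
have SN i j : (S *m gi y) i j = nab (gradv u) i j y.
  by rewrite nab_gradv // mxE; apply: eq_bigr => l _; rewrite mxE.
have [h0 h1 h2] := hess_trace_le sS NP.
have T2 : \tr (S *m gi y *m (S *m gi y)) = nab2 (gradv u) y.
  by apply: eq_bigr => i _; rewrite mxE; apply: eq_bigr => j _; rewrite !SN.
have T1 : \tr (S *m gi y) = lap u y.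
  by rewrite lap_nab //; apply: eq_bigr => i _; rewrite SN.
rewrite -T2 -T1; split => //.
pose w : 'rV[R]_m := \row_i pd i u y.
have wX j : (w *m gi y) 0 j = gradv u j y.
  by rewrite mxE; apply: eq_bigr => k _; rewrite mxE mulrC giC.
have pE : pair u u y = (w *m gi y *m w^T) 0 0.
  by rewrite mxE /pair; apply: eq_bigr => i _; rewrite wX !mxE mulrC.
have dE i : pd i (pair u u) y = 2 * (w *m gi y *m S) 0 i.
  rewrite pd_pair // mxE; congr (_ * _); apply: eq_bigr => j _.
  by rewrite wX !mxE mulrC Hess_sym.
have -> : pair (pair u u) (pair u u) y =
    4 * (w *m gi y *m S *m gi y *m (w *m gi y *m S)^T) 0 0.
  rewrite [in RHS]mxE mulr_sumr /pair; apply: eq_bigr => i _.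
  rewrite /gradv -/(pair u u) dE [in RHS]mxE [in X in _ = _ * (_ * X)]mxE.
  rewrite mulr_suml mulr_sumr mulr_sumr; apply: eq_bigr => j _.
  by rewrite -/(pair u u) dE giC //; ring.
by rewrite pE ler_pM2l //; exact: h2.
Qed.

End function.

Section bochner.

(* The pointwise identity behind the weak Bochner formula.  At a given point, [x i], [p i] and
   [f] stand for the components of the field [X], the derivatives of the test function [phi]
   and its value, [d i j] for the derivative of [X^j] in the direction [i], and [dG] for the
   derivatives of the Christoffel symbols [G].  On the right, the first sum is a
   null Lagrangian and the second one a divergence, up to the volume density. *)
Lemma bochner_algebra (x p ga : 'I_m -> R) (d : 'I_m -> 'I_m -> R)
    (G : 'I_m -> 'I_m -> 'I_m -> R) (dG : 'I_m -> 'I_m -> 'I_m -> 'I_m -> R) (f : R) :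
  (forall k i j, G k i j = G k j i) ->
  (forall i, ga i = \sum_k G k k i) ->
  let A i j := d i j + \sum_k G j i k * x k in
  let ric j k := \sum_i (dG i i j k - dG j i i k +
                   \sum_q (G i i q * G q j k - G i j q * G q i k)) in
  let Y j := \sum_i \sum_k G j i k * (x i * x k) - (\sum_i ga i * x i) * x j in
  let dY j := \sum_i \sum_k (dG j j i k * (x i * x k) + G j i k * (d j i * x k + x i * d j k))
      - ((\sum_i ((\sum_k dG j k k i) * x i + ga i * d j i)) * x j + (\sum_i ga i * x i) * d j j) in
  f * (\sum_i \sum_j A i j * A j i + \sum_j \sum_k ric j k * (x j * x k) - (\sum_j A j j) ^+ 2)
  + \sum_i p i * (\sum_j x j * A j i - x i * \sum_j A j j) =
  \sum_i \sum_j (((p i + f * ga i) * x j + f * d i j) * d j i -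
                 ((p j + f * ga j) * x j + f * d j j) * d i i)
  + \sum_j ((p j + f * ga j) * Y j + f * dY j).
Proof.
move=> Gs gaE A ric Y dY.
(* [N] is the Christoffel part of [A]. Reindexing expresses all terms through finitely many scalar
   sums, and the claim becomes a polynomial identity between these. *)
pose N i j := \sum_k G j i k * x k.
pose s := \sum_j d j j; pose t := \sum_i ga i * x i.
have tN : \sum_j N j j = t.
  by rewrite /N exchange_big /=; apply: eq_bigr => k _; rewrite gaE mulr_suml.
have DE : \sum_j A j j = s + t by rewrite big_split /= -/(N _ _) tN.
have YE j : Y j = \sum_i x i * N i j - t * x j.
  rewrite /Y -/t; congr (_ - _); apply: eq_bigr => i _; rewrite /N mulr_sumr.
  by apply: eq_bigr => k _; ring.
pose dd := \sum_i \sum_j d i j * d j i.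
pose dN := \sum_i \sum_j d i j * N j i.
pose NN := \sum_i \sum_j N i j * N j i.
have AA : \sum_i \sum_j A i j * A j i = dd + 2 * dN + NN.
  have -> : 2 * dN = dN + \sum_i \sum_j N i j * d j i.
    rewrite mulr2n mulrDl mul1r; congr (_ + _); rewrite /dN exchange_big /=.
    by apply: eq_bigr => i _; apply: eq_bigr => j _; rewrite mulrC.
  rewrite /dd /dN /NN -!big_split /=; apply: eq_bigr => i _.
  rewrite -!big_split /=; apply: eq_bigr => j _.
  by rewrite /A -/(N i j) -/(N j i); ring.
pose gN := \sum_j ga j * \sum_i x i * N i j.
pose DG := \sum_j \sum_i \sum_k dG j j i k * (x i * x k).
pose Dg := \sum_j \sum_i (\sum_k dG j k k i) * (x i * x j).
(* The first quadratic curvature term contracts to [ga] and gives [gN]; symmetry of [G] in its lower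
   indices turns the second into [NN]. *)
have ricE : \sum_j \sum_k ric j k * (x j * x k) = DG - Dg + gN - NN.
  have -> : DG = \sum_j \sum_k (\sum_i dG i i j k) * (x j * x k).
    rewrite /DG exchange_big /=; apply: eq_bigr => j _; rewrite exchange_big /=.
    by apply: eq_bigr => k _; rewrite mulr_suml.
  have -> : Dg = \sum_j \sum_k (\sum_i dG j i i k) * (x j * x k).
    by apply: eq_bigr => j _; apply: eq_bigr => k _; rewrite [x k * x j]mulrC.
  have -> : gN = \sum_j \sum_k (\sum_i \sum_q G i i q * G q j k) * (x j * x k).
    rewrite /gN; under eq_bigr do rewrite gaE mulr_suml.
    under [RHS]eq_bigr do under eq_bigr do rewrite exchange_big /= mulr_suml.
    under [RHS]eq_bigr do rewrite exchange_big /=.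
    rewrite [RHS]exchange_big /=; apply: eq_bigr => q _.
    under [RHS]eq_bigr do under eq_bigr do rewrite mulr_suml.
    under [RHS]eq_bigr do rewrite exchange_big /=.
    rewrite [RHS]exchange_big /=; apply: eq_bigr => i _.
    rewrite mulr_sumr; apply: eq_bigr => j _; rewrite /N !mulr_sumr.
    by apply: eq_bigr => k _; ring.
  have -> : NN = \sum_j \sum_k (\sum_i \sum_q G i j q * G q i k) * (x j * x k).
    have -> : NN = \sum_i \sum_q \sum_j \sum_k G i j q * G q i k * (x j * x k).
      rewrite /NN exchange_big /=; apply: eq_bigr => i _; apply: eq_bigr => q _.
      rewrite /N mulr_suml; apply: eq_bigr => j _; rewrite mulr_sumr.
      by apply: eq_bigr => k _; rewrite (Gs i j q); ring.
    under [LHS]eq_bigr do rewrite exchange_big /=.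
    rewrite exchange_big /=; apply: eq_bigr => j _.
    under [LHS]eq_bigr do rewrite exchange_big /=.
    rewrite exchange_big /=; apply: eq_bigr => k _.
    by rewrite mulr_suml; apply: eq_bigr => i _; rewrite mulr_suml.
  rewrite -!sumrN -!big_split /=; apply: eq_bigr => j _.
  rewrite -!sumrN -!big_split /=; apply: eq_bigr => k _.
  have -> : ric j k = \sum_i dG i i j k - \sum_i dG j i i k
      + \sum_i \sum_q G i i q * G q j k - \sum_i \sum_q G i j q * G q i k.
    rewrite /ric -!sumrB -big_split -sumrB /=; apply: eq_bigr => i _.
    by rewrite sumrB; ring.
  by ring.
pose gd := \sum_i \sum_j ga i * (x j * d j i).
have dYE : \sum_j dY j = DG + 2 * dN - Dg - gd - t * s.
  rewrite /dY sumrB; under [X in X - _]eq_bigr do under eq_bigr do rewrite big_split /=.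
  under [X in X - _]eq_bigr do rewrite big_split /=.
  rewrite big_split /= -/DG big_split /=; under [X in _ - (X + _)]eq_bigr do rewrite big_split /= mulrDl !mulr_suml.
  rewrite [X in _ - (X + _)]big_split /=.
  have -> : \sum_i \sum_i0 (\sum_k dG i k k i0) * x i0 * x i = Dg.
    by apply: eq_bigr => j _; apply: eq_bigr => i _; rewrite mulrA.
  have -> : \sum_i \sum_i0 ga i0 * d i i0 * x i = gd.
    by rewrite /gd exchange_big /=; apply: eq_bigr => i _; apply: eq_bigr => j _; ring.
  rewrite -/t -mulr_sumr -/s.
  have -> : \sum_i \sum_i0 \sum_k G i i0 k * (d i i0 * x k + x i0 * d i k) = 2 * dN.
    have -> : 2 * dN = dN + dN by ring.
    rewrite /dN -big_split /=; apply: eq_bigr => j _.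
    have E : \sum_i \sum_k G j i k * (x i * d j k) = \sum_i d j i * N i j.
      rewrite exchange_big /=; apply: eq_bigr => k _; rewrite /N mulr_sumr.
      by apply: eq_bigr => i _; rewrite Gs; ring.
    rewrite -[X in _ = _ + X]E -big_split /=; apply: eq_bigr => i _.
    rewrite /N mulr_sumr -big_split /=; apply: eq_bigr => k _; ring.
  by ring.
pose pxd := \sum_i p i * \sum_j x j * d j i.
pose pxN := \sum_i p i * \sum_j x j * N j i.
pose px := \sum_i p i * x i.
have L2 : \sum_i p i * (\sum_j x j * A j i - x i * \sum_j A j j) = pxd + pxN - px * (s + t).
  rewrite /pxd /pxN /px mulr_suml -big_split -sumrB /=; apply: eq_bigr => i _.
  rewrite DE -mulrDr mulrBr mulrA; congr (_ * _ - _).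
  by rewrite -big_split /=; apply: eq_bigr => j _; rewrite -mulrDr.
have R1 : \sum_i \sum_j (((p i + f * ga i) * x j + f * d i j) * d j i -
                 ((p j + f * ga j) * x j + f * d j j) * d i i) =
   pxd + f * gd + f * dd - (px + f * t + f * s) * s.
  have -> : f * gd = \sum_i f * (ga i * \sum_j x j * d j i).
    rewrite /gd mulr_sumr; apply: eq_bigr => i _; congr (_ * _); rewrite mulr_sumr.
    by apply: eq_bigr.
  have -> : f * dd = \sum_i f * \sum_j d i j * d j i by rewrite mulr_sumr.
  have -> : (px + f * t + f * s) * s = \sum_i (px + f * t + f * s) * d i i by rewrite mulr_sumr.
  rewrite /pxd -!big_split -sumrB /=; apply: eq_bigr => i _.
  rewrite sumrB; congr (_ - _).
    rewrite !mulr_sumr -!big_split /=; apply: eq_bigr => j _; ring.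
  rewrite -mulr_suml; congr (_ * _); rewrite /px /t /s !mulr_sumr -!big_split /=.
  by apply: eq_bigr => j _; ring.
have R2 : \sum_j ((p j + f * ga j) * Y j + f * dY j) =
   pxN - px * t + f * gN - f * t ^+ 2 + f * \sum_j dY j.
  rewrite big_split /= -mulr_sumr; congr (_ + _).
  have -> : f * gN = \sum_j f * (ga j * \sum_i x i * N i j) by rewrite mulr_sumr.
  have -> : f * t ^+ 2 = \sum_j f * t * (ga j * x j) by rewrite -mulr_sumr -/t; ring.
  have -> : px * t = \sum_j t * (p j * x j) by rewrite -mulr_sumr mulrC.
  rewrite /pxN -sumrB -big_split -sumrB /=; apply: eq_bigr => j _.
  by rewrite YE; ring.
rewrite R1 R2 L2 AA ricE DE dYE; ring.
Qed.

End bochner.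
End chart.

Arguments C1_pd_cts {R m f} j _.
Section integrals.
Context d (T : measurableType d) {R : realType} (mu : {measure set T -> \bar R}).
Implicit Types f g : T -> R.
Local Notation intg f := (mu.-integrable setT (EFin \o f)).

Lemma integrable_EFin_sum (I : Type) (r : seq I) (F : I -> T -> R) :
  (forall i, intg (F i)) -> intg (fun y => \sum_(i <- r) F i y).
Proof.
move=> h; elim: r => [|i r IH].
  under [X in mu.-integrable _ X]eq_fun do rewrite /= big_nil; exact: integrable0.
under [X in mu.-integrable _ X]eq_fun do rewrite /= big_cons.
exact: (integrable_EFinD (h i) IH).
Qed.

Lemma Rintegral_fsum (I : Type) (r : seq I) (F : I -> T -> R) :
  (forall i, intg (F i)) ->
  (\int[mu]_y (\sum_(i <- r) F i y) = \sum_(i <- r) \int[mu]_y F i y)%R.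
Proof.
move=> h; elim: r => [|i r IH].
  rewrite big_nil; under eq_Rintegral do rewrite big_nil.
  by rewrite /Rintegral integral0.
rewrite big_cons -IH; under eq_Rintegral do rewrite big_cons.
exact: (RintegralD measurableT (h i) (integrable_EFin_sum r h)).
Qed.
End integrals.

(** * The weak Bochner formula *)

Section chart_integrals.
Context {R : realType} {m : nat}.
Local Notation V := 'rV[R]_m.
Local Notation nu := (@nu R m).
Context (O : set V) (oO : open O) (g : V -> 'M[R]_m).
Hypothesis C1g : forall i j, C1 O (fun z => g z i j).
Hypothesis C1dg : forall i j k, C1 O (pd k (fun z => g z i j)).
Hypothesis gsym : forall y, O y -> (g y)^T = g y.
Hypothesis gpos : forall y, O y -> posdef (g y).
Implicit Types (y z : V) (i j k l : 'I_m).

Lemma integral_divergence (F : 'I_m -> V -> R) : (forall j, C1 setT (F j)) ->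
  (forall j, bdsupp (F j)) -> (\int[nu]_y \sum_j pd j (F j) y)%R = 0.
Proof.
move=> hF bF; rewrite Rintegral_fsum => [|j].
  by rewrite big1 // => j _; exact: integral_pd.
exact: (cc_integrable (C1_pd_cts j (hF j)) (pd_bdsupp j (bF j))).
Qed.

Lemma integral_null_lagrangian (F H : 'I_m -> V -> R) :
  (forall j, C1 setT (F j)) -> (forall j, C1 setT (H j)) ->
  (forall j, bdsupp (F j)) -> (forall j, bdsupp (H j)) ->
  (\int[nu]_y \sum_i \sum_j (pd i (F j) y * pd j (H i) y - pd j (F j) y * pd i (H i) y))%R = 0.
Proof.
move=> hF hH bF bH.
have ii i j k l : nu.-integrable setT (EFin \o (fun y => pd i (F j) y * pd k (H l) y)).
  apply: cc_integrable; last exact: (bdsuppMl _ (pd_bdsupp i (bF j))).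
  by move=> y; apply: ctsM; [exact: (C1_pd_cts i (hF j))|exact: (C1_pd_cts k (hH l))].
have iB i j := integrable_EFinB (ii i j j i) (ii j j i i).
rewrite Rintegral_fsum => [|i]; last exact: (integrable_EFin_sum _ (iB i)).
rewrite big1 // => i _; rewrite (Rintegral_fsum _ (iB i)) big1 // => j _.
rewrite (RintegralB measurableT (ii i j j i) (ii j j i i)).
by rewrite (null_lagrangian i j (hF j) (hH i) (bF j) (bH i)) subrr.
Qed.

(** The integrand is the coordinate divergence of $h\,\mathrm{vol}\,\nabla u$, a $C^1$ field
    extended by zero outside [K]. *)
Lemma weak_laplacian (u h : V -> R) (K : set V) :
  (forall k, C1 O (pd k u)) -> C1 O h -> compact K -> K `<=` O ->
  (forall z, ~ K z -> h z = 0) ->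
  (\int[nu]_y (vol g y * (h y * lap g u y + \sum_i pd i h y * gradv g u i y)))%R = 0.
Proof.
move=> hdu hh cK KO h0.
have cl : closed K by apply: compact_closed => //; exact: norm_hausdorff.
pose F j y := h y * (vol g y * gradv g u j y).
have C1w j : C1 O (fun y => vol g y * gradv g u j y).
  by apply: C1M => //; [exact: C1_vol|exact: C1_gradv].
have F0 j z : ~ K z -> F j z = 0 by move=> /h0 E; rewrite /F E mul0r.
have hF j : C1 setT (F j).
  by apply: (@C1_ext _ _ O K) => //; [exact: F0|exact: C1M].
transitivity (\int[nu]_y \sum_j pd j (F j) y)%R; last first.
  by apply: integral_divergence => // j; exact: (bdsupp_compact cK (F0 j)).
apply: eq_Rintegral => y _; have [Ky|Ky] := pselect (K y); last first.
  have E1 : \sum_i pd i h y * gradv g u i y = 0.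
    by apply: big1 => i _; rewrite (pd_supp i cl h0 Ky) mul0r.
  have E2 : \sum_j pd j (F j) y = 0 by apply: big1 => i _; exact: (pd_supp i cl (F0 i) Ky).
  by rewrite E1 E2 (h0 _ Ky) mul0r add0r mulr0.
have Oy := KO _ Ky; have v0 : vol g y != 0 by rewrite gt_eqF // (vol_gt0 gsym gpos).
have E : vol g y * lap g u y = \sum_j pd j (fun z => vol g z * gradv g u j z) y.
  by rewrite /lap; field.
rewrite mulrDr mulrCA E mulr_sumr mulr_sumr -big_split /=; apply: eq_bigr => j _.
rewrite [RHS](pdM (C1_derivable hh j Oy) (C1_derivable (C1w j) j Oy)).
by rewrite [RHS]addrC; congr (_ + _); ring.
Qed.

(** The entries of [ricci] unfolded, so that a bound given by [ricci_ge] applies by conversion. *)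
Definition Ric j k y : R := \sum_i (pd i (Gam g i j k) y - pd j (Gam g i i k) y +
  \sum_q (Gam g i i q y * Gam g q j k y - Gam g i j q y * Gam g q i k y)).

(* Only first derivatives of [X] occur: the curvature comes from those of the Christoffel
   symbols.  Hence [X] may be the gradient of a function which is merely C^2. *)
Lemma weak_bochner (X : 'I_m -> V -> R) (phi eta : V -> R) (K K' W : set V) :
  (forall i, C1 O (X i)) -> C1 O phi -> closed K -> K `<=` W -> open W ->
  (forall z, ~ K z -> phi z = 0) -> C1 O eta -> compact K' -> K' `<=` O ->
  (forall z, ~ K' z -> eta z = 0) -> (forall z, W z -> eta z = 1) ->
  (\int[nu]_y (vol g y * (phi y * (nab2 g X y + \sum_j \sum_k Ric j k y * (X j y * X k y)
      - (\sum_j nab g X j j y) ^+ 2)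
    + \sum_i pd i phi y * (\sum_j X j y * nab g X j i y - X i y * \sum_j nab g X j j y))))%R = 0.
Proof.
move=> hX hphi cK KW oW phi0 heta cK' KO' eta0 eta1.
have cl' : closed K' by apply: compact_closed => //; exact: norm_hausdorff.
have WK' : W `<=` K'.
  move=> z Wz; apply: contrapT => /eta0; rewrite eta1 // => /eqP; by rewrite oner_eq0.
have KO : K `<=` O by move=> z /KW /WK' /KO'.
pose psi y := phi y * vol g y.
have hpsi : C1 O psi by apply: C1M => //; exact: C1_vol.
pose F j y := psi y * X j y.
(* The null Lagrangian identity asks both fields to be global and compactly supported. As [eta] is 1
   on the open set [W] around [K], the truncation leaves the derivatives of [X] unchanged where [F]
   lives. *)
pose H j y := eta y * X j y.
pose Y j y := \sum_i \sum_k Gam g j i k y * (X i y * X k y) - (\sum_i gam g i y * X i y) * X j y.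
pose Z j y := psi y * Y j y.
have XM i j : C1 O (fun y => X i y * X j y) by exact: C1M.
have GX j i k : C1 O (fun y => Gam g j i k y * (X i y * X k y)).
  by apply: C1M => //; exact: C1_Gam.
have gX i : C1 O (fun y => gam g i y * X i y) by apply: C1M => //; exact: C1_gam.
have SG j : C1 O (fun y => \sum_i \sum_k Gam g j i k y * (X i y * X k y)).
  by apply: C1_sum => // i; apply: C1_sum => // k; exact: GX.
have Sg : C1 O (fun y => \sum_i gam g i y * X i y) by exact: C1_sum.
have Sgx j : C1 O (fun y => (\sum_i gam g i y * X i y) * X j y) by exact: C1M.
have hY j : C1 O (Y j) by exact: C1B.
have cpK : compact K by apply: (subclosed_compact cK cK') => z /KW /WK'.
have F0 j z : ~ K z -> F j z = 0 by move=> /phi0 E; rewrite /F /psi E !mul0r.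
have Z0 j z : ~ K z -> Z j z = 0 by move=> /phi0 E; rewrite /Z /psi E !mul0r.
have H0 j z : ~ K' z -> H j z = 0 by move=> /eta0 E; rewrite /H E !mul0r.
have hF j : C1 setT (F j) by apply: (@C1_ext _ _ O K) => //; [exact: F0|exact: C1M].
have hZ j : C1 setT (Z j) by apply: (@C1_ext _ _ O K) => //; [exact: Z0|exact: C1M].
have hH j : C1 setT (H j) by apply: (@C1_ext _ _ O K') => //; [exact: H0|exact: C1M].
have bF j := bdsupp_compact cpK (F0 j).
have bZ j := bdsupp_compact cpK (Z0 j).
have bH j := bdsupp_compact cK' (H0 j).
pose N y := \sum_i \sum_j (pd i (F j) y * pd j (H i) y - pd j (F j) y * pd i (H i) y).
pose D y := \sum_j pd j (Z j) y.
have IN : (\int[nu]_y N y)%R = 0 by exact: integral_null_lagrangian.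
have ID : (\int[nu]_y D y)%R = 0 by exact: integral_divergence.
have intD : nu.-integrable setT (EFin \o D).
  apply: integrable_EFin_sum => j.
  exact: (cc_integrable (C1_pd_cts j (hZ j)) (pd_bdsupp j (bZ j))).
have intN : nu.-integrable setT (EFin \o N).
  have ii i j k l : nu.-integrable setT (EFin \o (fun y => pd i (F j) y * pd k (H l) y)).
    apply: cc_integrable; last exact: (bdsuppMl _ (pd_bdsupp i (bF j))).
    by move=> y; apply: ctsM; [exact: (C1_pd_cts i (hF j))|exact: (C1_pd_cts k (hH l))].
  apply: integrable_EFin_sum => i; apply: integrable_EFin_sum => j.
  exact: (integrable_EFinB (ii i j j i) (ii j j i i)).
transitivity (\int[nu]_y (N y + D y))%R; last first.
  by rewrite (RintegralD measurableT intN intD) IN ID addr0.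
apply: eq_Rintegral => y _; have [Ky|Ky] := pselect (K y); last first.
  have -> : N y = 0.
    apply: big1 => i _; apply: big1 => j _.
    by rewrite !(pd_supp _ cK (F0 j) Ky) !mul0r subrr.
  have -> : D y = 0 by apply: big1 => j _; exact: (pd_supp _ cK (Z0 j) Ky).
  rewrite (phi0 _ Ky) mul0r addr0 add0r [X in _ * X]big1 ?mulr0 // => i _.
  by rewrite (pd_supp i cK phi0 Ky) mul0r.
have Oy := KO _ Ky; have Wy := KW _ Ky.
have dH i j : pd i (H j) y = pd i (X j) y.
  by apply: (pd_eq i oW) => // z; rewrite inE => Wz; rewrite /H eta1 // mul1r.
have dpsi i : pd i psi y = vol g y * (pd i phi y + phi y * gam g i y).
  rewrite pdM; [|exact: (C1_derivable hphi i Oy)|exact: (C1_derivable (C1_vol oO C1g gsym gpos) i Oy)].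
  by rewrite (pd_vol oO C1g gsym gpos) //; ring.
have dF i j : pd i (F j) y = vol g y * ((pd i phi y + phi y * gam g i y) * X j y + phi y * pd i (X j) y).
  rewrite pdM; [|exact: (C1_derivable hpsi i Oy)|exact: (C1_derivable (hX j) i Oy)].
  by rewrite dpsi /psi; ring.
have dX i j k : pd k (fun y => X i y * X j y) y = pd k (X i) y * X j y + X i y * pd k (X j) y.
  by rewrite pdM //; [exact: (C1_derivable (hX i) k Oy)|exact: (C1_derivable (hX j) k Oy)].
have dY j : pd j (Y j) y =
    \sum_i \sum_k (pd j (Gam g j i k) y * (X i y * X k y) +
       Gam g j i k y * (pd j (X i) y * X k y + X i y * pd j (X k) y))
   - ((\sum_i ((\sum_k pd j (Gam g k k i) y) * X i y + gam g i y * pd j (X i) y)) * X j y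
     + (\sum_i gam g i y * X i y) * pd j (X j) y).
  rewrite pdB; [|exact: (C1_derivable (SG j) j Oy)|exact: (C1_derivable (Sgx j) j Oy)].
  rewrite pdM; [|exact: (C1_derivable Sg j Oy)|exact: (C1_derivable (hX j) j Oy)].
  congr (_ - (_ * _ + _)).
    rewrite pd_sum => [|i]; last first.
      by apply: derivable_fsum => k; exact: (C1_derivable (GX j i k) j Oy).
    apply: eq_bigr => i _; rewrite pd_sum => [|k]; last exact: (C1_derivable (GX j i k) j Oy).
    apply: eq_bigr => k _; rewrite pdM; [by rewrite dX| |exact: (C1_derivable (XM i k) j Oy)].
    exact: (C1_derivable (C1_Gam oO C1g C1dg gpos j i k) j Oy).
  rewrite pd_sum => [|i]; last exact: (C1_derivable (gX i) j Oy).
  apply: eq_bigr => i _; rewrite pdM; last 2 first.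
  - exact: (C1_derivable (C1_gam oO C1g C1dg gpos i) j Oy).
  - exact: (C1_derivable (hX i) j Oy).
  congr (_ * _ + _); rewrite pd_sum // => k.
  exact: (C1_derivable (C1_Gam oO C1g C1dg gpos k k i) j Oy).
have dZ j : pd j (Z j) y = vol g y * ((pd j phi y + phi y * gam g j y) * Y j y + phi y * pd j (Y j) y).
  rewrite pdM; [|exact: (C1_derivable hpsi j Oy)|exact: (C1_derivable (hY j) j Oy)].
  by rewrite dpsi /psi; ring.
have B := @bochner_algebra R m (fun i => X i y) (fun i => pd i phi y) (fun i => gam g i y)
  (fun i j => pd i (X j) y) (fun k i j => Gam g k i j y) (fun a k i j => pd a (Gam g k i j) y) (phi y)
  (fun k i j => Gam_sym oO gsym k i j Oy) (fun i => erefl).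
transitivity (vol g y * (\sum_i \sum_j
   (((pd i phi y + phi y * gam g i y) * X j y + phi y * pd i (X j) y) * pd j (X i) y
   - ((pd j phi y + phi y * gam g j y) * X j y + phi y * pd j (X j) y) * pd i (X i) y)
  + \sum_j ((pd j phi y + phi y * gam g j y) * Y j y + phi y * pd j (Y j) y))); last first.
  rewrite mulrDr !mulr_sumr; congr (_ + _); last by apply: eq_bigr => j _; rewrite dZ.
  apply: eq_bigr => i _; rewrite mulr_sumr; apply: eq_bigr => j _.
  by rewrite !dF !dH mulrBr; congr (_ - _); exact: mulrA.
congr (_ * _); have -> : \sum_j ((pd j phi y + phi y * gam g j y) * Y j y + phi y * pd j (Y j) y) =
  \sum_j ((pd j phi y + phi y * gam g j y) * Y j y + phi y * (\sum_i \sum_k (pd j (Gam g j i k) y * (X i y * X k y) +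
       Gam g j i k y * (pd j (X i) y * X k y + X i y * pd j (X k) y))
   - ((\sum_i ((\sum_k pd j (Gam g k k i) y) * X i y + gam g i y * pd j (X i) y)) * X j y
     + (\sum_i gam g i y * X i y) * pd j (X j) y))).
  by apply: eq_bigr => j _; rewrite dY.
exact: B.
Qed.
End chart_integrals.

(** * Charts and the pairing of differentials *)

Section manifold.
Context {R : realType} {m : nat} {M : ptopologicalType} (G : riemannian R m M).
Local Notation V := 'rV[R]_m.
Local Notation nu := (@nu R m).
Implicit Types (a b : chart G) (x : M) (y z : V) (i j k l : 'I_m).

Lemma range_open a : open (chart_range a).
Proof. exact: chart_map_open. Qed.
Arguments range_open : clear implicits.

Lemma C1_metric a i j : C1 (chart_range a) (fun z => metric_mx a z i j).
Proof. by have [] := C1_Ck2 (@metric_mx_smooth _ _ _ G a i j 2). Qed.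

Lemma C1_dmetric a i j k : C1 (chart_range a) (pd k (fun z => metric_mx a z i j)).
Proof. by have [] := C1_Ck2 (@metric_mx_smooth _ _ _ G a i j 2). Qed.

Lemma posdef_metric a y : chart_range a y -> posdef (metric_mx a y).
Proof. by move=> ry v v0; exact: metric_mx_pos. Qed.

Lemma range_map a x : chart_dom a x -> chart_range a (chart_map a x).
Proof. by exists x. Qed.

Lemma inv_dom a y : chart_range a y -> chart_dom a (chart_inv a y).
Proof. by move=> [x dx <-]; rewrite chart_mapK. Qed.

Lemma chart_invK a y : chart_range a y -> chart_map a (chart_inv a y) = y.
Proof. by move=> [x dx <-]; rewrite chart_mapK. Qed.

Definition overlap a b : set V := chart_map a @` (chart_dom a `&` chart_dom b).

Lemma overlapE a b y : overlap a b y <-> chart_range a y /\ chart_dom b (chart_inv a y).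
Proof.
split=> [[x [ax bx] <-]|[ry by_]]; first by rewrite chart_mapK //; split => //; exists x.
by exists (chart_inv a y); [split => //; exact: inv_dom|exact: chart_invK].
Qed.

Lemma open_chart_preim a (U : set M) : open U -> open [set y | chart_range a y /\ U (chart_inv a y)].
Proof.
move=> oU; rewrite openE => y [ry Uy]; rewrite /interior.
apply: filterI; first exact: (open_nbhs_nbhs (conj (range_open a) ry)).
have c := @chart_inv_continuous _ _ _ G a y ry.
exact: (c _ (open_nbhs_nbhs (conj oU Uy))).
Qed.

Lemma overlap_open a b : open (overlap a b).
Proof.
have -> : overlap a b = [set y | chart_range a y /\ chart_dom b (chart_inv a y)].
  by apply/seteqP; split=> y /overlapE.
by apply: open_chart_preim; exact: chart_dom_open.
Qed.
Arguments overlap_open : clear implicits.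

Lemma open_dom_preim a (O : set V) : open O -> open [set x | chart_dom a x /\ O (chart_map a x)].
Proof.
move=> oO; rewrite openE => x [dx Ox]; rewrite /interior.
apply: filterI; first exact: (open_nbhs_nbhs (conj (chart_dom_open a) dx)).
have c := @chart_map_continuous _ _ _ G a x dx.
exact: (c _ (open_nbhs_nbhs (conj oO Ox))).
Qed.

Definition transition a b y : V := chart_map b (chart_inv a y).

Lemma trans_range a b y : overlap a b y -> chart_range b (transition a b y).
Proof. by move=> /overlapE[ry dy]; exact: range_map. Qed.

Lemma C1_trans a b k : C1 (overlap a b) (fun y => transition a b y 0 k).
Proof. by have [] := C1_Ck2 (@transition_smooth _ _ _ G a b k 2). Qed.

Definition jac a b y : 'M[R]_m := \matrix_(i, k) pd i (fun z => transition a b z 0 k) y.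

Lemma C1_change a b (f : V -> R) : C1 (chart_range b) f ->
  C1 (overlap a b) (fun y => f (transition a b y)) /\
  forall y j, overlap a b y -> pd j (fun y => f (transition a b y)) y =
    \sum_k jac a b y j k * pd k f (transition a b y).
Proof.
move=> hf; have [h1 h2] := @C1_comp _ _ _ _ f (transition a b) (overlap_open a b) (range_open b)
  (@trans_range a b) (C1_trans a b) hf.
by split => // y j oy; rewrite h2 //; apply: eq_bigr => k _; rewrite mxE.
Qed.

Definition lift_fun a (F : V -> R) (x : M) : R :=
  if `[< chart_dom a x >] then F (chart_map a x) else 0.

Lemma lift_funE a F x : chart_dom a x -> lift_fun a F x = F (chart_map a x).
Proof. by move=> dx; rewrite /lift_fun; case: asboolP. Qed.

Lemma lift_fun_inv a F y : chart_range a y -> lift_fun a F (chart_inv a y) = F y.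
Proof. by move=> ry; rewrite lift_funE ?chart_invK //; exact: inv_dom. Qed.

Lemma lift_fun0 a F x (K : set V) : (forall z, ~ K z -> F z = 0) ->
  ~ (chart_inv a @` K) x -> lift_fun a F x = 0.
Proof.
move=> F0 Kx; rewrite /lift_fun; case: asboolP => // dx; apply: F0 => Kz.
by apply: Kx; exists (chart_map a x); rewrite ?chart_mapK.
Qed.

Lemma compact_inv a (K : set V) : compact K -> K `<=` chart_range a ->
  compact (chart_inv a @` K) /\ chart_inv a @` K `<=` chart_dom a.
Proof.
move=> cK KO; split; last by move=> _ [z /KO rz <-]; exact: inv_dom.
apply: continuous_compact => //; apply: continuous_in_subspaceT => z.
by rewrite inE => /KO rz; exact: chart_inv_continuous.
Qed.

Lemma compact_closedM (K : set M) : compact K -> closed K.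
Proof. by move=> cK; apply: compact_closed => //; exact: (manifold_hausdorff G). Qed.

Definition fC1 (f : M -> R) := forall a, C1 (chart_range a) (fun y => f (chart_inv a y)).

Lemma C1_local (O : set V) (f : V -> R) : (forall y, O y -> exists U : set V,
  [/\ open U, U y & C1 U f]) -> C1 O f.
Proof.
move=> h; split=> [y Oy|y j Oy|y j Oy]; case: (h y Oy) => U [oU Uy hf].
- exact: (C1_continuous hf Uy).
- exact: (C1_derivable hf j Uy).
- exact: (C1_pd_continuous hf j Uy).
Qed.

(** Since the manifold is Hausdorff, the image of [K] is closed. A point of another chart lies
    either over [chart_dom a], where the chain rule for transitions applies, or in an open set where
    the lift vanishes. *)
Lemma fC1_lift a (F : V -> R) (K : set V) : compact K -> K `<=` chart_range a ->
  (forall z, ~ K z -> F z = 0) -> C1 (chart_range a) F -> fC1 (lift_fun a F).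
Proof.
move=> cK KO F0 hF b; have [cK' K'O] := compact_inv cK KO.
have cl := compact_closedM cK'.
apply: C1_local => y ry.
have [dy|dy] := pselect (chart_dom a (chart_inv b y)).
  exists (overlap b a); split; [exact: overlap_open|exact/overlapE|].
  apply: (C1_eq _ _ (proj1 (C1_change b hF))); first exact: overlap_open.
  by move=> z; rewrite inE => /overlapE[rz dz]; rewrite lift_funE.
exists [set z | chart_range b z /\ (~` (chart_inv a @` K)) (chart_inv b z)]; split.
- by apply: open_chart_preim; exact: closed_openC.
- by split => // /K'O.
- apply: (@C1_eq _ _ _ (fun=> 0)) => [|z|]; last exact: C1_cst.
    by apply: open_chart_preim; exact: closed_openC.
  by rewrite inE => -[_ Kz]; rewrite (lift_fun0 F0).
Qed.

Lemma continuous_chart (f : M -> R) a x : chart_dom a x ->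
  {for chart_map a x, continuous (fun y => f (chart_inv a y))} -> {for x, continuous f}.
Proof.
move=> dx cf; apply: (@near_continuous _ _ (fun x => f (chart_inv a (chart_map a x)))).
  apply: filterS (open_nbhs_nbhs (conj (chart_dom_open a) dx)) => z dz.
  by rewrite chart_mapK.
apply: (cts_comp (g := chart_map a) (f := fun y => f (chart_inv a y))) => //.
exact: chart_map_continuous.
Qed.

Lemma fC1_continuous f : fC1 f -> continuous f.
Proof.
move=> hf x; apply: (continuous_chart (chart_atP G x)).
by apply: (C1_continuous (hf _)); apply: range_map; exact: chart_atP.
Qed.

Lemma lift_continuous a (F : V -> R) (K : set V) : compact K -> K `<=` chart_range a ->
  (forall z, ~ K z -> F z = 0) -> (forall z, chart_range a z -> {for z, continuous F}) ->
  continuous (lift_fun a F).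
Proof.
move=> cK KO F0 hF; have [cK' K'O] := compact_inv cK KO.
apply: (continuous_ext (chart_dom_open a) (compact_closedM cK') K'O).
  by move=> x; exact: lift_fun0.
move=> x dx; apply: (continuous_chart dx).
apply: (@near_continuous _ _ F); last by apply: hF; exact: range_map.
apply: filterS (open_nbhs_nbhs (conj (range_open a) (range_map dx))) => z rz.
by rewrite lift_fun_inv.
Qed.

Lemma fC1D f h : fC1 f -> fC1 h -> fC1 (fun x => f x + h x).
Proof. by move=> hf hh a; exact: (C1D (range_open a) (hf a) (hh a)). Qed.

Lemma fC1M f h : fC1 f -> fC1 h -> fC1 (fun x => f x * h x).
Proof. by move=> hf hh a; exact: (C1M (range_open a) (hf a) (hh a)). Qed.

Lemma fC1_sum (I : Type) (r : seq I) (P : pred I) (F : I -> M -> R) : 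
  (forall i : I, fC1 (F i)) -> fC1 (fun x => \sum_(i <- r | P i) F i x).
Proof.
move=> h a.
exact: (C1_sum (F := fun (i : I) z => F i (chart_inv a z)) r P (range_open a) (fun i : I => h i a)).
Qed.

Definition dpair_at a (f h : M -> R) (x : M) : R :=
  pair (metric_mx a) (fun y => f (chart_inv a y)) (fun y => h (chart_inv a y)) (chart_map a x).

Definition dpair (f h : M -> R) (x : M) : R := dpair_at (chart_at G x) f h x.

Definition row_d (f : V -> R) y : 'rV[R]_m := \row_i pd i f y.

Lemma pairE g (f h : V -> R) y : pair g f h y = (row_d f y *m gi g y *m (row_d h y)^T) 0 0.
Proof.
rewrite -mulmxA mxE; apply: eq_bigr => i _; rewrite !mxE; congr (_ * _).
by apply: eq_bigr => j _; rewrite !mxE.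
Qed.

Lemma row_d_change a b f y : C1 (chart_range b) (fun y => f (chart_inv b y)) -> overlap a b y ->
  row_d (fun y => f (chart_inv a y)) y =
  row_d (fun y => f (chart_inv b y)) (transition a b y) *m (jac a b y)^T.
Proof.
move=> hf oy; apply/rowP => j; rewrite !mxE.
rewrite (@pd_eq _ _ (overlap a b) _ (fun y => f (chart_inv b (transition a b y)))) //; last 2 first.
- exact: overlap_open.
- by move=> z; rewrite inE => /overlapE[rz dz]; rewrite /transition chart_mapK.
have [_ ->//] := @C1_change a b _ hf.
by apply: eq_bigr => k _; rewrite !mxE mulrC.
Qed.

(** The rows of differentials transform by the Jacobian and the inverse metric by its inverse, so
    the factors cancel. *)
Lemma dpair_atE a b f h x : fC1 f -> fC1 h -> chart_dom a x -> chart_dom b x ->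
  dpair_at a f h x = dpair_at b f h x.
Proof.
move=> hf hh ax bx; rewrite /dpair_at !pairE.
have oy : overlap a b (chart_map a x) by exists x.
have tE : transition a b (chart_map a x) = chart_map b x by rewrite /transition chart_mapK.
rewrite (row_d_change (hf b) oy) (row_d_change (hh b) oy) tE.
set A := jac a b _; set p := row_d _ _; set q := row_d _ _.
have ga := @metric_mx_transition _ _ _ G a b _ oy; rewrite -/(transition a b _) tE -/A in ga.
have u : metric_mx a (chart_map a x) \in unitmx.
  by apply: posdef_unit; apply: posdef_metric; exact: range_map.
have ub : metric_mx b (chart_map b x) \in unitmx.
  by apply: posdef_unit; apply: posdef_metric; exact: range_map.
(* Invertibility of the Jacobian is read off from the transformation rule of the metric, whose left
   side is invertible. *)
have uA : A \in unitmx by move: u; rewrite ga !unitmx_mul => /andP[/andP[]].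
have uT : A^T \in unitmx by rewrite unitmx_tr.
have -> : gi (metric_mx a) (chart_map a x) = invmx A^T *m gi (metric_mx b) (chart_map b x) *m invmx A.
  apply: (can_inj (mulKmx u)).
  rewrite /gi mulmxV // ga -!mulmxA (mulmxA A^T) mulmxV // mul1mx.
  by rewrite (mulmxA (metric_mx b _)) mulmxV // mul1mx mulmxV.
rewrite trmx_mul trmxK !mulmxA; congr (fun_of_matrix _ _ _).
by rewrite -(mulmxA p) mulmxV // mulmx1 -(mulmxA (p *m _)) mulVmx // mulmx1.
Qed.

Lemma dpairE a f h x : fC1 f -> fC1 h -> chart_dom a x -> dpair f h x = dpair_at a f h x.
Proof. by move=> hf hh ax; apply: dpair_atE => //; exact: chart_atP. Qed.

End manifold.
#[global] Arguments range_open {R m M G} a.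
#[global] Arguments overlap_open {R m M G} a b.
#[global] Arguments C1_metric {R m M G} a i j.
#[global] Arguments C1_dmetric {R m M G} a i j k.

(** * Integration in a chart *)

Section density.
Local Open Scope ereal_scope.
Context d1 d2 (T1 : measurableType d1) (T2 : measurableType d2) {R : realType}.
Context (mu : {measure set T1 -> \bar R}) (nu : {measure set T2 -> \bar R}).
Context (D : set T1) (E : set T2) (phi : T2 -> T1) (w : T2 -> R).
Hypothesis mD : measurable D.
Hypothesis mE : measurable E.
Hypothesis mphi : measurable_fun E phi.
Hypothesis phiD : forall y, E y -> D (phi y).
Hypothesis mw : measurable_fun E w.
Hypothesis w0 : forall y, E y -> (0 <= w y)%R.
Hypothesis muE : forall A, measurable A -> A `<=` D ->
  mu A = \int[nu]_(y in E) (\1_A (phi y) * w y)%:E.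

Import HBNNSimple.

(** The hypothesis [muE] is the case of indicators; linearity gives simple functions, and monotone
    convergence the rest. *)
Lemma ge0_integral_change (f : T1 -> \bar R) : measurable_fun D f ->
  (forall x, D x -> 0 <= f x) ->
  \int[mu]_(x in D) f x = \int[nu]_(y in E) (f (phi y) * (w y)%:E).
Proof.
move=> mf f0; pose h := nnsfun_approx mD mf.
have mh n : measurable_fun E (fun y => (h n (phi y))%:E).
  by apply/measurable_EFinP; apply: (measurable_comp measurableT) => //; exact: measurable_funP.
have mwE : measurable_fun E (EFin \o w) by exact/measurable_EFinP.
have -> : \int[mu]_(x in D) f x = lim (\int[mu]_(x in D) (EFin \o h n) x @[n --> \oo]).
  have fE x : D x -> f x = lim ((EFin \o h n) x @[n --> \oo]).
    by move=> Dx; apply/esym/cvg_lim => //; exact: cvg_nnsfun_approx.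
  under eq_integral => x /[!inE] /fE -> //.
  apply: monotone_convergence => //.
  - move=> n; apply/measurable_EFinP.
    by apply: (measurable_funS measurableT) => //; exact/measurable_funP.
  - by move=> n x Dx //=; rewrite lee_fin.
  - by move=> x Dx a b ab; rewrite lee_fin; exact/lefP/nd_nnsfun_approx.
have -> : \int[nu]_(y in E) (f (phi y) * (w y)%:E) =
    lim (\int[nu]_(y in E) ((h n (phi y))%:E * (w y)%:E) @[n --> \oo]).
  have fg y : E y -> f (phi y) * (w y)%:E = lim ((h n (phi y))%:E * (w y)%:E @[n --> \oo]).
    move=> Ey; apply/esym/cvg_lim => //; apply: cvgeZr => //.
    by apply: cvg_nnsfun_approx => //; exact: phiD.
  under eq_integral => x /[!inE] /fg -> //.
  apply: (@monotone_convergence _ _ _ nu E mE (fun n y => (h n (phi y))%:E * (w y)%:E)).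
  - by move=> n; apply: emeasurable_funM.
  - by move=> n x Ex /=; rewrite mule_ge0 ?lee_fin ?w0.
  - by move=> x Ex a b ab/=; rewrite lee_wpmul2r ?lee_fin ?w0//; exact/lefP/nd_nnsfun_approx.
suff suf n : \int[mu]_(x in D) (EFin \o h n) x = \int[nu]_(y in E) ((h n (phi y))%:E * (w y)%:E).
  by under eq_fun do rewrite suf.
transitivity (\int[mu]_(x in D)
   (\sum_(y \in range (h n)) (y * \1_(h n @^-1` [set y]) x)%:E)).
  by apply: eq_integral => t tE; rewrite /= fimfunE -fsumEFin.
have indich r : measurable_fun D (fun x => (r * \1_(h n @^-1` [set r]) x)%:E).
  by apply: (measurable_comp measurableT) => //; exact: measurable_funM.
have mindic r : measurable_fun E (fun y => (\1_(h n @^-1` [set r]) (phi y))%:E).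
  apply/measurable_EFinP; apply: (measurable_comp (F := setT)) => //.
rewrite ge0_integral_fsum//; last by move=> r y Ey; exact: nnfun_muleindic_ge0.
transitivity (\int[nu]_(y in E) (\sum_(r \in range (h n))
    (r * \1_(h n @^-1` [set r]) (phi y))%:E * (w y)%:E)); last first.
  under [RHS]eq_integral => x xE.
    rewrite fimfunE -fsumEFin // ge0_mule_fsuml => [|y]; last exact: nnfun_muleindic_ge0.
    over.
  by [].
rewrite ge0_integral_fsum//; last 2 first.
- move=> r; apply: emeasurable_funM => //; under eq_fun do rewrite EFinM.
  by apply: emeasurable_funM.
- by move=> r y Ey; rewrite mule_ge0 ?lee_fin ?w0// -lee_fin nnfun_muleindic_ge0.
apply: eq_fsbigr => r rhn.
under eq_integral do rewrite EFinM.
rewrite integralZl_indic_nnsfun // integral_indic //.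
rewrite muE; [|exact: measurableI|by move=> x []].
(* The approximations are nonnegative, so a negative [r] has an empty fibre; a nonnegative one may
   be pulled out of the integral. *)
have [r0|r0] := ltP r 0%R.
  have E0 : h n @^-1` [set r] = set0.
    by apply/seteqP; split => // x /= hx; move: r0; rewrite -hx ltNge fun_ge0.
  rewrite E0 set0I.
  under [X in _ * X]eq_integral do rewrite indic0 mul0r.
  under [RHS]eq_integral do rewrite indic0 mulr0 mul0e.
  by rewrite !integral0 mule0.
under [RHS]eq_integral do rewrite EFinM -muleA.
rewrite ge0_integralZl //; last 2 first.
- by apply: emeasurable_funM.
- by move=> y Ey; rewrite mule_ge0 ?lee_fin ?w0.
congr (_ * _); apply: eq_integral => y; rewrite inE => Ey.
rewrite EFinM; congr (_%:E * _); rewrite !indicE in_setI.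
by rewrite [X in _ && X]mem_set ?andbT //; exact: phiD.
Qed.
End density.

Section volume.
Context {R : realType} {m : nat} {M : ptopologicalType} (G : riemannian R m M).
Context (mu : {measure set (borel M) -> \bar R}) (muG : riemannian_volume G mu).
Local Notation V := 'rV[R]_m.
Local Notation nu := (@nu R m).
Implicit Types (a b : chart G) (x : M) (y z : V) (i j k l : 'I_m).
Local Notation vol a := (vol (metric_mx a)).

Lemma continuous_measurable (f : M -> R) : continuous f ->
  measurable_fun [set: borel M] (f : borel M -> R).
Proof. by move=> cf; exact: (borel_fun openT (fun x _ => cf x)). Qed.

Lemma vol_metric_gt0 a y : chart_range a y -> 0 < vol a y.
Proof. exact: (vol_gt0 (@metric_mx_sym _ _ _ G a) (@posdef_metric _ _ _ G a)). Qed.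

Lemma C1_vol_metric a : C1 (chart_range a) (fun z => vol a z).
Proof.
exact: (C1_vol (range_open a) (C1_metric a) (@metric_mx_sym _ _ _ G a) (@posdef_metric _ _ _ G a)).
Qed.

Lemma mrange a : measurable (chart_range a : set (borel V)).
Proof. by apply: borel_open; exact: (range_open a). Qed.

Lemma mdom a : measurable (chart_dom a : set (borel M)).
Proof. by apply: borel_open; exact: chart_dom_open. Qed.

Lemma minv a : measurable_fun (chart_range a : set (borel V)) (chart_inv a : borel V -> borel M).
Proof. by apply: borel_map; [exact: (range_open a)|move=> y; exact: chart_inv_continuous]. Qed.

Lemma mvol a : measurable_fun (chart_range a : set (borel V)) (fun y => vol a y).
Proof.
by apply: borel_fun; [exact: (range_open a)|move=> y ry; exact: (C1_continuous (C1_vol_metric a) ry)].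
Qed.

(** Pulling [A] back by the inverse chart, instead of pushing it forward, makes the integrand
    visibly measurable, so that [integral_nu] applies. *)
Lemma volumeE a (A : set (borel M)) : measurable A -> A `<=` chart_dom a ->
  (mu A = \int[nu]_(y in chart_range a) (\1_A (chart_inv a y) * vol a y)%:E)%E.
Proof.
move=> mA Ad; rewrite (muG mA Ad) integral_mkcond.
have mr := mrange a; have mi := @minv a; have mv := @mvol a.
pose f := (fun y => (\1_A (chart_inv a y) * vol a y)%:E) \_ (chart_range a).
have mf : @measurable_fun _ _ (borel V) (\bar R) setT f.
  apply/(measurable_restrictT _ mr); apply/measurable_EFinP; apply: measurable_funM => //.
  have mA1 : measurable_fun [set: borel M] (\1_A : borel M -> R) by exact: measurable_indic.
  by apply: (measurable_comp (F := setT) (f := \1_A : borel M -> R)).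
rewrite -/f (integral_nu mf) => [|y]; last first.
  rewrite /f patchE; case: ifPn => //; rewrite inE => ry.
  by rewrite lee_fin mulr_ge0 // ltW // vol_metric_gt0.
congr leb_integral; apply/funext => y; rewrite /f patchE; case: ifPn.
  rewrite inE => ry; congr (_ * _)%:E; rewrite !indicE; congr (_%:R); congr nat_of_bool.
  apply/idP/idP; rewrite !inE; first by move=> [x Ax <-]; rewrite chart_mapK //; exact: Ad.
  by move=> Ax; exists (chart_inv a y) => //; exact: chart_invK.
move/negP => ry; rewrite indicE memNset ?mul0r // => -[x Ax xy]; apply: ry.
by rewrite inE; exists x => //; exact: Ad.
Qed.

Lemma ge0_integral_lift a (F : V -> R) (K : set V) : compact K -> K `<=` chart_range a ->
  (forall z, ~ K z -> F z = 0) -> (forall z, chart_range a z -> {for z, continuous F}) ->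
  (forall y, 0 <= F y) ->
  (\int[mu]_x (lift_fun a F x)%:E = \int[nu]_y (F y * vol a y)%:E)%E.
Proof.
move=> cK KO F0 cF Fge.
have cL := lift_continuous cK KO F0 cF.
have mL : measurable_fun [set: borel M] (lift_fun a F : borel M -> R).
  exact: continuous_measurable.
have L0 x : 0 <= lift_fun a F x by rewrite /lift_fun; case: ifP.
transitivity (\int[mu]_(x in (chart_dom a : set (borel M))) (lift_fun a F x)%:E)%E.
  rewrite [RHS]integral_mkcond; apply: eq_integral => x _; rewrite patchE /lift_fun.
  by case: asboolP => dx; [rewrite mem_set|case: ifP].
rewrite (ge0_integral_change (mdom a) (mrange a) (@minv a) (@inv_dom _ _ _ _ a) (@mvol a)
   _ (@volumeE a)).
- rewrite integral_mkcond; apply: eq_integral => y _; rewrite patchE; case: ifPn.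
    by rewrite inE => ry; rewrite lift_fun_inv.
  by move/negP => ry; rewrite F0 ?mul0r // => /KO ky; apply: ry; rewrite inE.
- by move=> y ry; exact/ltW/vol_metric_gt0.
- by apply/measurable_EFinP; exact: measurable_funTS.
- by move=> x _; rewrite lee_fin.
Qed.

Lemma lift_cc a (F : V -> R) (K : set V) : compact K -> K `<=` chart_range a ->
  (forall z, ~ K z -> F z = 0) -> (forall z, chart_range a z -> {for z, continuous F}) ->
  nu.-integrable setT (EFin \o (fun y => F y * vol a y)).
Proof.
move=> cK KO F0 cF.
have cl : closed K by apply: compact_closed => //; exact: norm_hausdorff.
have Fv0 z : ~ K z -> F z * vol a z = 0 by move=> /F0 ->; rewrite mul0r.
apply: cc_integrable; last exact: (bdsupp_compact cK Fv0).
apply: (continuous_ext (range_open a) cl KO Fv0) => z rz.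
by apply: ctsM; [exact: cF|exact: (C1_continuous (C1_vol_metric a) rz)].
Qed.

Lemma ge0_integrable_lift a (F : V -> R) (K : set V) : compact K -> K `<=` chart_range a ->
  (forall z, ~ K z -> F z = 0) -> (forall z, chart_range a z -> {for z, continuous F}) ->
  (forall y, 0 <= F y) -> mu.-integrable setT (EFin \o (lift_fun a F : borel M -> R)).
Proof.
move=> cK KO F0 cF Fge.
have cL := lift_continuous cK KO F0 cF.
have L0 x : 0 <= lift_fun a F x by rewrite /lift_fun; case: ifP.
apply/integrableP; split.
  by apply/measurable_EFinP; exact: continuous_measurable.
under eq_integral do rewrite /= ger0_norm //.
rewrite (ge0_integral_lift cK KO F0 cF Fge).
have /integrableP[_] := lift_cc cK KO F0 cF; apply: le_lt_trans.
apply: ge0_le_integral => //.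
- move=> y _; have [ky|/F0 ->] := pselect (K y); last by rewrite mul0r.
  by rewrite lee_fin mulr_ge0 // ltW // vol_metric_gt0 //; exact: KO.
- by have /integrableP[] := lift_cc cK KO F0 cF.
- by apply: measurableT_comp => //; have /integrableP[] := lift_cc cK KO F0 cF.
- by move=> y _; rewrite lee_fin ler_norm.
Qed.

(** The positive and negative parts of [F] are continuous over the chart and vanish off the same
    [K], which reduces the claim to the nonnegative case. *)
Lemma integral_lift a (F : V -> R) (K : set V) : compact K -> K `<=` chart_range a ->
  (forall z, ~ K z -> F z = 0) -> (forall z, chart_range a z -> {for z, continuous F}) ->
  mu.-integrable setT (EFin \o (lift_fun a F : borel M -> R)) /\
  (\int[mu]_x lift_fun a F x = \int[nu]_y (F y * vol a y))%R.
Proof.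
move=> cK KO F0 cF.
pose P y := Num.max (F y) 0; pose N y := Num.max (- F y) 0.
have FE : F = fun y => P y - N y.
  by apply/funext => y; rewrite /P /N; case: (leP (F y) 0) => h; case: (leP (- F y) 0) => h'; lra.
have P0 z : ~ K z -> P z = 0 by move=> /F0 E; rewrite /P E maxxx.
have N0 z : ~ K z -> N z = 0 by move=> /F0 E; rewrite /N E oppr0 maxxx.
have cP z : chart_range a z -> {for z, continuous P}.
  by move=> rz; apply: continuous_max; [exact: cF|exact: cts_cst].
have cN z : chart_range a z -> {for z, continuous N}.
  by move=> rz; apply: continuous_max; [apply: continuousN; exact: cF|exact: cts_cst].
have Pge y : 0 <= P y by rewrite le_max lexx orbT.
have Nge y : 0 <= N y by rewrite le_max lexx orbT.
have iP := ge0_integrable_lift cK KO P0 cP Pge.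
have iN := ge0_integrable_lift cK KO N0 cN Nge.
have LE : lift_fun a F = fun x => lift_fun a P x - lift_fun a N x.
  by apply/funext => x; rewrite /lift_fun; case: ifP => _; rewrite ?subr0 // [in LHS]FE.
rewrite LE; split; first exact: (integrable_EFinB iP iN).
rewrite (RintegralB measurableT iP iN).
have e1 : (\int[mu]_x lift_fun a P x = \int[nu]_y (P y * vol a y))%R.
  by rewrite /Rintegral (ge0_integral_lift cK KO P0 cP Pge).
have e2 : (\int[mu]_x lift_fun a N x = \int[nu]_y (N y * vol a y))%R.
  by rewrite /Rintegral (ge0_integral_lift cK KO N0 cN Nge).
rewrite e1 e2 -(RintegralB measurableT (lift_cc cK KO P0 cP) (lift_cc cK KO N0 cN)).
by apply: eq_Rintegral => y _; rewrite [in RHS]FE mulrBl.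
Qed.

End volume.

(** * Regularity and positivity of the pairing of differentials in a chart *)

Section chart_regularity.
Context {R : realType} {m : nat}.
Local Notation V := 'rV[R]_m.
Context (O : set V) (oO : open O) (g : V -> 'M[R]_m).
Hypothesis C1g : forall i j, C1 O (fun z => g z i j).
Hypothesis gsym : forall y, O y -> (g y)^T = g y.
Hypothesis gpos : forall y, O y -> posdef (g y).
Implicit Types (y z : V) (i j k l : 'I_m) (u v f h : V -> R).

Lemma pair_continuous f h y : C1 O f -> C1 O h -> O y -> {for y, continuous (pair g f h)}.
Proof.
move=> hf hh Oy; apply: continuous_fsum => i; apply: ctsM; first exact: (C1_pd_continuous hf i Oy).
apply: continuous_fsum => j; apply: ctsM; last exact: (C1_pd_continuous hh j Oy).
exact: (C1_continuous (C1_gi oO C1g gpos i j) Oy).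
Qed.

Lemma C1_pair f h : (forall k, C1 O (pd k f)) -> (forall k, C1 O (pd k h)) -> C1 O (pair g f h).
Proof.
move=> hf hh; apply: C1_sum => // i; apply: C1M => //.
by apply: C1_gradv.
Qed.

Lemma lap_continuous u y : (forall k, C1 O (pd k u)) -> O y -> {for y, continuous (lap g u)}.
Proof.
move=> hu Oy; have hv := C1_vol oO C1g gsym gpos.
have v0 z : O z -> vol g z != 0 by move=> Oz; rewrite gt_eqF // (vol_gt0 gsym gpos).
apply: ctsM; first exact: (C1_continuous (C1V oO hv v0) Oy).
apply: continuous_fsum => j.
have h : C1 O (fun z => vol g z * gradv g u j z) by apply: C1M => //; exact: C1_gradv.
exact: (C1_pd_continuous h j Oy).
Qed.

Lemma pair_sym f h y : O y -> pair g f h y = pair g h f y.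
Proof.
move=> Oy; rewrite /pair /gradv; under eq_bigr do rewrite mulr_sumr.
under [RHS]eq_bigr do rewrite mulr_sumr.
rewrite exchange_big /=; apply: eq_bigr => i _; apply: eq_bigr => j _.
by rewrite (giC gsym i j Oy); ring.
Qed.

Lemma pair_ge0 f y : O y -> 0 <= pair g f f y.
Proof.
move=> Oy; rewrite pairE; have [P NP] := gi_factor gsym gpos Oy.
exact: (psd_factor _ NP).
Qed.

Lemma pair_cauchy_schwarz f h y : O y ->
  pair g f h y ^+ 2 <= pair g f f y * pair g h h y.
Proof.
move=> Oy; rewrite !pairE; have [P NP] := gi_factor gsym gpos Oy.
exact: (psd_cauchy_schwarz _ _ NP).
Qed.

End chart_regularity.

(** * Partitions of unity *)

Section manifold_calculus.
Context {R : realType} {m : nat} {M : ptopologicalType} (G : riemannian R m M).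
Local Notation V := 'rV[R]_m.
Local Notation nu := (@nu R m).
Implicit Types (a b : chart G) (x : M) (y z : V) (i j k l : 'I_m) (f h u v : M -> R).
Local Notation loc a f := (fun y => f (chart_inv a y)).
Local Notation fC1 := (fC1 G).
Local Notation dpair := (dpair G).

Definition fC2 u := fC1 u /\ forall a k, C1 (chart_range a) (pd k (loc a u)).

Definition lap_at a u x : R := lap (metric_mx a) (loc a u) (chart_map a x).

Definition flap u x : R := lap_at (chart_at G x) u x.

Definition restr a f y : R := if `[< chart_range a y >] then f (chart_inv a y) else 0.

Lemma restrE a f y : chart_range a y -> restr a f y = f (chart_inv a y).
Proof. by rewrite /restr; case: asboolP. Qed.

Lemma restr0 a f y : ~ chart_range a y -> restr a f y = 0.
Proof. by rewrite /restr; case: asboolP. Qed.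

Lemma lift_restr a f : (forall x, ~ chart_dom a x -> f x = 0) -> lift_fun a (restr a f) = f.
Proof.
move=> f0; apply/funext => x; rewrite /lift_fun; case: asboolP => dx; last by rewrite f0.
by rewrite restrE ?chart_mapK //; exact: range_map.
Qed.

Lemma C1_restr a f : fC1 f -> C1 (chart_range a) (restr a f).
Proof.
move=> hf; apply: (C1_eq (range_open a) _ (hf a)) => y; rewrite inE => ry.
by rewrite restrE.
Qed.

Lemma compact_map a (K : set M) : compact K -> K `<=` chart_dom a ->
  compact (chart_map a @` K) /\ chart_map a @` K `<=` chart_range a.
Proof.
move=> cK Kd; split; last by move=> _ [x /Kd dx <-]; exact: range_map.
apply: continuous_compact => //; apply: continuous_in_subspaceT => z.
by rewrite inE => /Kd dz; exact: chart_map_continuous.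
Qed.

Lemma restr_supp a f (K : set M) : (forall x, ~ K x -> f x = 0) ->
  forall y, ~ (chart_map a @` K) y -> restr a f y = 0.
Proof.
move=> f0 y Ky; have [ry|/restr0 ->//] := pselect (chart_range a y).
by rewrite restrE // f0 // => Kx; apply: Ky; exists (chart_inv a y) => //; exact: chart_invK.
Qed.

Lemma loc_continuous a f y : continuous f -> chart_range a y -> {for y, continuous (loc a f)}.
Proof.
move=> cf ry; apply: (cts_comp (g := chart_inv a) (f := f)); last exact: cf.
exact: chart_inv_continuous.
Qed.

Lemma dpair_local f1 f2 h (U : set M) x : open U -> (forall z : M, U z -> f1 z = f2 z) -> U x ->
  dpair f1 h x = dpair f2 h x.
Proof.
move=> oU f12 Ux; set a := chart_at G x; apply: eq_bigr => i _; congr (_ * _).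
have dx : chart_dom a x by exact: chart_atP.
have oP : open [set y | chart_range a y /\ U (chart_inv a y)] by exact: open_chart_preim.
apply: (pd_eq i oP); last first.
  by split; [exact: range_map|rewrite chart_mapK].
by move=> z; rewrite inE => -[rz Uz]; exact: f12.
Qed.

Lemma dpair_cst c h x : dpair (fun=> c) h x = 0.
Proof. by apply: big1 => i _; rewrite pd_cst mul0r. Qed.

Lemma dpair_supp f h (K : set M) x : closed K -> (forall z : M, ~ K z -> f z = 0) -> ~ K x ->
  dpair f h x = 0.
Proof.
move=> cK f0 Kx; rewrite -(dpair_cst 0 h x).
exact: (dpair_local h (closed_openC cK) f0 Kx).
Qed.

Lemma range_at x : chart_range (chart_at G x) (chart_map (chart_at G x) x).
Proof. by apply: range_map; exact: chart_atP. Qed.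

Lemma dpairC f h x : dpair f h x = dpair h f x.
Proof. exact: (pair_sym (@metric_mx_sym _ _ _ G _) _ _ (range_at x)). Qed.

Lemma dpair_ge0 f x : 0 <= dpair f f x.
Proof.
exact: (pair_ge0 (@metric_mx_sym _ _ _ G _) (@posdef_metric _ _ _ G _) _ (range_at x)).
Qed.

Lemma dpair_cauchy_schwarz f h x : dpair f h x ^+ 2 <= dpair f f x * dpair h h x.
Proof.
exact: (pair_cauchy_schwarz (@metric_mx_sym _ _ _ G _) (@posdef_metric _ _ _ G _) _ _ (range_at x)).
Qed.

Lemma loc_derivable f a j x : fC1 f -> chart_dom a x ->
  derivable (loc a f) (chart_map a x) (delta_mx 0 j : V).
Proof. by move=> hf dx; exact: (C1_derivable (hf a) j (range_map dx)). Qed.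
Arguments loc_derivable : clear implicits.

Lemma dpairDl f1 f2 h x : fC1 f1 -> fC1 f2 ->
  dpair (fun x => f1 x + f2 x) h x = dpair f1 h x + dpair f2 h x.
Proof.
move=> h1 h2; have dx := chart_atP G x; rewrite -big_split /=; apply: eq_bigr => i _.
by rewrite (pdD (loc_derivable _ _ i _ h1 dx) (loc_derivable _ _ i _ h2 dx)) mulrDl.
Qed.

Lemma dpairMl f1 f2 h x : fC1 f1 -> fC1 f2 ->
  dpair (fun x => f1 x * f2 x) h x = f1 x * dpair f2 h x + f2 x * dpair f1 h x.
Proof.
move=> h1 h2; have dx := chart_atP G x; rewrite !mulr_sumr -big_split /=; apply: eq_bigr => i _.
by rewrite (pdM (loc_derivable _ _ i _ h1 dx) (loc_derivable _ _ i _ h2 dx)) /= chart_mapK //; ring.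
Qed.

Lemma dpair_suml (I : Type) (r : seq I) (F : I -> M -> R) h x : (forall i : I, fC1 (F i)) ->
  dpair (fun x => \sum_(i <- r) F i x) h x = \sum_(i <- r) dpair (F i) h x.
Proof.
move=> hF; elim: r => [|i r IH].
  rewrite big_nil -[RHS](dpair_cst 0 h x); apply: (congr1 (fun f => dpair f h x)).
  by apply/funext => z; rewrite big_nil.
transitivity (dpair (fun x => F i x + \sum_(i <- r) F i x) h x).
  by apply: (congr1 (fun f => dpair f h x)); apply/funext => z; rewrite big_cons.
rewrite big_cons; apply: (etrans (dpairDl h x (hF i) (fC1_sum r xpredT hF))).
exact: (congr1 (fun t => dpair (F i) h x + t) IH).
Qed.

Lemma dpair_continuous f h : fC1 f -> fC1 h -> continuous (dpair f h).
Proof.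
move=> hf hh x; have dx := chart_atP G x; apply: (continuous_chart dx); set a := chart_at G x.
apply: (@near_continuous _ _ (pair (metric_mx a) (loc a f) (loc a h))).
  apply: filterS (open_nbhs_nbhs (conj (range_open a) (range_map dx))) => z rz.
  by rewrite (dpairE hf hh (inv_dom rz)) /dpair_at chart_invK.
exact: (pair_continuous (range_open a) (C1_metric a) (@posdef_metric _ _ _ G a) (hf a) (hh a) (range_map dx)).
Qed.

Lemma fC1_dpair u v : fC2 u -> fC2 v -> fC1 (dpair u v).
Proof.
move=> [hu hdu] [hv hdv] a.
apply: (C1_eq (range_open a) _ (C1_pair (range_open a) (C1_metric a) (@posdef_metric _ _ _ G a) (hdu a) (hdv a))).
by move=> z; rewrite inE => rz; rewrite (dpairE hu hv (inv_dom rz)) /dpair_at chart_invK.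
Qed.

(* The closed ball of radius [sqrt 2 * cell_rad] supports the bump function of the cell; the
   factor 8 leaves room for the bump function of twice the radius, which equals 1 near it. *)
Record cell := Cell {
  cell_chart : chart G; cell_ctr : V; cell_rad : R;
  cell_rad_gt0 : 0 < cell_rad;
  cell_sub : [set z | sqdist cell_ctr z <= 8 * cell_rad ^+ 2] `<=` chart_range cell_chart }.

Implicit Types p : cell.

Definition cbump p : V -> R := bump (cell_ctr p) (cell_rad p).
Definition cfun p : M -> R := lift_fun (cell_chart p) (cbump p).
Definition csupp p : set V := [set z | sqdist (cell_ctr p) z <= 2 * cell_rad p ^+ 2].
Definition ccore p : set M :=
  [set x | chart_dom (cell_chart p) x /\
     [set z | sqdist (cell_ctr p) z < cell_rad p ^+ 2] (chart_map (cell_chart p) x)].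

Lemma csupp_compact p : compact (csupp p).
Proof. exact: compact_sqdist. Qed.

Lemma csupp_range p : csupp p `<=` chart_range (cell_chart p).
Proof.
move=> z hz; apply: cell_sub; apply: (le_trans hz).
by rewrite ler_wpM2r ?sqr_ge0 //; lra.
Qed.

Lemma cbump0 p z : ~ csupp p z -> cbump p z = 0.
Proof.
move=> h; apply/eqP; apply: contra_notT h => /(bump_supp (cell_rad_gt0 p)) => h.
exact: ltW.
Qed.

Lemma fC1_cfun p : fC1 (cfun p).
Proof.
apply: (fC1_lift (@csupp_compact p) (@csupp_range p) (@cbump0 p)).
by apply: C1_bump; exact: (range_open _).
Qed.

Lemma cfun_ge0 p x : 0 <= cfun p x.
Proof. by rewrite /cfun /lift_fun; case: ifP => // _; exact: bump_ge0. Qed.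

Lemma cfun1 p x : ccore p x -> cfun p x = 1.
Proof.
move=> [dx hx]; rewrite /cfun lift_funE //.
by apply: (bump1 (cell_rad_gt0 p)); exact: ltW.
Qed.

Lemma open_ccore p : open (ccore p).
Proof. by apply: open_dom_preim; exact: open_sqdist. Qed.

Lemma cell_exists x : exists p, ccore p x.
Proof.
set a := chart_at G x; have rx := range_at x; rewrite -/a in rx.
have /nbhs_ballP[e /= e0 he] := open_nbhs_nbhs (conj (range_open a) rx).
(* With radius [e / 4] the closed ball required by a cell has squared radius
   $8(e/4)^2=e^2/2<e^2$. *)
have r0 : 0 < e / 4 by rewrite divr_gt0.
have sub : [set z | sqdist (chart_map a x) z <= 8 * (e / 4) ^+ 2] `<=` chart_range a.
  move=> z /= hz; apply: he; apply: sqdist_ball => //; apply: (le_lt_trans hz).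
  have -> : 8 * (e / 4) ^+ 2 = e ^+ 2 / 2 by field.
  by rewrite ltr_pdivrMr // ltr_pMr ?exprn_gt0 // ltr1n.
exists (Cell r0 sub); split => /=; first exact: chart_atP.
by rewrite sqdist_self exprn_gt0.
Qed.

(* The common weight [w] is 1/S for S >= 1, where S is the sum of the bump functions, and is made
   globally C^1 by replacing S with S + (1 - step S), which never vanishes. *)
Lemma partition_of_unity (K : set M) : compact K ->
  exists (s : seq cell) (w : M -> R) (U : set M),
  [/\ fC1 w, (forall x, 0 <= w x), open U, K `<=` U &
    forall x, U x -> \sum_(p <- s) cfun p x * w x = 1].
Proof.
rewrite compact_cover => cK; have [P hP] := choice cell_exists.
have KT : K `<=` cover setT (fun x => ccore (P x)) by move=> x _; exists x.
have [D _ KD] := cK M setT (fun x => ccore (P x)) (fun x _ => @open_ccore (P x)) KT.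
pose s : seq cell := [seq P x | x <- finmap.enum_fset D].
pose S x := \sum_(p <- s) cfun p x.
have hS : fC1 S by apply: fC1_sum => p; exact: fC1_cfun.
have S0 x : 0 <= S x by apply: sumr_ge0 => p _; exact: cfun_ge0.
pose T x := S x + (1 - step (S x)).
have T0 x : 0 < T x.
  have := S0 x; rewrite le_eqVlt => /predU1P[E|h]; first by rewrite /T -E step0 // subr0 add0r.
  by rewrite /T ltr_wpDr // subr_ge0 step_le1.
pose U : set M := \bigcup_(x in [set x | x \in finmap.enum_fset D]) ccore (P x).
exists s, (fun x => (T x)^-1), U; split => //.
- move=> a; have oa := range_open a; apply: (C1V oa); last by move=> y _; rewrite gt_eqF.
  apply: (C1D oa (hS a)); apply: (C1B oa); first exact: C1_cst.
  exact: (C1_step oa (hS a)).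
- by move=> x; rewrite invr_ge0 ltW.
- by apply: bigcup_open => x _; exact: open_ccore.
- move=> x [z Dz hz]; have S1 : 1 <= S x.
    rewrite /S /s big_map (big_rem z) //= (cfun1 hz) lerDl.
    by apply: sumr_ge0 => p _; exact: cfun_ge0.
  rewrite -mulr_suml -/(S x) /T step1 // subrr addr0 divff // gt_eqF //.
  exact: lt_le_trans S1.
Qed.
End manifold_calculus.

(** * Green's formula *)

Section integration.
Context {R : realType} {m : nat} {M : ptopologicalType} (G : riemannian R m M).
Context (mu : {measure set (borel M) -> \bar R}) (muG : riemannian_volume G mu).
Local Notation V := 'rV[R]_m.
Local Notation nu := (@nu R m).
Implicit Types (a b : chart G) (x : M) (y z : V) (i j k l : 'I_m) (f h u v : M -> R).
Implicit Types (p : cell G).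
Local Notation loc a f := (fun y => f (chart_inv a y)).
Local Notation fC1 := (fC1 G).
Local Notation fC2 := (fC2 G).
Local Notation dpair := (dpair G).
Local Notation flap := (flap G).
Local Notation vol a := (vol (metric_mx a)).
Local Notation intg f := (mu.-integrable setT (EFin \o (f : borel M -> R))).

Lemma integral_chart a f (K : set M) : compact K -> K `<=` chart_dom a ->
  (forall x, ~ K x -> f x = 0) -> (forall y, chart_range a y -> {for y, continuous (loc a f)}) ->
  intg f /\ (\int[mu]_x f x = \int[nu]_y (restr a f y * vol a y))%R.
Proof.
move=> cK Kd f0 cf; have [cK' Kr] := compact_map cK Kd.
have cr z : chart_range a z -> {for z, continuous (restr a f)}.
  move=> rz; apply: near_continuous (cf z rz).
  apply: filterS (open_nbhs_nbhs (conj (range_open a) rz)) => w rw.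
  by rewrite restrE.
have E : lift_fun a (restr a f) = f.
  by apply: lift_restr => x dx; apply: f0 => /Kd.
by have := integral_lift muG cK' Kr (restr_supp f0) cr; rewrite E.
Qed.

Definition ccell p : set M := chart_inv (cell_chart p) @` csupp p.

Lemma ccell_compact p : compact (ccell p).
Proof. by have [] := compact_inv (@csupp_compact _ _ _ _ p) (@csupp_range _ _ _ _ p). Qed.

Lemma ccell_dom p : ccell p `<=` chart_dom (cell_chart p).
Proof. by have [] := compact_inv (@csupp_compact _ _ _ _ p) (@csupp_range _ _ _ _ p). Qed.

Lemma cfun0 p x : ~ ccell p x -> cfun p x = 0.
Proof. exact: (lift_fun0 (@cbump0 _ _ _ _ p)). Qed.

(** Finiteness of the integral has to be extracted from the chart formula: a partition of unity
    splits [f] into finitely many pieces, each compactly supported in one chart. *)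
Lemma cc_integrable_manifold f (K : set M) : continuous f -> compact K ->
  (forall x, ~ K x -> f x = 0) -> intg f.
Proof.
move=> cf cK f0; have [s [w [U [hw w0 oU KU sU]]]] := partition_of_unity G cK.
have E : f = fun x => \sum_(p <- s) cfun p x * w x * f x.
  apply/funext => x; have [Kx|/f0 ->] := pselect (K x).
    by rewrite -mulr_suml sU ?mul1r //; exact: KU.
  by rewrite -mulr_suml mulr0.
rewrite E; apply: (@integrable_EFin_sum _ (borel M)) => p.
have z0 x : ~ ccell p x -> cfun p x * w x * f x = 0 by move=> /cfun0 ->; rewrite !mul0r.
apply: (proj1 (integral_chart (@ccell_compact p) (@ccell_dom p) z0 _)) => y ry.
apply: (loc_continuous (f := fun x => cfun p x * w x * f x)) => // x.
exact: (ctsM (ctsM (@fC1_continuous _ _ _ G _ (fC1_cfun p) x) (@fC1_continuous _ _ _ G _ hw x)) (cf x)).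
Qed.

Lemma lap_at_inv a u y : chart_range a y -> lap_at a u (chart_inv a y) = lap (metric_mx a) (loc a u) y.
Proof. by move=> ry; rewrite /lap_at chart_invK. Qed.

Lemma loc_lap_continuous a u y : fC2 u -> chart_range a y -> {for y, continuous (loc a (lap_at a u))}.
Proof.
move=> [hu hdu] ry; apply: (@near_continuous _ _ (lap (metric_mx a) (loc a u))).
  apply: filterS (open_nbhs_nbhs (conj (range_open a) ry)) => z rz.
  by rewrite lap_at_inv.
exact: (lap_continuous (range_open a) (C1_metric a) (@metric_mx_sym _ _ _ G a)
  (@posdef_metric _ _ _ G a) (hdu a) ry).
Qed.

(** Green's formula within one chart, stated with the coordinate Laplacian of that chart, because it
    serves to prove that this Laplacian is chart independent. *)
Lemma weak_lap_at a h u (K : set M) : fC1 h -> fC2 u -> compact K -> K `<=` chart_dom a ->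
  (forall x, ~ K x -> h x = 0) ->
  (\int[mu]_x (h x * lap_at a u x) = - \int[mu]_x dpair h u x)%R.
Proof.
move=> hh hu cK Kd h0; have [hu1 hu2] := hu.
have cl := compact_closedM G cK; have [cK' Kr] := compact_map cK Kd.
have e0 x : ~ K x -> h x * lap_at a u x = 0 by move=> /h0 ->; rewrite mul0r.
have d0 x : ~ K x -> dpair h u x = 0 by exact: dpair_supp.
have ch := fC1_continuous hh.
have c1 y : chart_range a y -> {for y, continuous (loc a (fun x => h x * lap_at a u x))}.
  by move=> ry; apply: ctsM; [exact: loc_continuous|exact: loc_lap_continuous].
have c2 y : chart_range a y -> {for y, continuous (loc a (dpair h u))}.
  by move=> ry; apply: loc_continuous => //; exact: dpair_continuous.
have [_ ->] := integral_chart cK Kd e0 c1; have [_ ->] := integral_chart cK Kd d0 c2.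
have W := weak_laplacian (range_open a) (C1_metric a) (@metric_mx_sym _ _ _ G a)
  (@posdef_metric _ _ _ G a) (hu2 a) (C1_restr a hh) cK' Kr (restr_supp h0).
have rc f y : (forall y, chart_range a y -> {for y, continuous (loc a f)}) -> chart_range a y ->
    {for y, continuous (restr a f)}.
  move=> cf ry; apply: near_continuous (cf y ry).
  apply: filterS (open_nbhs_nbhs (conj (range_open a) ry)) => z rz.
  by rewrite restrE.
have I1 := lift_cc cK' Kr (restr_supp e0) (fun z => rc _ z c1).
have I2 := lift_cc cK' Kr (restr_supp d0) (fun z => rc _ z c2).
apply/eqP; rewrite -subr_eq0 opprK -(RintegralD measurableT I1 I2); apply/eqP.
rewrite -[RHS]W; apply: eq_Rintegral => y _.
have [ry|ry] := pselect (chart_range a y); last first.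
  rewrite !restr0 // !mul0r add0r.
  have ny : ~ (chart_map a @` K) y by move=> /Kr.
  have cl' : closed (chart_map a @` K) by apply: compact_closed => //; exact: norm_hausdorff.
  have -> : \sum_i pd i (restr a h) y * gradv (metric_mx a) (loc a u) i y = 0.
    by apply: big1 => i _; rewrite (pd_supp i cl' (restr_supp h0) ny) mul0r.
  by rewrite addr0 mulr0.
rewrite !restrE // lap_at_inv // (dpairE hh hu1 (inv_dom ry)) /dpair_at chart_invK //.
rewrite -mulrDl mulrC; congr (_ * (_ + _)); apply: eq_bigr => i _; congr (_ * _).
apply: (pd_eq i (range_open a)) => // z; rewrite inE => rz; by rewrite restrE.
Qed.

(* Testing [lap_at a u - lap_at b u] with a bump function: both terms integrate to
   [- \int <dh, du>], which does not depend on the chart. *)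
Lemma lap_atE_le a b u x : fC2 u -> chart_dom a x -> chart_dom b x ->
  ~ (lap_at b u x < lap_at a u x).
Proof.
move=> hu ax bx lt; pose D y := lap_at a u (chart_inv a y) - lap_at b u (chart_inv a y).
have oy : overlap a b (chart_map a x) by exists x.
have cD y : overlap a b y -> {for y, continuous D}.
  move=> o; have [ry dy] := (proj1 (overlapE a b y)) o.
  apply: ctsB; first exact: loc_lap_continuous.
  apply: (cts_comp (g := chart_inv a) (f := lap_at b u)); first exact: chart_inv_continuous.
  apply: (continuous_chart dy); apply: loc_lap_continuous => //; exact: range_map.
have Dy : 0 < D (chart_map a x) by rewrite /D chart_mapK // subr_gt0.
have : \forall y \near chart_map a x, overlap a b y /\ 0 < D y.
  apply: filterI; first exact: (open_nbhs_nbhs (conj (overlap_open a b) oy)).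
  exact: (cvgr_gt _ (cD _ oy)).
move=> /nbhs_ballP[e /= e0 he].
have r0 : 0 < e / 2 by rewrite divr_gt0.
set y0 := chart_map a x; pose beta := bump y0 (e / 2).
pose K := [set z | sqdist y0 z <= 2 * (e / 2) ^+ 2].
have Kb z : K z -> overlap a b z /\ 0 < D z.
  move=> /= hz; apply: he; apply: sqdist_ball => //.
  by apply: (le_lt_trans hz); exact: half_sq.
have cK : compact K by exact: compact_sqdist.
have Kr : K `<=` chart_range a by move=> z /Kb[/overlapE[]].
have b0 z : ~ K z -> beta z = 0.
  move=> h; apply/eqP; apply: contra_notT h => /(bump_supp r0) => h.
  exact: ltW.
pose h := lift_fun a beta.
have hh : fC1 h by apply: (fC1_lift cK Kr b0); apply: C1_bump; exact: (range_open a).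
have [cKM KMa] := compact_inv cK Kr.
have h0 (z : M) : ~ (chart_inv a @` K) z -> h z = 0 by exact: lift_fun0.
have KMb : chart_inv a @` K `<=` chart_dom b by move=> _ [z /Kb[/overlapE[_ dz] _] <-].
have Ea := weak_lap_at hh hu cKM KMa h0.
have Eb := weak_lap_at hh hu cKM KMb h0.
have ea0 (z : M) : ~ (chart_inv a @` K) z -> h z * lap_at a u z = 0 by move=> /h0 ->; rewrite mul0r.
have eb0 (z : M) : ~ (chart_inv a @` K) z -> h z * lap_at b u z = 0 by move=> /h0 ->; rewrite mul0r.
have ch := fC1_continuous hh.
have ca y : chart_range a y -> {for y, continuous (loc a (fun x => h x * lap_at a u x))}.
  by move=> ry; apply: ctsM; [exact: loc_continuous|exact: loc_lap_continuous].
have cb y : chart_range b y -> {for y, continuous (loc b (fun x => h x * lap_at b u x))}.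
  by move=> ry; apply: ctsM; [exact: loc_continuous|exact: loc_lap_continuous].
have [ia _] := integral_chart cKM KMa ea0 ca.
have [ib _] := integral_chart cKM KMb eb0 cb.
have EB := etrans (RintegralB measurableT ia ib)
  (etrans (congr2 (fun s t => s - t) Ea Eb) (subrr _)).
(* Read in the chart [a], the Laplacian of the chart [b] is continuous only over the overlap; off
   [K] the bump function annihilates the product. *)
have cd y : chart_range a y ->
    {for y, continuous (loc a (fun x => h x * lap_at a u x - h x * lap_at b u x))}.
  move=> ry; apply: (@near_continuous _ _ (fun y => beta y * D y)).
    apply: filterS (open_nbhs_nbhs (conj (range_open a) ry)) => z rz.
    by rewrite -mulrBr /h lift_fun_inv.
  have [Ky|Ky] := pselect (K y).
    apply: ctsM; last by apply: cD; have [] := Kb _ Ky.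
    exact: (C1_continuous (C1_bump y0 (e / 2) openT) I).
  apply: (@near_continuous _ _ (fun=> 0)); last exact: cst_continuous.
  apply: filterS (open_nbhs_nbhs (conj (closed_openC (@closed_sqdist _ _ y0 (2 * (e / 2) ^+ 2))) Ky)) => z Kz.
  by rewrite b0 // mul0r.
have ed0 (z : M) : ~ (chart_inv a @` K) z -> h z * lap_at a u z - h z * lap_at b u z = 0.
  by move=> hz; exact: (etrans (congr2 (fun s t => s - t) (ea0 z hz) (eb0 z hz)) (subrr _)).
have [_ Ed] := integral_chart cKM KMa ed0 cd.
have pos : (0 < \int[nu]_y (beta y * D y * vol a y))%R.
  have cv : continuous (fun y => beta y * D y * vol a y).
    apply: (continuous_ext (range_open a) (@closed_sqdist _ _ y0 (2 * (e / 2) ^+ 2)) Kr).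
      by move=> z Kz; rewrite b0 // !mul0r.
    move=> y ry; apply: ctsM; last exact: (C1_continuous (C1_vol_metric a) ry).
    apply: (@near_continuous _ _ (loc a (fun x => h x * lap_at a u x - h x * lap_at b u x))); last exact: cd.
    apply: filterS (open_nbhs_nbhs (conj (range_open a) ry)) => z rz.
    by rewrite -mulrBr /h lift_fun_inv.
  apply: (@integral_gt0 _ _ _ y0) => //.
  - by apply: (bdsupp_compact cK) => z /b0 ->; rewrite !mul0r.
  - move=> z; have [Kz|/b0 ->] := pselect (K z); last by rewrite !mul0r.
    exact: (mulr_ge0 (mulr_ge0 (bump_ge0 _ _ _) (ltW (proj2 (Kb z Kz)))) (ltW (vol_metric_gt0 (Kr z Kz)))).
  - have b1 : 0 < beta y0 by rewrite /beta bump1 ?ltr01 // sqdist_self sqr_ge0.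
    exact: (mulr_gt0 (mulr_gt0 b1 Dy) (vol_metric_gt0 (range_map ax))).
suff E : (\int[nu]_y (beta y * D y * vol a y) = 0)%R by rewrite E ltxx in pos.
apply: (etrans _ (etrans (esym Ed) EB)); apply: eq_Rintegral => y _.
have [ry|ry] := pselect (chart_range a y).
  by rewrite restrE // -mulrBr /h lift_fun_inv.
by rewrite restr0 // b0 ?mul0r // => /Kr.
Qed.

Lemma lap_atE a b u x : fC2 u -> chart_dom a x -> chart_dom b x -> lap_at a u x = lap_at b u x.
Proof.
move=> hu ax bx; have := lap_atE_le hu ax bx; have := lap_atE_le hu bx ax.
by move: (lap_at a u x) (lap_at b u x) => s t; case: (ltgtP s t).
Qed.

Lemma flapE a u x : fC2 u -> chart_dom a x -> flap u x = lap_at a u x.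
Proof. by move=> hu ax; apply: lap_atE => //; exact: chart_atP. Qed.

Lemma flap_continuous u : fC2 u -> continuous (flap u).
Proof.
move=> hu x; have dx := chart_atP G x; apply: (continuous_chart dx).
apply: (@near_continuous _ _ (loc (chart_at G x) (lap_at (chart_at G x) u))).
  apply: filterS (open_nbhs_nbhs (conj (range_open _) (range_map dx))) => z rz.
  by rewrite (flapE hu (inv_dom rz)).
exact: (loc_lap_continuous hu (range_map dx)).
Qed.

Lemma flap_supp u (K : set M) x : closed K -> (forall x, ~ K x -> u x = 0) -> ~ K x ->
  flap u x = 0.
Proof.
move=> cK u0 Kx; set a := chart_at G x; have dx := chart_atP G x; rewrite -/a in dx.
rewrite /flap /lap_at -/a /lap big1 ?mulr0 // => j _.
have oP : open [set y | chart_range a y /\ (~` K) (chart_inv a y)].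
  by apply: open_chart_preim; exact: closed_openC.
rewrite -[RHS](pd_cst 0 (chart_map a x) j); apply: (pd_eq j oP); last first.
  by split; [exact: range_map|rewrite chart_mapK].
move=> y; rewrite inE => Py; rewrite /gradv big1 ?mulr0 // => i _.
rewrite (pd_eq (g := fun=> 0) i oP) ?pd_cst ?mulr0 //.
by move=> z; rewrite inE => -[_ Kz]; exact: u0.
Qed.

(** A partition of unity cuts the test function, not [u], into pieces supported in charts, and
    [flapE] merges the local Laplacians. *)
Lemma green h u (K : set M) : fC1 h -> fC2 u -> compact K -> (forall x, ~ K x -> h x = 0) ->
  (\int[mu]_x (h x * flap u x) = - \int[mu]_x dpair h u x)%R.
Proof.
move=> hh hu cK h0; have [s [w [U [hw w0 oU KU sU]]]] := partition_of_unity G cK.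
pose phi p x := cfun p x * w x * h x.
have hphi p : fC1 (phi p) by apply: fC1M => //; apply: fC1M => //; exact: fC1_cfun.
have hE x : h x = \sum_(p <- s) phi p x.
  rewrite -mulr_suml; have [Kx|/h0 ->] := pselect (K x); last by rewrite mulr0.
  by rewrite sU ?mul1r //; exact: KU.
have phi0 p x : ~ ccell p x -> phi p x = 0 by move=> /cfun0 E; rewrite /phi E !mul0r.
have i1 p : intg (fun x => phi p x * flap u x).
  apply: (@cc_integrable_manifold _ (ccell p)); [|exact: ccell_compact|].
    by move=> x; apply: ctsM; [exact: (fC1_continuous (hphi p))|exact: flap_continuous].
  by move=> x /phi0 ->; rewrite mul0r.
have clc p : closed (ccell p) by apply: (compact_closedM G); exact: ccell_compact.
have i2 p : intg (dpair (phi p) u).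
  apply: (@cc_integrable_manifold _ (ccell p)); [|exact: ccell_compact|].
    by move=> x; exact: (dpair_continuous (hphi p) (proj1 hu)).
  by move=> x; apply: dpair_supp => //; exact: phi0.
transitivity (\int[mu]_x \sum_(p <- s) (phi p x * flap u x))%R.
  by apply: eq_Rintegral => x _; rewrite -mulr_suml -hE.
rewrite (Rintegral_fsum _ i1).
transitivity (- \int[mu]_x \sum_(p <- s) dpair (phi p) u x)%R; last first.
  congr (- _); apply: eq_Rintegral => x _; rewrite -dpair_suml //.
  by apply: (congr1 (fun f => dpair f u x)); apply/funext => z; rewrite hE.
rewrite (Rintegral_fsum _ i2) -sumrN; apply: eq_bigr => p _.
rewrite -(weak_lap_at (hphi p) hu (@ccell_compact p) (@ccell_dom p) (phi0 p)).
apply: eq_Rintegral => x _; have [dx|dx] := pselect (chart_dom (cell_chart p) x).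
  by rewrite (flapE hu dx).
have -> : phi p x = 0 by apply: phi0 => /ccell_dom.
exact: (etrans (mul0r _) (esym (mul0r _))).
Qed.

End integration.

(** * The integrated Bochner inequality *)

Section chart_bochner.
Context {R : realType} {m : nat}.
Local Notation V := 'rV[R]_m.
Context (O : set V) (oO : open O) (g : V -> 'M[R]_m).
Hypothesis C1g : forall i j, C1 O (fun z => g z i j).
Hypothesis C1dg : forall i j k, C1 O (pd k (fun z => g z i j)).
Hypothesis gsym : forall y, O y -> (g y)^T = g y.
Hypothesis gpos : forall y, O y -> posdef (g y).
Context (u : V -> R) (C1u : C1 O u) (C1du : forall k, C1 O (pd k u)).
Implicit Types (y z : V) (i j k l : 'I_m).

(** This is $\nabla_{\nabla u}\nabla u=\frac12\nabla|\nabla u|^2$, a consequence of the symmetry of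
    the Hessian. It rewrites the gradient terms of the weak Bochner formula. *)
Lemma nab_grad_pair i y : O y ->
  \sum_j gradv g u j y * nab g (gradv g u) j i y = 2^-1 * gradv g (pair g u u) i y.
Proof.
move=> Oy; rewrite [gradv g (pair g u u) i y]/gradv mulr_sumr.
transitivity (\sum_j \sum_l gradv g u j y * (Hess g u j l y * gi g y l i)).
  by apply: eq_bigr => j _; rewrite (nab_gradv oO C1g gsym gpos C1du) // mulr_sumr.
rewrite exchange_big /=; apply: eq_bigr => l _.
rewrite (pd_pair oO C1g gsym gpos C1du) //.
transitivity (gi g y i l * \sum_j Hess g u l j y * gradv g u j y); last by field.
rewrite mulr_sumr; apply: eq_bigr => j _.
by rewrite (Hess_sym oO gsym C1u C1du j l Oy) (giC gsym l i Oy); ring.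
Qed.

(** The quantity $|\mathrm{Hess}\,u|^2+\mathrm{Ric}(\nabla u,\nabla u)$, continuous for $u$ of class
    $C^2$, whose integral Bochner's formula evaluates. *)
Definition hess_ric y : R := nab2 g (gradv g u) y +
  \sum_j \sum_k Ric g j k y * (gradv g u j y * gradv g u k y).

Lemma hess_ric_continuous y : O y -> {for y, continuous hess_ric}.
Proof.
move=> Oy.
have hX i : C1 O (gradv g u i) by exact: (C1_gradv oO C1g gpos C1du).
have hG k i j : C1 O (Gam g k i j) by exact: (C1_Gam oO C1g C1dg gpos).
have cG k i j := C1_continuous (hG k i j) Oy.
have cX i := C1_continuous (hX i) Oy.
have cn i j : {for y, continuous (nab g (gradv g u) i j)}.
  apply: ctsD; first exact: (C1_pd_continuous (hX j) i Oy).
  by apply: continuous_fsum => k; apply: ctsM.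
apply: ctsD.
  by apply: continuous_fsum => i; apply: continuous_fsum => j; exact: (ctsM (cn i j) (cn j i)).
apply: continuous_fsum => j; apply: continuous_fsum => k.
apply: ctsM; last exact: (ctsM (cX j) (cX k)).
apply: continuous_fsum => i; apply: ctsD.
  by apply: ctsB; [exact: (C1_pd_continuous (hG i j k) i Oy)|exact: (C1_pd_continuous (hG i i k) j Oy)].
apply: continuous_fsum => q.
exact: (ctsB (ctsM (cG i i q) (cG q j k)) (ctsM (cG i j q) (cG q i k))).
Qed.

Lemma gradv_metric y : O y ->
  ((\row_i gradv g u i y : V) *m g y *m (\row_i gradv g u i y : V)^T) 0 0 = pair g u u y.
Proof.
move=> Oy; have un := g_unit gpos Oy.
have E : (\row_i gradv g u i y : V) = row_d u y *m gi g y.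
  apply/rowP => i; rewrite !mxE; apply: eq_bigr => j _.
  by rewrite (giC gsym j i Oy) !mxE mulrC.
rewrite {1}E /gi -!mulmxA (mulmxA (invmx _)) mulVmx // mul1mx mxE.
by apply: eq_bigr => i _; rewrite !mxE.
Qed.

Lemma hess_ric_ge (c : R) y : O y ->
  (forall v : V, - c * (v *m g y *m v^T) 0 0 <=
     (v *m (\matrix_(j, k) Ric g j k y) *m v^T) 0 0) ->
  nab2 g (gradv g u) y <= hess_ric y + c * pair g u u y.
Proof.
move=> Oy /(_ (\row_i gradv g u i y)); rewrite gradv_metric // => h.
have E : ((\row_i gradv g u i y : V) *m (\matrix_(j, k) Ric g j k y) *m (\row_i gradv g u i y : V)^T) 0 0
   = \sum_j \sum_k Ric g j k y * (gradv g u j y * gradv g u k y).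
  rewrite mxE; under eq_bigr do rewrite mxE mulr_suml.
  rewrite exchange_big /=; apply: eq_bigr => j _; apply: eq_bigr => k _.
  by rewrite !mxE; ring.
rewrite E in h; rewrite /hess_ric -addrA lerDl -lerBlDr add0r -mulNr; exact: h.
Qed.

(** The bounds of [hess_bounds] persist when the squared Hessian is replaced by the larger
    [hess_ric + c |du|^2], the quantity whose integral is known. *)
Lemma hess_ric_bounds (c : R) y : O y ->
  (forall v : V, - c * (v *m g y *m v^T) 0 0 <=
     (v *m (\matrix_(j, k) Ric g j k y) *m v^T) 0 0) ->
  [/\ 0 <= hess_ric y + c * pair g u u y,
    lap g u y ^+ 2 <= m%:R * (hess_ric y + c * pair g u u y) &
    pair g (pair g u u) (pair g u u) y <= 4 * ((hess_ric y + c * pair g u u y) * pair g u u y)].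
Proof.
move=> Oy hR; have [h0 h1 h2] := hess_bounds oO C1g gsym gpos C1u C1du Oy.
have h := hess_ric_ge Oy hR; split; first exact: le_trans h0 h.
  by apply: (le_trans h1); rewrite ler_wpM2l.
apply: (le_trans h2); rewrite ler_wpM2l // ler_wpM2r //.
exact: (pair_ge0 gsym gpos _ Oy).
Qed.

Lemma pair_congr (f f' h h' : V -> R) y : {in O, f =1 f'} -> {in O, h =1 h'} -> O y ->
  pair g f h y = pair g f' h' y.
Proof.
move=> ff hh Oy; apply: eq_bigr => i _; rewrite (pd_eq i oO ff Oy); congr (_ * _).
by apply: eq_bigr => j _; rewrite (pd_eq j oO hh Oy).
Qed.
End chart_bochner.

Lemma Rintegral_cst0 d (T : measurableType d) (R : realType) (mu : {measure set T -> \bar R}) :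
  (\int[mu]_x (0 : R))%R = 0.
Proof. by rewrite /Rintegral integral0. Qed.

Section bochner_manifold.
Context {R : realType} {m : nat} {M : ptopologicalType} (G : riemannian R m M).
Context (mu : {measure set (borel M) -> \bar R}) (muG : riemannian_volume G mu).
Local Notation V := 'rV[R]_m.
Local Notation nu := (@nu R m).
Implicit Types (a b : chart G) (x : M) (y z : V) (i j k l : 'I_m) (f h u v w : M -> R).
Implicit Types (p : cell G).
Local Notation loc a f := (fun y => f (chart_inv a y)).
Local Notation fC1 := (fC1 G).
Local Notation fC2 := (fC2 G).
Local Notation dpair := (dpair G).
Local Notation flap := (flap G).
Local Notation vol a := (vol (metric_mx a)).
Local Notation intg f := (mu.-integrable setT (EFin \o (f : borel M -> R))).

Definition hess_ric_at a u y : R := hess_ric (metric_mx a) (loc a u) y.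

Definition cell_hess_ric p w u : M -> R :=
  lift_fun (cell_chart p) (fun y => cbump p y * w (chart_inv (cell_chart p) y) * hess_ric_at (cell_chart p) u y).

(** The terms of Bochner's formula in which the localizing function is differentiated. They are
    linear in it, so their sum over a partition of unity vanishes. *)
Definition cell_remainder p w u x : R :=
  2^-1 * dpair (fun x => cfun p x * w x) (dpair u u) x - flap u x * dpair (fun x => cfun p x * w x) u x.

Lemma hess_ric_at_continuous a u y : fC2 u -> chart_range a y -> {for y, continuous (hess_ric_at a u)}.
Proof.
move=> [hu hdu] ry.
exact: (hess_ric_continuous (range_open a) (C1_metric a) (C1_dmetric a) (@posdef_metric _ _ _ G a) (hdu a) ry).
Qed.

Lemma fC1_cell p w : fC1 w -> fC1 (fun x => cfun p x * w x).
Proof. by move=> hw; exact: (fC1M (@fC1_cfun _ _ _ G p) hw). Qed.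

Lemma dpair_inv a f h y : fC1 f -> fC1 h -> chart_range a y ->
  dpair f h (chart_inv a y) = pair (metric_mx a) (loc a f) (loc a h) y.
Proof. by move=> hf hh ry; rewrite (dpairE hf hh (inv_dom ry)) /dpair_at chart_invK. Qed.

Lemma cell0 p w x : ~ ccell p x -> cfun p x * w x = 0.
Proof. by move=> /cfun0 ->; rewrite mul0r. Qed.

Lemma ccell_closed p : closed (ccell p).
Proof. by apply: (compact_closedM G); exact: ccell_compact. Qed.

Lemma integrable_flap2 p w u : fC1 w -> fC2 u ->
  intg (fun x => cfun p x * w x * (flap u x * flap u x)).
Proof.
move=> hw hu; apply: (cc_integrable_manifold muG _ (@ccell_compact _ _ _ _ p)).
  move=> x; have cu := @flap_continuous _ _ _ _ _ muG _ hu x.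
  exact: (ctsM (@fC1_continuous _ _ _ G _ (fC1_cell p hw) x) (ctsM cu cu)).
by move=> x /(cell0 w) ->; rewrite mul0r.
Qed.

Lemma cell_remainder0 p w u x : ~ ccell p x -> cell_remainder p w u x = 0.
Proof.
move=> h; have E v : dpair (fun x => cfun p x * w x) v x = 0.
  by apply: dpair_supp h; [exact: ccell_closed|exact: cell0].
by rewrite /cell_remainder !E !mulr0 subr0.
Qed.

Lemma cell_remainder_continuous p w u : fC1 w -> fC2 u -> continuous (cell_remainder p w u).
Proof.
move=> hw hu x; have hp := fC1_cell p hw.
have c1 := @dpair_continuous _ _ _ G _ _ hp (fC1_dpair hu hu) x.
have c2 := @dpair_continuous _ _ _ G _ _ hp (proj1 hu) x.
change {for x, continuous (fun x => 2^-1 * dpair (fun x => cfun p x * w x) (dpair u u) x -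
  flap u x * dpair (fun x => cfun p x * w x) u x)}.
exact: (ctsB (ctsZ (c := 2^-1) c1) (ctsM (@flap_continuous _ _ _ _ _ muG _ hu x) c2)).
Qed.

Lemma integrable_remainder p w u : fC1 w -> fC2 u -> intg (cell_remainder p w u).
Proof.
move=> hw hu; apply: (cc_integrable_manifold muG _ (@ccell_compact _ _ _ _ p)).
  exact: cell_remainder_continuous.
exact: cell_remainder0.
Qed.

(** The weak Bochner formula in the chart of the cell, with the bump function times the weight as
    test function; [nab_grad_pair] turns its gradient terms into [cell_remainder]. *)
Lemma integral_cell_hess_ric p w u : fC1 w -> fC2 u ->
  intg (cell_hess_ric p w u) /\
  (\int[mu]_x cell_hess_ric p w u x =
   \int[mu]_x (cfun p x * w x * (flap u x * flap u x)) - \int[mu]_x cell_remainder p w u x)%R.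
Proof.
move=> hw hu; have [hu1 hu2] := hu; set a := cell_chart p.
pose phi y := cbump p y * w (chart_inv a y).
have oa : open (chart_range a) := range_open a.
have hphi : C1 (chart_range a) phi.
  by apply: (C1M oa _ (hw a)); exact: (C1_bump _ _ oa).
have cK := @csupp_compact _ _ _ G p; have Kr : csupp p `<=` chart_range a := @csupp_range _ _ _ G p.
have phi0 z : ~ csupp p z -> phi z = 0 by move=> /cbump0 E; rewrite /phi E mul0r.
have L0 z : ~ csupp p z -> phi z * hess_ric_at a u z = 0 by move=> /phi0 ->; rewrite mul0r.
have cL z : chart_range a z -> {for z, continuous (fun z => phi z * hess_ric_at a u z)}.
  move=> rz; apply: ctsM; last exact: hess_ric_at_continuous.
  exact: (C1_continuous hphi rz).
have [iL EL] := integral_lift muG cK Kr L0 cL; split; first exact: iL.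
rewrite [LHS]EL.
have e2 x : ~ ccell p x -> cfun p x * w x * (flap u x * flap u x) = 0.
  by move=> /(cell0 w) ->; rewrite mul0r.
have c2 y : chart_range a y -> {for y, continuous (loc a (fun x => cfun p x * w x * (flap u x * flap u x)))}.
  move=> ry; apply: (loc_continuous (f := fun x => cfun p x * w x * (flap u x * flap u x))) => // x.
  have cu := @flap_continuous _ _ _ _ _ muG _ hu x.
  exact: (ctsM (@fC1_continuous _ _ _ G _ (fC1_cell p hw) x) (ctsM cu cu)).
have c3 y : chart_range a y -> {for y, continuous (loc a (cell_remainder p w u))}.
  by move=> ry; apply: loc_continuous => //; exact: cell_remainder_continuous.
have cKM := @ccell_compact _ _ _ _ p; have KMd : ccell p `<=` chart_dom a := @ccell_dom _ _ _ _ p.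
have [_ E2] := integral_chart muG cKM KMd e2 c2.
have [_ E3] := integral_chart muG cKM KMd (@cell_remainder0 p w u) c3.
rewrite E2 E3.
have rc f y : (forall y, chart_range a y -> {for y, continuous (loc a f)}) -> chart_range a y ->
    {for y, continuous (restr a f)}.
  move=> cf ry; apply: near_continuous (cf y ry).
  apply: filterS (open_nbhs_nbhs (conj oa ry)) => z rz.
  by rewrite restrE.
have [cK' Kr'] := compact_map cKM KMd.
have I1 := lift_cc cK Kr L0 cL.
have I2 := lift_cc cK' Kr' (restr_supp e2) (fun z => rc _ z c2).
have I3 := lift_cc cK' Kr' (restr_supp (@cell_remainder0 p w u)) (fun z => rc _ z c3).
have r0 := cell_rad_gt0 p.
(* In squared radii: the test function lives in $2r^2$, the bump function of radius $2r$ is 1 up to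
   $4r^2$ and vanishes beyond $8r^2$, the bound in [cell_sub]. *)
pose W : set V := [set z | sqdist (cell_ctr p) z < 4 * cell_rad p ^+ 2].
pose eta := bump (cell_ctr p) (2 * cell_rad p).
have r2 : 0 < 2 * cell_rad p by rewrite mulr_gt0.
pose K' : set V := [set z | sqdist (cell_ctr p) z <= 8 * cell_rad p ^+ 2].
have clK : closed (csupp p) by exact: closed_sqdist.
have KW : csupp p `<=` W.
  move=> z hz; apply: (le_lt_trans hz); rewrite ltr_pM2r ?exprn_gt0 //; lra.
have oW : open W by exact: open_sqdist.
have cpK' : compact K' by exact: compact_sqdist.
have eta0 z : ~ K' z -> eta z = 0.
  move=> h; apply/eqP; apply: contra_notT h => /(bump_supp r2) => h.
  apply: ltW; apply: (lt_le_trans h); rewrite exprMn; lra.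
have eta1 z : W z -> eta z = 1.
  move=> hz; apply: (bump1 r2); rewrite exprMn; apply: ltW; apply: (lt_le_trans hz); lra.
have B := weak_bochner oa (C1_metric a) (C1_dmetric a) (@metric_mx_sym _ _ _ G a)
  (@posdef_metric _ _ _ G a)
  (fun i => C1_gradv oa (C1_metric a) (@posdef_metric _ _ _ G a) (hu2 a) i)
  hphi clK KW oW phi0 (C1_bump _ _ oa) cpK' (@cell_sub _ _ _ G p) eta0 eta1.
have I23 := integrable_EFinB I2 I3.
apply/eqP; rewrite -(RintegralB measurableT I2 I3) -subr_eq0 -(RintegralB measurableT I1 I23).
apply/eqP; apply: (etrans _ B); apply: eq_Rintegral => y _.
have [ry|ry] := pselect (chart_range a y); last first.
  have ny : ~ csupp p y by move=> /Kr.
  have E : \sum_i pd i phi y * (\sum_j gradv (metric_mx a) (loc a u) j y * nab (metric_mx a) (gradv (metric_mx a) (loc a u)) j i y -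
      gradv (metric_mx a) (loc a u) i y * \sum_j nab (metric_mx a) (gradv (metric_mx a) (loc a u)) j j y) = 0.
    by apply: big1 => i _; rewrite (pd_supp i clK phi0 ny) mul0r.
  by rewrite E !restr0 // phi0 // !mul0r !addr0 subrr subr0 mulr0.
rewrite !restrE //.
have phiE : {in chart_range a, (fun y => cfun p (chart_inv a y) * w (chart_inv a y)) =1 phi}.
  by move=> z; rewrite inE => rz; rewrite /cfun lift_fun_inv.
have lE : flap u (chart_inv a y) = lap (metric_mx a) (loc a u) y.
  by rewrite (flapE muG hu (inv_dom ry)) lap_at_inv.
have FE : {in chart_range a, loc a (dpair u u) =1 pair (metric_mx a) (loc a u) (loc a u)}.
  by move=> z; rewrite inE => rz; exact: (dpair_inv hu1 hu1 rz).
have d1 : dpair (fun x => cfun p x * w x) (dpair u u) (chart_inv a y) =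
    \sum_i pd i phi y * gradv (metric_mx a) (pair (metric_mx a) (loc a u) (loc a u)) i y.
  exact: (etrans (dpair_inv (fC1_cell p hw) (fC1_dpair hu hu) ry) (pair_congr oa _ phiE FE ry)).
have d2 : dpair (fun x => cfun p x * w x) u (chart_inv a y) =
    \sum_i pd i phi y * gradv (metric_mx a) (loc a u) i y.
  exact: (etrans (dpair_inv (fC1_cell p hw) hu1 ry) (pair_congr oa _ phiE (fun _ _ => erefl) ry)).
pose L := lap (metric_mx a) (loc a u) y.
pose S1 := \sum_i pd i phi y * gradv (metric_mx a) (pair (metric_mx a) (loc a u) (loc a u)) i y.
pose S2 := \sum_i pd i phi y * gradv (metric_mx a) (loc a u) i y.
pose N j i := nab (metric_mx a) (gradv (metric_mx a) (loc a u)) j i y.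
pose X i := gradv (metric_mx a) (loc a u) i y.
pose Q := hess_ric_at a u y.
have rE : cell_remainder p w u (chart_inv a y) = 2^-1 * S1 - L * S2.
  exact: (congr2 (fun s t => s - t) (congr1 (fun t => 2^-1 * t) d1) (congr2 *%R lE d2)).
have pE := phiE y (mem_set ry).
transitivity (phi y * Q * vol a y - (phi y * (L * L) * vol a y - (2^-1 * S1 - L * S2) * vol a y)).
  exact: (congr2 (fun s t => phi y * Q * vol a y - (s - t))
    (congr2 (fun s t => s * (t * t) * vol a y) pE lE) (congr1 (fun t => t * vol a y) rE)).
have lN : \sum_j N j j = L.
  exact: (esym (lap_nab oa (C1_metric a) (@metric_mx_sym _ _ _ G a) (@posdef_metric _ _ _ G a) (hu2 a) ry)).
have XE : \sum_i pd i phi y * (\sum_j X j * N j i - X i * L) = 2^-1 * S1 - L * S2.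
  rewrite /S1 /S2 !mulr_sumr -sumrB; apply: eq_bigr => i _.
  have -> : \sum_j X j * N j i = _ := nab_grad_pair oa (C1_metric a) (@metric_mx_sym _ _ _ G a)
    (@posdef_metric _ _ _ G a) (hu1 a) (hu2 a) i ry.
  by rewrite -/(X i); ring.
transitivity (vol a y * (phi y * (Q - L ^+ 2) + (2^-1 * S1 - L * S2))); first by ring.
transitivity (vol a y * (phi y * (Q - L ^+ 2) + \sum_i pd i phi y * (\sum_j X j * N j i - X i * L))).
  exact: (congr1 (fun t => vol a y * (phi y * (Q - L ^+ 2) + t)) (esym XE)).
exact: (congr1 (fun t => vol a y * (phi y * (Q - t ^+ 2) + \sum_i pd i phi y * (\sum_j X j * N j i - X i * t)))
  (esym lN)).
Qed.

Lemma hess_ric_at_bounds a (C : R) u x : ricci_ge G (- C) -> fC2 u -> chart_dom a x ->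
  let B := hess_ric_at a u (chart_map a x) + C * dpair u u x in
  [/\ 0 <= B, flap u x * flap u x <= m%:R * B &
    dpair (dpair u u) (dpair u u) x <= 4 * (B * dpair u u x)].
Proof.
move=> hR hu dx; have [hu1 hu2] := hu; have ry := range_map dx; set y := chart_map a x in ry *.
have oa : open (chart_range a) := range_open a.
have E1 : dpair u u x = pair (metric_mx a) (loc a u) (loc a u) y by exact: (dpairE hu1 hu1 dx).
have FE : {in chart_range a, loc a (dpair u u) =1 pair (metric_mx a) (loc a u) (loc a u)}.
  by move=> z; rewrite inE => rz; exact: (dpair_inv hu1 hu1 rz).
have E2 : dpair (dpair u u) (dpair u u) x =
    pair (metric_mx a) (pair (metric_mx a) (loc a u) (loc a u)) (pair (metric_mx a) (loc a u) (loc a u)) y.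
  have hF := fC1_dpair hu hu.
  exact: (etrans (dpairE hF hF dx) (pair_congr oa _ FE FE ry)).
have E3 : flap u x = lap (metric_mx a) (loc a u) y by exact: (flapE muG hu dx).
have := hess_ric_bounds oa (C1_metric a) (@metric_mx_sym _ _ _ G a) (@posdef_metric _ _ _ G a)
  (hu1 a) (hu2 a) ry (hR a y ry).
by rewrite E2 E1 E3 expr2.
Qed.

(* [E] is the average, over a partition of unity, of |Hess u|^2 + Ric(du, du) + C |du|^2 computed
   in the respective charts, so that its chart independence need not be known. *)
Lemma bochner_energy (C : R) u (K : set M) : ricci_ge G (- C) -> fC2 u -> compact K ->
  (forall x, ~ K x -> u x = 0) ->
  exists E : M -> R, [/\ intg E, (forall x, 0 <= E x),
    (forall x, flap u x * flap u x <= m%:R * E x),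
    (forall x, dpair (dpair u u) (dpair u u) x <= 4 * (E x * dpair u u x)) &
    (\int[mu]_x E x = \int[mu]_x (flap u x * flap u x) + C * \int[mu]_x dpair u u x)%R].
Proof.
move=> hR hu cK u0; have [hu1 hu2] := hu; have cl := compact_closedM G cK.
have [s [w [U [hw w0 oU KU sU]]]] := partition_of_unity G cK.
have F0 x : ~ K x -> dpair u u x = 0 by exact: dpair_supp.
have L0 x : ~ K x -> flap u x = 0 by exact: flap_supp.
have hF := fC1_dpair hu hu.
have cu := @flap_continuous _ _ _ _ _ muG _ hu.
pose T p x := cell_hess_ric p w u x + C * (cfun p x * w x * dpair u u x).
pose B p x := hess_ric_at (cell_chart p) u (chart_map (cell_chart p) x) + C * dpair u u x.
have c0 p x : ~ chart_dom (cell_chart p) x -> cfun p x = 0.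
  by move=> dx; apply: cfun0 => /ccell_dom.
have TE p x : T p x = cfun p x * w x * B p x.
  have [dx|dx] := pselect (chart_dom (cell_chart p) x).
    have -> : T p x = cbump p (chart_map (cell_chart p) x) * w (chart_inv (cell_chart p) (chart_map (cell_chart p) x)) *
      hess_ric_at (cell_chart p) u (chart_map (cell_chart p) x) + C * (cfun p x * w x * dpair u u x).
      exact: (congr1 (fun t => t + C * (cfun p x * w x * dpair u u x)) (lift_funE _ dx)).
    rewrite (chart_mapK dx) -[cbump p _](lift_funE _ dx) -/(cfun p) /B.
    by move: (hess_ric_at _ _ _) (dpair _ _ _) (cfun p x) (w x) => *; ring.
  have -> : T p x = C * (cfun p x * w x * dpair u u x).
    rewrite /T /cell_hess_ric /lift_fun; case: asboolP => // _.
    exact: (add0r _).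
  by rewrite (c0 p x dx) !mul0r mulr0.
have bB p x : 0 <= cfun p x * w x * B p x /\ cfun p x * w x * (flap u x * flap u x) <= m%:R * (cfun p x * w x * B p x) /\
    cfun p x * w x * dpair (dpair u u) (dpair u u) x <= 4 * (cfun p x * w x * B p x * dpair u u x).
  have ph0 : 0 <= cfun p x * w x by exact: (mulr_ge0 (cfun_ge0 p x) (w0 x)).
  have [dx|dx] := pselect (chart_dom (cell_chart p) x); last first.
    by rewrite (c0 p x dx) !mul0r !mulr0.
  have [b0 b1 b2] := hess_ric_at_bounds hR hu dx; rewrite -/(B p x) in b0 b1 b2.
  split; first exact: (mulr_ge0 ph0 b0).
  move: b1 b2; move: (dpair (dpair u u) (dpair u u) x) (dpair u u x) (flap u x * flap u x) (B p x) (cfun p x * w x) ph0 => t f l b c ph0 b1 b2.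
  split; first by rewrite mulrCA ler_wpM2l.
  by rewrite -mulrA mulrCA ler_wpM2l.
have intF : intg (dpair u u) by exact: (cc_integrable_manifold muG (dpair_continuous hu1 hu1) cK F0).
have intL : intg (fun x => flap u x * flap u x).
  apply: (cc_integrable_manifold muG _ cK) => [x|x /L0 ->]; last by rewrite mul0r.
  exact: (ctsM (cu x) (cu x)).
have intpF p : intg (fun x => cfun p x * w x * dpair u u x).
  apply: (cc_integrable_manifold muG _ cK) => [x|x /F0 ->]; last by rewrite mulr0.
  exact: (ctsM (@fC1_continuous _ _ _ G _ (fC1_cell p hw) x) (dpair_continuous hu1 hu1 (x:=x))).
have intH p := proj1 (integral_cell_hess_ric p hw hu).
have intT p : intg (T p) by exact: (integrable_EFinD (intH p) (integrable_EFinZ C (intpF p))).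
exists (fun x => \sum_(p <- s) T p x); split.
- exact: integrable_EFin_sum.
- by move=> x; apply: sumr_ge0 => p _; rewrite TE; have [] := bB p x.
- move=> x; have [Kx|/L0 ->] := pselect (K x); last first.
    rewrite mul0r mulr_ge0 //; apply: sumr_ge0 => p _; rewrite TE; by have [] := bB p x.
  have -> : flap u x * flap u x = \sum_(p <- s) cfun p x * w x * (flap u x * flap u x).
    by rewrite -mulr_suml (sU x (KU x Kx)) mul1r.
  by rewrite mulr_sumr; apply: ler_sum => p _; rewrite TE; have [_ []] := bB p x.
- move=> x; have [Kx|Kx] := pselect (K x); last first.
    have -> : dpair (dpair u u) (dpair u u) x = 0 by exact: (dpair_supp _ _ cl F0 Kx).
    by rewrite (F0 x Kx) !mulr0.
  have -> : dpair (dpair u u) (dpair u u) x = \sum_(p <- s) cfun p x * w x * dpair (dpair u u) (dpair u u) x.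
    by rewrite -mulr_suml (sU x (KU x Kx)) mul1r.
  rewrite mulr_suml mulr_sumr; apply: ler_sum => p _; rewrite TE.
  by have [_ []] := bB p x.
rewrite (Rintegral_fsum _ intT).
pose Phi x := \sum_(p <- s) cfun p x * w x.
have e1 : \sum_(p <- s) (\int[mu]_x (cfun p x * w x * dpair u u x))%R = (\int[mu]_x dpair u u x)%R.
  rewrite -(Rintegral_fsum _ intpF); apply: eq_Rintegral => x _; rewrite -mulr_suml.
  have [Kx|/F0 ->] := pselect (K x); last by rewrite mulr0.
  by rewrite (sU x (KU x Kx)) mul1r.
have e2 : \sum_(p <- s) (\int[mu]_x (cfun p x * w x * (flap u x * flap u x)))%R = (\int[mu]_x (flap u x * flap u x))%R.
  rewrite -(Rintegral_fsum _ (fun p => integrable_flap2 p hw hu)); apply: eq_Rintegral => x _.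
  rewrite -mulr_suml; have [Kx|/L0 ->] := pselect (K x); last by rewrite mul0r mulr0.
  by rewrite (sU x (KU x Kx)) mul1r.
have e3 : \sum_(p <- s) (\int[mu]_x cell_remainder p w u x)%R = 0.
  rewrite -(Rintegral_fsum _ (fun p => integrable_remainder p hw hu)).
  rewrite -[RHS](@Rintegral_cst0 _ _ _ mu); apply: eq_Rintegral => x _.
  have hphi p : fC1 (fun x => cfun p x * w x) := fC1_cell p hw.
  have DS v : \sum_(p <- s) dpair (fun x => cfun p x * w x) v x = dpair Phi v x.
    exact: (esym (@dpair_suml _ _ _ G _ s (fun p x => cfun p x * w x) v x hphi)).
  have -> : \sum_(p <- s) cell_remainder p w u x = 2^-1 * dpair Phi (dpair u u) x - flap u x * dpair Phi u x.
    by rewrite -(DS u) -(DS (dpair u u)) !mulr_sumr -sumrB.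
  (* On [U] the weights add up to 1, so the differential of their sum is zero; off [U] the point
     lies outside [K], where the factors coming from [u] vanish. *)
  have [Ux|Ux] := pselect (U x).
    have D0 v : dpair Phi v x = 0.
      exact: (etrans (@dpair_local _ _ _ G Phi (fun=> 1) v U x oU sU Ux) (dpair_cst G 1 v x)).
    by rewrite !D0 !mulr0 subr0.
  have Kx : ~ K x by move=> /KU.
  have D0 : dpair Phi (dpair u u) x = 0.
    exact: (etrans (dpairC G _ _ x) (dpair_supp _ _ cl F0 Kx)).
  by rewrite D0 (L0 x Kx) mul0r subr0 mulr0.
transitivity (\sum_(p <- s) ((\int[mu]_x (cfun p x * w x * (flap u x * flap u x)))%R -
    (\int[mu]_x cell_remainder p w u x)%R + C * (\int[mu]_x (cfun p x * w x * dpair u u x))%R)).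
  apply: eq_bigr => p _.
  rewrite (RintegralD measurableT (intH p) (integrable_EFinZ C (intpF p))).
  rewrite (RintegralZl C measurableT (intpF p)); congr (_ + _).
  exact: (proj2 (integral_cell_hess_ric p hw hu)).
by rewrite big_split /= sumrB e2 e3 -mulr_sumr e1 subr0.
Qed.
End bochner_manifold.

(** * The L^4 estimate *)

Section pointwise.
Context {R : realType}.

Lemma le_of_sqr (a c : R) : 0 <= c -> a ^+ 2 <= c ^+ 2 -> - a <= c /\ a <= c.
Proof. by move=> c0 h; split; nra. Qed.

Lemma cauchy_schwarz2 (a b c d : R) : (c * a + d * b) ^+ 2 <= (c ^+ 2 + d ^+ 2) * (a * a + b * b).
Proof.
rewrite -subr_ge0; have -> : (c ^+ 2 + d ^+ 2) * (a * a + b * b) - (c * a + d * b) ^+ 2 =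
  (c * b - d * a) ^+ 2 by ring.
exact: sqr_ge0.
Qed.

Lemma half_absorb (a b : R) : a <= 2^-1 * b + 2^-1 * a -> a <= b.
Proof. by lra. Qed.

(** Applied to $|dF|^2$ with $F=|du|^2+|dv|^2$. The bound on [auv] gives $|a_{uv}|\le
    2(e_uf_v+e_vf_u)$, exactly the mixed part of the product on the right, so the constant 4 of the
    real case survives. *)
Lemma cross_term_le (eu ev fu fv auu auv avv : R) :
  0 <= eu -> 0 <= ev -> 0 <= fu -> 0 <= fv ->
  auu <= 4 * (eu * fu) -> avv <= 4 * (ev * fv) -> 0 <= auu -> 0 <= avv -> auv ^+ 2 <= auu * avv ->
  auu + auv + (auv + avv) <= 4 * ((eu + ev) * (fu + fv)).
Proof.
move=> eu0 ev0 fu0 fv0 h1 h2 a1 a2 h3.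
have x0 : 0 <= eu * fv by exact: mulr_ge0.
have y0 : 0 <= ev * fu by exact: mulr_ge0.
have h4 : auv ^+ 2 <= (2 * (eu * fv + ev * fu)) ^+ 2.
  apply: (le_trans h3); apply: (le_trans (ler_pM a1 a2 h1 h2)).
  by move: (sqr_ge0 (eu * fv - ev * fu)); nra.
have c0 : 0 <= 2 * (eu * fv + ev * fu) by rewrite mulr_ge0 // addr_ge0.
have [_ h5] := le_of_sqr c0 h4; nra.
Qed.

Lemma gradient_term_le (u v al be M2 dF fu fv : R) : u ^+ 2 + v ^+ 2 <= M2 -> 0 <= dF ->
  0 <= fu -> 0 <= fv -> al ^+ 2 <= dF * fu -> be ^+ 2 <= dF * fv ->
  (u * al + v * be) ^+ 2 <= M2 * (dF * (fu + fv)).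
Proof.
move=> h0 d0 f0 g0 h1 h2.
apply: (@le_trans _ _ ((u ^+ 2 + v ^+ 2) * (al ^+ 2 + be ^+ 2))).
  by move: (sqr_ge0 (u * be - v * al)); nra.
apply: ler_pM => //; [by rewrite addr_ge0 ?sqr_ge0|by rewrite addr_ge0 ?sqr_ge0|].
by rewrite mulrDr lerD.
Qed.

(** Here [a] stands for $u\Delta u+v\Delta v$, [b] for $\langle dF,u\,du+v\,dv\rangle$ and [E] for
    the Bochner energy. The difference of the two sides is at least $\frac12((2+\sqrt m)M\sqrt
    E-F)^2$. *)
Lemma integrand_le (a b F E M rm : R) : 0 <= F -> 0 <= E -> 0 <= M -> 0 <= rm ->
  a ^+ 2 <= M ^+ 2 * (rm ^+ 2 * E) -> b ^+ 2 <= M ^+ 2 * (4 * (E * F) * F) ->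
  - (F * a + b) <= 2^-1 * ((2 + rm) ^+ 2 * M ^+ 2 * E) + 2^-1 * (F * F).
Proof.
move=> F0 E0 M0 rm0 ha hb; pose s := Num.sqrt E.
have s0 : 0 <= s by exact: sqrtr_ge0.
have ss : E = s ^+ 2 by rewrite sqr_sqrtr.
have [ha' _] : - a <= M * rm * s /\ a <= M * rm * s.
  apply: le_of_sqr; first by rewrite !mulr_ge0.
  by rewrite !exprMn -ss -mulrA.
have [hb' _] : - b <= 2 * M * s * F /\ b <= 2 * M * s * F.
  apply: le_of_sqr; first by rewrite !mulr_ge0.
  by apply: (le_trans hb); rewrite ss le_eqVlt; apply/orP; left; apply/eqP; ring.
have h1 : - (F * a) <= F * (M * rm * s) by rewrite -mulrN ler_wpM2l.
apply: (@le_trans _ _ (F * (M * rm * s) + 2 * M * s * F)); first by rewrite opprD lerD.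
rewrite ss -subr_ge0.
have -> : 2^-1 * ((2 + rm) ^+ 2 * M ^+ 2 * s ^+ 2) + 2^-1 * (F * F) - (F * (M * rm * s) + 2 * M * s * F)
  = 2^-1 * ((2 + rm) * M * s - F) ^+ 2 by field.
by rewrite mulr_ge0 ?invr_ge0 ?sqr_ge0.
Qed.

End pointwise.

Section L4_estimate.
Context {R : realType} {m : nat} {M : ptopologicalType} (G : riemannian R m M).
Context (mu : {measure set (borel M) -> \bar R}) (muG : riemannian_volume G mu).
Implicit Types (x : M) (f h u v w : M -> R).
Local Notation fC1 := (fC1 G).
Local Notation fC2 := (fC2 G).
Local Notation dpair := (dpair G).
Local Notation flap := (flap G).
Local Notation intg f := (mu.-integrable setT (EFin \o (f : borel M -> R))).

(* Green's formula with the test function [F * u]. *)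
Lemma integral_energy_mul u F (K : set M) : fC2 u -> fC1 F -> compact K -> (forall x, ~ K x -> u x = 0) ->
  [/\ intg (fun x => F x * dpair u u x), intg (fun x => F x * (u x * flap u x)),
    intg (fun x => u x * dpair F u x) &
   (\int[mu]_x (F x * dpair u u x) =
    - (\int[mu]_x (F x * (u x * flap u x)) + \int[mu]_x (u x * dpair F u x)))%R].
Proof.
move=> hu hF cK u0; have [hu1 hu2] := hu; have cl := compact_closedM G cK.
have d0 x : ~ K x -> dpair u u x = 0 by exact: dpair_supp.
have cu := @fC1_continuous _ _ _ G _ hu1; have cF := @fC1_continuous _ _ _ G _ hF.
have cl' := @flap_continuous _ _ _ _ _ muG _ hu.
have i1 : intg (fun x => F x * dpair u u x).
  apply: (cc_integrable_manifold muG _ cK) => [x|x /d0 ->]; last by rewrite mulr0.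
  exact: (ctsM (cF x) (dpair_continuous hu1 hu1 (x:=x))).
have i2 : intg (fun x => F x * (u x * flap u x)).
  apply: (cc_integrable_manifold muG _ cK) => [x|x /u0 ->]; last by rewrite mul0r mulr0.
  exact: (ctsM (cF x) (ctsM (cu x) (cl' x))).
have i3 : intg (fun x => u x * dpair F u x).
  apply: (cc_integrable_manifold muG _ cK) => [x|x /u0 ->]; last by rewrite mul0r.
  exact: (ctsM (cu x) (dpair_continuous hF hu1 (x:=x))).
split => //.
have hFu : fC1 (fun x => F x * u x) by exact: fC1M.
have Fu0 x : ~ K x -> F x * u x = 0 by move=> /u0 ->; rewrite mulr0.
have gr := green muG hFu hu cK Fu0.
have E1 : (\int[mu]_x (F x * u x * flap u x) = \int[mu]_x (F x * (u x * flap u x)))%R.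
  by apply: eq_Rintegral => x _; exact: (esym (mulrA _ _ _)).
have E2 : (\int[mu]_x dpair (fun x => F x * u x) u x =
    \int[mu]_x (F x * dpair u u x) + \int[mu]_x (u x * dpair F u x))%R.
  rewrite -(RintegralD measurableT i1 i3); apply: eq_Rintegral => x _.
  exact: (dpairMl u x hF hu1).
move: gr; rewrite E1 E2; move: (\int[mu]_x (F x * (u x * flap u x)))%R => A ->.
move: (\int[mu]_x (F x * dpair u u x))%R (\int[mu]_x (u x * dpair F u x))%R => a b; ring.
Qed.

Definition energy u v x : R := dpair u u x + dpair v v x.

(** Green's formulas for [F * u] and [F * v] are added before estimating, so that [integrand_le]
    bounds the sum pointwise. The half of $\int F^2$ on the right is then absorbed, this integral
    being finite. *)
Lemma L4_compact (C Mu : R) u v (K : set M) : ricci_ge G (- C) -> fC2 u -> fC2 v -> compact K ->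
  (forall x, ~ K x -> u x = 0) -> (forall x, ~ K x -> v x = 0) -> 0 <= Mu ->
  (forall x, u x ^+ 2 + v x ^+ 2 <= Mu ^+ 2) ->
  (\int[mu]_x (energy u v x * energy u v x) <= dim_const m * Mu ^+ 2 *
     (\int[mu]_x (flap u x * flap u x) + \int[mu]_x (flap v x * flap v x)
      + C * \int[mu]_x energy u v x))%R.
Proof.
move=> hR hu hv cK u0 v0 Mu0 uvM; pose F := energy u v; rewrite -/F.
have [hu1 hu2] := hu; have [hv1 hv2] := hv; have cl := compact_closedM G cK.
have hFu := fC1_dpair hu hu; have hFv := fC1_dpair hv hv.
have hF : fC1 F by exact: fC1D.
have [Eu [iEu Eu0 Eu1 Eu2 Eu3]] := bochner_energy muG hR hu cK u0.
have [Ev [iEv Ev0 Ev1 Ev2 Ev3]] := bochner_energy muG hR hv cK v0.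
have [iu1 iu2 iu3 Iu] := integral_energy_mul hu hF cK u0.
have [iv1 iv2 iv3 Iv] := integral_energy_mul hv hF cK v0.
have du0 x : ~ K x -> dpair u u x = 0 by exact: dpair_supp.
have dv0 x : ~ K x -> dpair v v x = 0 by exact: dpair_supp.
have idu : intg (dpair u u) by exact: (cc_integrable_manifold muG (dpair_continuous hu1 hu1) cK du0).
have idv : intg (dpair v v) by exact: (cc_integrable_manifold muG (dpair_continuous hv1 hv1) cK dv0).
have iFF : intg (fun x => F x * F x).
  have := integrable_EFinD iu1 iv1; congr (mu.-integrable _ _); apply/funext => x /=.
  by rewrite -mulrDr.
have iE : intg (fun x => Eu x + Ev x) by exact: integrable_EFinD.
pose P x := F x * (u x * flap u x + v x * flap v x) + (u x * dpair F u x + v x * dpair F v x).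
have iP : intg P.
  have := integrable_EFinD (integrable_EFinD iu2 iv2) (integrable_EFinD iu3 iv3).
  congr (mu.-integrable _ _); apply/funext => x /=; by rewrite /P mulrDr.
have IF : (\int[mu]_x (F x * F x) = - \int[mu]_x P x)%R.
  have -> : (\int[mu]_x (F x * F x) = \int[mu]_x (F x * dpair u u x) + \int[mu]_x (F x * dpair v v x))%R.
    rewrite -(RintegralD measurableT iu1 iv1); apply: eq_Rintegral => x _.
    exact: mulrDr.
  have -> : (\int[mu]_x P x = (\int[mu]_x (F x * (u x * flap u x)) + \int[mu]_x (F x * (v x * flap v x))) +
      (\int[mu]_x (u x * dpair F u x) + \int[mu]_x (v x * dpair F v x)))%R.
    rewrite -(RintegralD measurableT iu2 iv2) -(RintegralD measurableT iu3 iv3).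
    rewrite -(RintegralD measurableT (integrable_EFinD iu2 iv2) (integrable_EFinD iu3 iv3)).
    by apply: eq_Rintegral => x _; rewrite /P mulrDr.
  by rewrite Iu Iv -opprD addrACA.
have key x : - P x <= 2^-1 * ((2 + Num.sqrt m%:R) ^+ 2 * Mu ^+ 2 * (Eu x + Ev x)) + 2^-1 * (F x * F x).
  have fu := dpair_ge0 G u x; have fv := dpair_ge0 G v x.
  have F0 : 0 <= F x by exact: addr_ge0.
  have E0 : 0 <= Eu x + Ev x by exact: addr_ge0.
  apply: (integrand_le F0 E0 Mu0 (sqrtr_ge0 _)).
    have sm : (Num.sqrt m%:R : R) ^+ 2 = m%:R by rewrite sqr_sqrtr.
    rewrite sm.
    apply: (@le_trans _ _ ((u x ^+ 2 + v x ^+ 2) * (flap u x * flap u x + flap v x * flap v x))).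
      exact: cauchy_schwarz2.
    apply: ler_pM => //; first by rewrite addr_ge0 ?sqr_ge0.
      by rewrite addr_ge0 // -expr2 sqr_ge0.
    by rewrite mulrDr lerD.
  have dFF : dpair F F x <= 4 * ((Eu x + Ev x) * F x).
    have -> : dpair F F x = dpair (dpair u u) (dpair u u) x + dpair (dpair u u) (dpair v v) x +
        (dpair (dpair u u) (dpair v v) x + dpair (dpair v v) (dpair v v) x).
      have EF h : dpair F h x = dpair (dpair u u) h x + dpair (dpair v v) h x by exact: (dpairDl h x hFu hFv).
      rewrite EF (dpairC G (dpair u u) F x) (dpairC G (dpair v v) F x) !EF.
      by rewrite (dpairC G (dpair v v) (dpair u u) x).
    exact: (cross_term_le (Eu0 x) (Ev0 x) fu fv (Eu2 x) (Ev2 x) (dpair_ge0 G _ x) (dpair_ge0 G _ x)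
      (dpair_cauchy_schwarz G _ _ x)).
  have h1 := gradient_term_le (uvM x) (dpair_ge0 G F x) fu fv (dpair_cauchy_schwarz G F u x)
    (dpair_cauchy_schwarz G F v x).
  exact: (le_trans h1 (ler_wpM2l (sqr_ge0 Mu) (ler_wpM2r F0 dFF))).
have iB1 := integrable_EFinZ 2^-1 (integrable_EFinZ ((2 + Num.sqrt m%:R) ^+ 2 * Mu ^+ 2) iE).
have iB2 := integrable_EFinZ 2^-1 iFF.
have iNP : intg (fun x => - P x).
  have := integrable_EFinZ (-1) iP; congr (mu.-integrable _ _); apply/funext => x /=.
  by rewrite mulN1r.
have IP : (\int[mu]_x (- P x) = - \int[mu]_x P x)%R.
  rewrite -mulN1r -(RintegralZl (-1) measurableT iP); apply: eq_Rintegral => x _.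
  exact: (esym (mulN1r _)).
have := le_Rintegral measurableT iNP (integrable_EFinD iB1 iB2) (fun x _ => key x).
rewrite IP -IF (RintegralD measurableT iB1 iB2) (RintegralZl 2^-1 measurableT iFF).
rewrite (RintegralZl 2^-1 measurableT (integrable_EFinZ ((2 + Num.sqrt m%:R) ^+ 2 * Mu ^+ 2) iE)).
rewrite (RintegralZl _ measurableT iE) (RintegralD measurableT iEu iEv) Eu3 Ev3.
have -> : (\int[mu]_x F x = \int[mu]_x dpair u u x + \int[mu]_x dpair v v x)%R.
  exact: (RintegralD measurableT idu idv).
rewrite /dim_const => h; apply: half_absorb; apply: (le_trans h).
rewrite lerD2r ler_wpM2l ?invr_ge0 // ler_wpM2l ?mulr_ge0 ?sqr_ge0 //.
by rewrite [leLHS]addrACA -mulrDr.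
Qed.
End L4_estimate.

(** * Removing the compact support *)

Section convergence.
Context d (T : measurableType d) {R : realType} (mu : {measure set T -> \bar R}).
Implicit Types f g : T -> R.
Local Notation intg f := (mu.-integrable setT (EFin \o f)).

Lemma integrable_le f g : measurable_fun setT f -> intg g -> (forall x, `|f x| <= g x) -> intg f.
Proof.
move=> mf ig fg; apply: (le_integrable measurableT _ _ ig); first exact/measurable_EFinP.
by move=> x _ /=; rewrite lee_fin (le_trans (fg x)) // ler_norm.
Qed.

Lemma integrable_normr f : intg f -> intg (fun x => `|f x|).
Proof. exact: (integrable_norm (mu := mu)). Qed.

Lemma integrable_mul f g : measurable_fun setT f -> measurable_fun setT g ->
  intg (fun x => f x * f x) -> intg (fun x => g x * g x) -> intg (fun x => f x * g x).
Proof.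
move=> mf mg i1 i2; apply: (integrable_le _ (integrable_EFinD i1 i2)); first exact: measurable_funM.
move=> x; rewrite normrM -!expr2 -(real_normK (num_real (f x))) -(real_normK (num_real (g x))).
move: (normr_ge0 (f x)) (normr_ge0 (g x)); move: `|f x| `|g x| => a b a0 b0.
by move: (sqr_ge0 (a - b)); nra.
Qed.

Lemma Rintegral_dominated (f_ : nat -> T -> R) f g : (forall n, intg (f_ n)) ->
  measurable_fun setT f -> intg g -> (forall n x, `|f_ n x| <= g x) ->
  (forall x, f_ n x @[n --> \oo] --> f x) ->
  intg f /\ (\int[mu]_x f_ n x)%R @[n --> \oo] --> (\int[mu]_x f x)%R.
Proof.
move=> if_ mf ig fg ff.
have mF n : measurable_fun setT (fun x => (f_ n x)%:E) by have /integrableP[] := if_ n.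
have mf' : measurable_fun setT (fun x => (f x)%:E) by exact/measurable_EFinP.
have [iL _ H] : [/\ mu.-integrable setT (fun y => (f y)%:E),
    (\int[mu]_x `|(f_ n x)%:E - (f x)%:E| @[n --> \oo] --> 0)%E
  & (\int[mu]_x (f_ n x)%:E @[n --> \oo] --> \int[mu]_x (f x)%:E)%E].
  apply: (@dominated_convergence _ _ R mu setT measurableT (fun n y => (f_ n y)%:E) _ _ mF mf' _ ig).
    by apply: aeW => y _; apply/fine_cvgP; split; [exact: nearW|exact: ff].
  by apply: aeW => y n _; rewrite lee_fin; exact: fg.
by split => //; apply: fine_cvg; rewrite fineK //; exact: integrable_fin_num.
Qed.

Lemma Rintegral_fatou (f_ : nat -> T -> R) f (c_ : nat -> R) (c : R) :
  (forall n, intg (f_ n)) -> measurable_fun setT f -> (forall n x, 0 <= f_ n x) ->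
  (forall n, (\int[mu]_x f_ n x)%R <= c_ n) -> c_ @ \oo --> c ->
  (forall x, f_ n x @[n --> \oo] --> f x) ->
  intg f /\ (\int[mu]_x f x)%R <= c.
Proof.
move=> if_ mf f0 fc cc ff.
have fx0 x : 0 <= f x.
  rewrite -(cvg_lim _ (ff x)) //; apply: limr_ge; first exact: (cvgP _ (ff x)).
  by apply: nearW => n; exact: f0.
have mF n : measurable_fun setT (fun x => (f_ n x)%:E) by have /integrableP[] := if_ n.
have := @fatou _ _ _ mu setT measurableT (fun n x => (f_ n x)%:E) mF (fun n x _ => f0 n x).
have -> : (\int[mu]_x limn_einf (fun n => (f_ n x)%:E) = \int[mu]_x (f x)%:E)%E.
  apply: eq_integral => x _; have c1 : (f_ n x)%:E @[n --> \oo] --> (f x)%:E.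
    by apply/fine_cvgP; split; [exact: nearW|exact: ff].
  by have [-> _] := cvg_limn_einf_sup c1.
have cE : (c_ n)%:E @[n --> \oo] --> c%:E.
  by apply/fine_cvgP; split; [exact: nearW|exact: cc].
have le : (limn_einf (fun n => \int[mu]_x (f_ n x)%:E) <= c%:E)%E.
  rewrite limn_einf_lim -(cvg_lim _ cE) //; apply: lee_lim.
  - exact: is_cvg_einfs.
  - by apply/cvg_ex; exists c%:E.
  - apply: nearW => n; apply: (@le_trans _ _ (\int[mu]_x (f_ n x)%:E)%E).
      by apply: ereal_inf_lbound; exists n => /=.
    have := fc n; rewrite -lee_fin /Rintegral fineK //.
    exact: (integrable_fin_num measurableT (if_ n)).
move=> /le_trans /(_ le) h.
have i : intg f.
  apply/integrableP; split; first exact/measurable_EFinP.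
  under eq_integral do rewrite /= ger0_norm //.
  by apply: le_lt_trans h _; exact: ltry.
split => //; rewrite -lee_fin /Rintegral fineK //.
exact: (integrable_fin_num measurableT i).
Qed.

Lemma cvg_of_bound (u_ : nat -> R) (l c : R) (e : nat -> R) : e @ \oo --> (0 : R) ->
  (\forall n \near \oo, `|u_ n - l| <= e n * c) -> u_ @ \oo --> l.
Proof.
move=> e0 h; apply/subr_cvg0; apply/norm_cvg0P.
apply: (@squeeze_cvgr _ _ _ _ (fun=> 0) (fun n => e n * c)).
- by apply: filterS h => n ->; rewrite normr_ge0.
- exact: cvg_cst.
- by rewrite -[X in _ --> X](mul0r c); apply: cvgMl.
Qed.
End convergence.

Lemma sum_lin4 (R : comPzRingType) (I : finType) (a b c : R) (A B P Q : I -> R) :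
  \sum_j (a * A j + b * B j + c * (P j + Q j)) =
  a * (\sum_j A j) + b * (\sum_j B j) + c * (\sum_j P j + \sum_j Q j).
Proof. by rewrite -big_split /= !mulr_sumr -!big_split. Qed.

Lemma divM_lin (F : fieldType) (p q a b s w : F) : w != 0 ->
  w^-1 * (p * a + q * b + w * s) = p * (w^-1 * a) + q * (w^-1 * b) + s.
Proof. by move=> w0; field. Qed.

(** * The Laplacian of a product *)

Section lap_product.
Context {R : realType} {m : nat}.
Local Notation V := 'rV[R]_m.
Context (O : set V) (oO : open O) (g : V -> 'M[R]_m).
Hypothesis C1g : forall i j, C1 O (fun z => g z i j).
Hypothesis gsym : forall y, O y -> (g y)^T = g y.
Hypothesis gpos : forall y, O y -> posdef (g y).
Context (f h : V -> R) (hf : C1 O f) (hh : C1 O h).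
Hypotheses (hdf : forall k, C1 O (pd k f)) (hdh : forall k, C1 O (pd k h)).

Lemma C1_pdM k : C1 O (pd k (fun z => f z * h z)).
Proof.
apply: (@C1_eq _ _ _ (fun z => pd k f z * h z + f z * pd k h z)) => //.
  move=> z; rewrite inE => Oz.
  by rewrite (pdM (C1_derivable hf k Oz) (C1_derivable hh k Oz)).
by apply: (C1D oO); apply: (C1M oO).
Qed.

Lemma lapM y : O y -> lap g (fun z => f z * h z) y =
  f y * lap g h y + h y * lap g f y + 2 * pair g f h y.
Proof.
move=> Oy; have v0 : vol g y != 0 by rewrite gt_eqF // (vol_gt0 gsym gpos).
have C1w u j : (forall k, C1 O (pd k u)) -> C1 O (fun z => vol g z * gradv g u j z).
  by move=> hu; apply: (C1M oO); [exact: C1_vol|exact: C1_gradv].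
have dw j : pd j (fun z => vol g z * gradv g (fun z => f z * h z) j z) y =
   f y * pd j (fun z => vol g z * gradv g h j z) y + h y * pd j (fun z => vol g z * gradv g f j z) y
   + vol g y * (pd j f y * gradv g h j y + pd j h y * gradv g f j y).
  have E : {in O, (fun z => vol g z * gradv g (fun z => f z * h z) j z) =1
     (fun z => f z * (vol g z * gradv g h j z) + h z * (vol g z * gradv g f j z))}.
    move=> z; rewrite inE => Oz.
    have -> : gradv g (fun z => f z * h z) j z = f z * gradv g h j z + h z * gradv g f j z.
      rewrite /gradv !mulr_sumr -big_split /=; apply: eq_bigr => k _.
      by rewrite (pdM (C1_derivable hf k Oz) (C1_derivable hh k Oz)); ring.
    by ring.
  have d1 := C1_derivable (C1M oO hf (C1w h j hdh)) j Oy.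
  have d2 := C1_derivable (C1M oO hh (C1w f j hdf)) j Oy.
  rewrite (pd_eq j oO E Oy) (pdD d1 d2).
  rewrite (pdM (C1_derivable hf j Oy) (C1_derivable (C1w h j hdh) j Oy)).
  rewrite (pdM (C1_derivable hh j Oy) (C1_derivable (C1w f j hdf) j Oy)).
  move: (pd j (fun z => vol g z * gradv g h j z) y) (pd j (fun z => vol g z * gradv g f j z) y).
  move: (gradv g h j y) (gradv g f j y) (pd j f y) (pd j h y) (f y) (h y) (vol g y) => *; ring.
have s := pair_sym gsym f h Oy.
have -> : 2 * pair g f h y = pair g f h y + pair g h f y by rewrite -s; ring.
pose W u j := pd j (fun z => vol g z * gradv g u j z) y.
transitivity ((vol g y)^-1 * \sum_j (f y * W h j + h y * W f j +
    vol g y * (pd j f y * gradv g h j y + pd j h y * gradv g f j y))).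
  exact: (congr1 (fun t => (vol g y)^-1 * t) (eq_bigr _ (fun j _ => dw j))).
have E : \sum_j (f y * W h j + h y * W f j +
    vol g y * (pd j f y * gradv g h j y + pd j h y * gradv g f j y)) =
   f y * (\sum_j W h j) + h y * (\sum_j W f j) + vol g y * (pair g f h y + pair g h f y).
  exact: sum_lin4.
transitivity (f y * ((vol g y)^-1 * \sum_j W h j) + h y * ((vol g y)^-1 * \sum_j W f j)
  + (pair g f h y + pair g h f y)); last by [].
exact: (etrans (congr1 (fun t => (vol g y)^-1 * t) E) (divM_lin _ _ _ _ _ v0)).
Qed.
End lap_product.

(** A real form of [laplacian_cutoff]: one null sequence [e], bounded by 1, controls gradients and
    Laplacians at every point, which makes the domination independent of [n]. *)
Record cutoffs (R : realType) (m : nat) (M : ptopologicalType) (G : riemannian R m M)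
    (chi : nat -> M -> R) (e : nat -> R) : Prop := Cutoffs {
  cut_C2 : forall n, fC2 G (chi n);
  cut_supp : forall n, exists2 K : set M, compact K & forall x, ~ K x -> chi n x = 0;
  cut_ge0 : forall n x, 0 <= chi n x;
  cut_le1 : forall n x, chi n x <= 1;
  cut_one : forall x, \forall n \near \oo, chi n x = 1;
  cut_d : forall n x, dpair G (chi n) (chi n) x <= e n ^+ 2;
  cut_lap : forall n x, `|flap G (chi n) x| <= e n;
  cut_e0 : e @ \oo --> (0 : R);
  cut_ege0 : forall n, 0 <= e n;
  cut_ele1 : forall n, e n <= 1 }.

Section real_estimates.
Context {R : realType}.

Lemma abs_le_of_sqr (s d f : R) : 0 <= d -> s ^+ 2 <= d ^+ 2 * f -> `|s| <= d * Num.sqrt f.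
Proof.
move=> d0 h; have -> : `|s| = Num.sqrt (s ^+ 2) by rewrite sqrtr_sqr.
by rewrite -[d in leRHS](ger0_norm d0) -sqrtr_sqr -sqrtrM ?sqr_ge0 // ler_wsqrtr.
Qed.

(** With $c=\chi$, $f=|du|^2$, $s=\langle d\chi,du\rangle$ and $d$ a bound for $|d\chi|^2$, this
    absorbs the cross term left by the test function $\chi^2u$ into $\chi^2|du|^2$. *)
Lemma young_cutoff (c u s d f : R) : 0 <= f -> d <= 1 -> 0 <= d -> s ^+ 2 <= d * f ->
  c ^+ 2 * f <= 2 * (c ^+ 2 * f + 2 * (c * u) * s) + 4 * (u * u).
Proof.
move=> f0 d1 d0 h.
have h1 : 4 * (u * u) * d <= 4 * (u * u) by rewrite ler_piMr // mulr_ge0 // -expr2 sqr_ge0.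
have h2 : 0 <= c ^+ 2 * f + 4 * (c * u) * s + 4 * (u * u) * d; last first.
  by move: h1 h2; move: (c ^+ 2 * f) (u * u * d) (c * u * s) => *; nra.
(* The square is completed after multiplication by [d]; if [d = 0], then [s = 0] as well. *)
have [d00|dp] := eqVneq d 0.
  have s0 : s = 0 by apply/eqP; rewrite -sqrf_eq0 eq_le sqr_ge0 andbT (le_trans h) // d00 mul0r.
  by rewrite s0 d00 !mulr0 !addr0 mulr_ge0 ?sqr_ge0.
have dp' : 0 < d by rewrite lt_def dp d0.
rewrite -(pmulr_rge0 _ dp').
have -> : d * (c ^+ 2 * f + 4 * (c * u) * s + 4 * (u * u) * d) =
   c ^+ 2 * (d * f - s ^+ 2) + (c * s + 2 * u * d) ^+ 2 by ring.
by rewrite addr_ge0 ?sqr_ge0 // mulr_ge0 ?sqr_ge0 // subr_ge0.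
Qed.

Lemma abs_cross_le (p a b : R) : 0 <= a -> 0 <= b -> p ^+ 2 <= a * b -> `|p| <= a + b.
Proof.
move=> a0 b0 h; have ab : p ^+ 2 <= (a + b) ^+ 2.
  apply: (le_trans h); rewrite -subr_ge0.
  have -> : (a + b) ^+ 2 - a * b = a * b + a ^+ 2 + b ^+ 2 by ring.
  by rewrite !addr_ge0 ?sqr_ge0 // mulr_ge0.
by have [h1 h2] := le_of_sqr (addr_ge0 a0 b0) ab; rewrite ler_norml lerNl h1 h2.
Qed.

(** A bound without [c] and [e], hence an integrable majorant valid for all cut-offs. *)
Lemma cross_dom (c u s e f p A : R) : 0 <= c -> c <= 1 -> 0 <= e -> e <= 1 -> 0 <= f ->
  `|s| <= e * Num.sqrt f -> `|p| <= A ->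
  `|c ^+ 2 * p + 2 * (c * u) * s| <= A + (u * u + f).
Proof.
move=> c0 c1 e0 e1 f0 hs hp; apply: (le_trans (ler_normD _ _)); apply: lerD.
  rewrite normrM (ger0_norm (sqr_ge0 c)); apply: le_trans hp.
  by rewrite ler_piMl // expr_le1.
have q0 := sqrtr_ge0 f; have hs' : `|s| <= Num.sqrt f by apply: (le_trans hs); rewrite ler_piMl.
rewrite normrM normrM (normrM c) (ger0_norm c0) normr_nat.
apply: (@le_trans _ _ (2 * `|u| * Num.sqrt f)).
  apply: ler_pM => //; first by rewrite !mulr_ge0.
  by rewrite ler_wpM2l // ler_piMl.
have -> : u * u = `|u| ^+ 2 by rewrite real_normK ?num_real // expr2.
rewrite -{2}(sqr_sqrtr f0) -subr_ge0.
have -> : `|u| ^+ 2 + Num.sqrt f ^+ 2 - 2 * `|u| * Num.sqrt f = (`|u| - Num.sqrt f) ^+ 2 by ring.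
exact: sqr_ge0.
Qed.

Lemma cross_small (u s e f : R) : `|s| <= e * Num.sqrt f ->
  `|2 * (1 * u) * s| <= e * (2 * `|u| * Num.sqrt f).
Proof.
move=> hs; rewrite mul1r normrM normrM normr_nat [leRHS]mulrCA.
by rewrite ler_wpM2l // mulr_ge0.
Qed.

Lemma lap_small (u l s e f : R) : `|s| <= e * Num.sqrt f -> `|l| <= e ->
  `|u * l + 2 * s| <= e * (`|u| + 2 * Num.sqrt f).
Proof.
move=> hs hl; apply: (le_trans (ler_normD _ _)); rewrite mulrDr; apply: lerD.
  by rewrite normrM mulrC ler_wpM2r.
by rewrite normrM normr_nat [leRHS]mulrCA ler_wpM2l.
Qed.

(** Here [r] is $u\Delta\chi+2\langle d\chi,du\rangle$. The constants come from using
    $(a+b)^2\le2a^2+2b^2$ twice, the second time on $|u|+2\sqrt f$. *)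
Lemma lap_dom (c L r e u f : R) : 0 <= c -> c <= 1 -> 0 <= e -> e <= 1 -> 0 <= f ->
  `|r| <= e * (`|u| + 2 * Num.sqrt f) ->
  `|(c * L + r) * (c * L + r)| <= 2 * (L * L) + (4 * (u * u) + 16 * f).
Proof.
move=> c0 c1 e0 e1 f0 hr; have q0 := sqrtr_ge0 f; set q := Num.sqrt f in hr q0.
have fE : f = q ^+ 2 by rewrite sqr_sqrtr.
have uE : u * u = `|u| ^+ 2 by rewrite real_normK ?num_real // expr2.
have w0 : 0 <= `|u| + 2 * q by rewrite addr_ge0 // mulr_ge0.
have hr' : `|r| <= `|u| + 2 * q by apply: (le_trans hr); rewrite ler_piMl.
have r2 : r ^+ 2 <= (`|u| + 2 * q) ^+ 2.
  by rewrite -(real_normK (num_real r)) ler_pXn2r ?nnegrE.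
have cL : (c * L) ^+ 2 <= L * L.
  by rewrite exprMn -expr2 ler_piMl ?sqr_ge0 // expr_le1.
rewrite -expr2 ger0_norm ?sqr_ge0 //.
apply: (@le_trans _ _ (2 * (c * L) ^+ 2 + 2 * r ^+ 2)).
  rewrite -subr_ge0; have -> : 2 * (c * L) ^+ 2 + 2 * r ^+ 2 - (c * L + r) ^+ 2 = (c * L - r) ^+ 2 by ring.
  exact: sqr_ge0.
apply: lerD; first by rewrite ler_wpM2l.
apply: (@le_trans _ _ (2 * (`|u| + 2 * q) ^+ 2)); first by rewrite ler_wpM2l.
rewrite fE uE -subr_ge0.
have -> : 4 * `|u| ^+ 2 + 16 * q ^+ 2 - 2 * (`|u| + 2 * q) ^+ 2 = 2 * (`|u| - 2 * q) ^+ 2 by ring.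
by rewrite mulr_ge0 ?sqr_ge0.
Qed.

End real_estimates.

(** * Passage to the limit along the cut-off functions *)

Section cutoff_estimates.
Context {R : realType} {m : nat} {M : ptopologicalType} (G : riemannian R m M).
Context (mu : {measure set (borel M) -> \bar R}) (muG : riemannian_volume G mu).
Implicit Types (x : M) (f h u v w : M -> R).
Local Notation fC1 := (fC1 G).
Local Notation fC2 := (fC2 G).
Local Notation dpair := (dpair G).
Local Notation flap := (flap G).
Local Notation energy := (energy G).
Local Notation intg f := (mu.-integrable setT (EFin \o (f : borel M -> R))).
Local Notation mfun f := (measurable_fun [set: borel M] (f : borel M -> R)).

Lemma fC2M f h : fC2 f -> fC2 h -> fC2 (fun x => f x * h x).
Proof.
move=> [f1 f2] [h1 h2]; split; first exact: (fC1M f1 h1).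
by move=> a k; exact: (C1_pdM (range_open a) (f1 a) (h1 a) (f2 a) (h2 a)).
Qed.

Lemma flapM f h x : fC2 f -> fC2 h ->
  flap (fun x => f x * h x) x = f x * flap h x + h x * flap f x + 2 * dpair f h x.
Proof.
move=> [f1 f2] [h1 h2]; set a := chart_at G x; have dx : chart_dom a x := chart_atP G x.
have := lapM (range_open a) (C1_metric a) (@metric_mx_sym _ _ _ G a) (@posdef_metric _ _ _ G a)
  (f1 a) (h1 a) (f2 a) (h2 a) (range_map dx).
by rewrite !(chart_mapK dx).
Qed.

Lemma fC2_measurable u : fC2 u -> mfun u.
Proof. by move=> [h _]; apply: continuous_measurable; exact: (fC1_continuous h). Qed.

Lemma flap_measurable u : fC2 u -> mfun (flap u).
Proof. by move=> h; apply: continuous_measurable; exact: (flap_continuous muG h). Qed.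

Lemma dpair_measurable u w : fC2 u -> fC2 w -> mfun (dpair u w).
Proof.
by move=> [hu _] [hw _]; apply: continuous_measurable; exact: (dpair_continuous hu hw).
Qed.

Lemma dpair_sqMl c u w x : fC2 c -> fC2 u ->
  dpair (fun x => c x * c x * u x) w x = c x ^+ 2 * dpair u w x + 2 * (c x * u x) * dpair c w x.
Proof.
move=> [hc _] [hu _].
have E1 := dpairMl w x (fC1M hc hc) hu; have E2 := dpairMl w x hc hc.
rewrite E1 E2; move: (c x) (u x) (dpair u w x) (dpair c w x) => *; ring.
Qed.

Context (chi : nat -> M -> R) (e : nat -> R) (hchi : cutoffs G chi e).

Lemma chi_sq_le1 n x : 0 <= chi n x ^+ 2 <= 1.
Proof. by rewrite sqr_ge0 /= expr_le1 ?(cut_le1 hchi) ?(cut_ge0 hchi). Qed.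

Lemma cut_e2 n : e n ^+ 2 <= e n.
Proof. by rewrite expr2 ler_piMr ?(cut_ele1 hchi) ?(cut_ege0 hchi). Qed.

Lemma cut_e2_le1 n : e n ^+ 2 <= 1.
Proof. exact: (le_trans (cut_e2 n) (cut_ele1 hchi n)). Qed.

Lemma chi_cross n w x : dpair (chi n) w x ^+ 2 <= e n ^+ 2 * dpair w w x.
Proof.
apply: (le_trans (dpair_cauchy_schwarz G (chi n) w x)).
exact: (ler_wpM2r (dpair_ge0 G w x) (cut_d hchi n x)).
Qed.

Lemma chi_cross_norm n w x : `|dpair (chi n) w x| <= e n * Num.sqrt (dpair w w x).
Proof. exact: (abs_le_of_sqr (cut_ege0 hchi n) (chi_cross n w x)). Qed.

Lemma cut_integrable f n : continuous f -> (forall x, chi n x = 0 -> f x = 0) -> intg f.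
Proof.
move=> cf f0; have [K cK h0] := cut_supp hchi n.
by apply: (cc_integrable_manifold muG cf cK) => x Kx; exact: (f0 x (h0 x Kx)).
Qed.

Lemma green_chi n u w : fC2 u -> fC2 w ->
  intg (fun x => chi n x * chi n x * u x * flap w x) /\
  intg (dpair (fun x => chi n x * chi n x * u x) w) /\
  (\int[mu]_x (chi n x * chi n x * u x * flap w x) =
    - \int[mu]_x dpair (fun x => chi n x * chi n x * u x) w x)%R.
Proof.
move=> hu hw; have [K cK h0] := cut_supp hchi n; have hc := cut_C2 hchi n.
have hh : fC1 (fun x => chi n x * chi n x * u x) := proj1 (fC2M (fC2M hc hc) hu).
have hh0 x : ~ K x -> chi n x * chi n x * u x = 0 by move=> /h0 ->; rewrite !mul0r.
have cl := compact_closedM G cK.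
split; [|split]; last exact: (green muG hh hw cK hh0).
  apply: (cc_integrable_manifold muG _ cK) => [x|x /hh0 ->]; last by rewrite mul0r.
  exact: (ctsM (@fC1_continuous _ _ _ G _ hh x) (@flap_continuous _ _ _ _ _ muG _ hw x)).
apply: (cc_integrable_manifold muG _ cK) => [x|x Kx]; last exact: (dpair_supp G _ cl hh0 Kx).
exact: (dpair_continuous hh (proj1 hw) (x:=x)).
Qed.

Lemma chi_one_cvg (f_ : nat -> R) (l : R) x : (forall n, chi n x = 1 -> f_ n = l) -> f_ @ \oo --> l.
Proof.
move=> h; apply: cvg_near_cst; apply: filterS (cut_one hchi x) => n hn.
exact: h.
Qed.

(* Green's formula with the test function [chi^2 * u], then Fatou. *)
Lemma integrable_dpair u : fC2 u -> intg (fun x => u x * u x) ->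
  intg (fun x => flap u x * flap u x) -> intg (dpair u u).
Proof.
move=> hu iu iL; have hc n := cut_C2 hchi n.
have mu_ := fC2_measurable hu; have mL := flap_measurable hu.
pose f_ n x := chi n x ^+ 2 * dpair u u x.
have cc n : continuous (chi n) by exact: (fC1_continuous (proj1 (hc n))).
have cd : continuous (dpair u u) by exact: (dpair_continuous (proj1 hu) (proj1 hu)).
have if_ n : intg (f_ n).
  apply: (@cut_integrable _ n) => [x|x E]; last by rewrite /f_ E expr0n mul0r.
  exact: (ctsM (ctsM (cc n x) (cc n x)) (cd x)).
have i2 n := proj1 (proj2 (green_chi n hu hu)).
(* The bracket bounds $-2\chi^2u\Delta u$, which Green's formula leaves; the summand $4u^2$ is the
   price of [young_cutoff]. *)
pose g x := (u x * u x + flap u x * flap u x) + 4 * (u x * u x).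
have ig : intg g by apply: integrable_EFinD; [exact: integrable_EFinD|exact: integrable_EFinZ].
apply: (proj1 (@Rintegral_fatou _ _ _ mu f_ _ (fun=> (\int[mu]_x g x)%R) (\int[mu]_x g x)%R if_ _ _ _ _ _)).
- exact: dpair_measurable.
- by move=> n x; exact: (mulr_ge0 (sqr_ge0 _) (dpair_ge0 G u x)).
- move=> n; have [i1 [_ E]] := green_chi n hu hu.
  have p1 x : f_ n x <= 2 * dpair (fun x => chi n x * chi n x * u x) u x + 4 * (u x * u x).
    rewrite (dpair_sqMl _ _ (hc n) hu).
    exact: (young_cutoff _ _ (dpair_ge0 G u x) (cut_e2_le1 n) (sqr_ge0 _) (chi_cross n u x)).
  have iA := integrable_EFinZ 2 (i2 n); have iB := integrable_EFinZ 4 iu.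
  have := le_Rintegral measurableT (if_ n) (integrable_EFinD iA iB) (fun x _ => p1 x).
  move=> /le_trans; apply; rewrite (RintegralD measurableT iA iB) (RintegralZl 2 measurableT (i2 n)).
  have iC : intg (fun x => u x * u x + flap u x * flap u x) by exact: integrable_EFinD.
  rewrite [leRHS](RintegralD measurableT iC iB) lerD2r.
  have iD := integrable_EFinZ (-2) i1.
  have -> : (2 * \int[mu]_x dpair (fun x => chi n x * chi n x * u x) u x =
    \int[mu]_x (- 2 * (chi n x * chi n x * u x * flap u x)))%R.
    rewrite (RintegralZl (-2) measurableT i1) E mulrNN; exact: erefl.
  apply: (le_Rintegral measurableT iD iC) => x _.
  have := chi_sq_le1 n x; move: (chi n x) (u x) (flap u x) => c a b /andP[c0 c1].
  apply: (@le_trans _ _ (c ^+ 2 * (a * a + b * b))).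
    rewrite -subr_ge0; have -> : c ^+ 2 * (a * a + b * b) - - 2 * (c * c * a * b) = c ^+ 2 * (a + b) ^+ 2 by ring.
    by rewrite mulr_ge0 ?sqr_ge0.
  by rewrite ler_piMl // addr_ge0 // -expr2 sqr_ge0.
- exact: cvg_cst.
- move=> x; apply: (@chi_one_cvg _ _ x) => n E; by rewrite /f_ E expr1n mul1r.
Qed.

(** Both sides of Green's formula for $\chi_n^2u$ converge by domination. Two different functions
    are allowed because the complex scalar product mixes real and imaginary parts. *)
Lemma integral_mul_flap u w : fC2 u -> fC2 w -> intg (fun x => u x * u x) ->
  intg (fun x => flap w x * flap w x) -> intg (dpair u u) -> intg (dpair w w) ->
  intg (fun x => u x * flap w x) /\ intg (dpair u w) /\
  (\int[mu]_x (u x * flap w x) = - \int[mu]_x dpair u w x)%R.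
Proof.
move=> hu hw iu iL idu idw; have hc n := cut_C2 hchi n.
have mu_ := fC2_measurable hu; have mL := flap_measurable hw; have md := dpair_measurable hu hw.
have iuL : intg (fun x => u x * flap w x) by exact: (@integrable_mul _ (borel M)).
have e0 := cut_e0 hchi.
have mul_ : mfun (fun x => u x * flap w x) by exact: measurable_funM.
have i1 n := proj1 (green_chi n hu hw); have i2 n := proj1 (proj2 (green_chi n hu hw)).
have [_ c1] : intg (fun x => u x * flap w x) /\
    (\int[mu]_x (chi n x * chi n x * u x * flap w x))%R @[n --> \oo] --> (\int[mu]_x (u x * flap w x))%R.
  apply: (Rintegral_dominated i1 mul_ (integrable_normr iuL)) => [n x|x].
    rewrite -mulrA normrM -expr2 ger0_norm ?sqr_ge0 // ler_piMl //.
    by have /andP[] := chi_sq_le1 n x.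
  by apply: (@chi_one_cvg _ _ x) => n ->; rewrite !mul1r.
have dE n x : dpair (fun x => chi n x * chi n x * u x) w x =
  chi n x ^+ 2 * dpair u w x + 2 * (chi n x * u x) * dpair (chi n) w x := dpair_sqMl w x (hc n) hu.
pose g x := (dpair u u x + dpair w w x) + (u x * u x + dpair w w x).
have ig : intg g by apply: integrable_EFinD; exact: integrable_EFinD.
have [id c2] : intg (dpair u w) /\
    (\int[mu]_x dpair (fun x => chi n x * chi n x * u x) w x)%R @[n --> \oo] --> (\int[mu]_x dpair u w x)%R.
  apply: (Rintegral_dominated i2 md ig) => [n x|x].
    rewrite dE; apply: (cross_dom _ (cut_ge0 hchi n x) (cut_le1 hchi n x) (cut_ege0 hchi n) (cut_ele1 hchi n)
      (dpair_ge0 G w x) (chi_cross_norm n w x)).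
    exact: (abs_cross_le (dpair_ge0 G u x) (dpair_ge0 G w x) (dpair_cauchy_schwarz G u w x)).
  apply: (cvg_of_bound (c := 2 * `|u x| * Num.sqrt (dpair w w x)) e0).
  apply: filterS (cut_one hchi x) => n E.
  rewrite dE E expr1n mul1r [X in `|X|]addrAC subrr add0r.
  exact: (cross_small _ (chi_cross_norm n w x)).
split; [exact: iuL|split; [exact: id|]].
have c3 : (\int[mu]_x (chi n x * chi n x * u x * flap w x))%R @[n --> \oo] --> (- \int[mu]_x dpair u w x)%R.
  have -> : (fun n => \int[mu]_x (chi n x * chi n x * u x * flap w x))%R =
      (fun n => - \int[mu]_x dpair (fun x => chi n x * chi n x * u x) w x)%R.
    by apply/funext => n; exact: (proj2 (proj2 (green_chi n hu hw))).
  exact: (cvgN c2).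
exact: (cvg_unique (@norm_hausdorff _ _) c1 c3).
Qed.

Lemma cc_integrable_dpair u (K : set M) : fC2 u -> compact K -> (forall x, ~ K x -> u x = 0) ->
  [/\ intg (dpair u u), intg (fun x => flap u x * flap u x) & forall x, ~ K x -> dpair u u x = 0].
Proof.
move=> hu cK u0; have cl := compact_closedM G cK.
have d0 x : ~ K x -> dpair u u x = 0 by exact: dpair_supp.
split => //; first exact: (cc_integrable_manifold muG (dpair_continuous (proj1 hu) (proj1 hu)) cK d0).
apply: (cc_integrable_manifold muG _ cK) => [x|x Kx].
  exact: (ctsM (@flap_continuous _ _ _ _ _ muG _ hu x) (@flap_continuous _ _ _ _ _ muG _ hu x)).
by rewrite (flap_supp G cl u0 Kx) mul0r.
Qed.

Section cut.
Context (u : M -> R) (hu : fC2 u) (iu : intg (fun x => u x * u x)) (idu : intg (dpair u u)).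
Context (iL : intg (fun x => flap u x * flap u x)).

Definition cut n x : R := chi n x * u x.

Lemma fC2_cut n : fC2 (cut n).
Proof. exact: (fC2M (cut_C2 hchi n) hu). Qed.

Lemma cut_support n : exists2 K : set M, compact K & forall x, ~ K x -> cut n x = 0.
Proof.
by have [K cK h0] := cut_supp hchi n; exists K => // x /h0 E; rewrite /cut E mul0r.
Qed.

Lemma integrable_cut n : intg (dpair (cut n) (cut n)) /\ intg (fun x => flap (cut n) x * flap (cut n) x).
Proof.
by have [K cK h0] := cut_support n; have [] := cc_integrable_dpair (fC2_cut n) cK h0.
Qed.

Lemma flap_cutE n x :
  flap (cut n) x = chi n x * flap u x + (u x * flap (chi n) x + 2 * dpair (chi n) u x).
Proof. by rewrite (flapM x (cut_C2 hchi n) hu) addrA. Qed.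

Lemma dpair_cutE n x : dpair (cut n) (cut n) x =
  chi n x ^+ 2 * dpair u u x + 2 * (chi n x * u x) * dpair (chi n) u x + u x ^+ 2 * dpair (chi n) (chi n) x.
Proof.
have [hc _] := cut_C2 hchi n; have [hu1 _] := hu.
have E h : dpair (cut n) h x = chi n x * dpair u h x + u x * dpair (chi n) h x by exact: (dpairMl h x hc hu1).
rewrite E (dpairC G u) (dpairC G (chi n)) !E (dpairC G u (chi n)).
by move: (chi n x) (u x) (dpair u u x) (dpair (chi n) u x) (dpair (chi n) (chi n) x) => *; ring.
Qed.

Lemma flap_cut_cvg : (\int[mu]_x (flap (cut n) x * flap (cut n) x))%R @[n --> \oo] -->
  (\int[mu]_x (flap u x * flap u x))%R.
Proof.
have mL := flap_measurable hu.
have mLL : mfun (fun x => flap u x * flap u x) by exact: measurable_funM.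
pose g x := 2 * (flap u x * flap u x) + (4 * (u x * u x) + 16 * dpair u u x).
have ig : intg g.
  apply: integrable_EFinD; first exact: (integrable_EFinZ 2 iL).
  exact: (integrable_EFinD (integrable_EFinZ 4 iu) (integrable_EFinZ 16 idu)).
have small n x := lap_small (u x) (chi_cross_norm n u x) (cut_lap hchi n x).
apply: (proj2 (Rintegral_dominated (fun n => proj2 (integrable_cut n)) mLL ig _ _)) => [n x|x].
  rewrite flap_cutE.
  exact: (lap_dom _ (cut_ge0 hchi n x) (cut_le1 hchi n x) (cut_ege0 hchi n) (cut_ele1 hchi n)
    (dpair_ge0 G u x) (small n x)).
have c : flap (cut n) x @[n --> \oo] --> flap u x.
  apply: (cvg_of_bound (cut_e0 hchi)); apply: filterS (cut_one hchi x) => n E.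
  rewrite flap_cutE E mul1r addrAC subrr add0r; exact: small.
exact: (cvgM c c).
Qed.

Lemma dpair_cut_small n x : chi n x = 1 ->
  `|dpair (cut n) (cut n) x - dpair u u x| <= e n * (2 * `|u x| * Num.sqrt (dpair u u x) + u x ^+ 2).
Proof.
move=> E; rewrite dpair_cutE E expr1n mul1r addrAC [X in X + _]addrAC subrr add0r mulrDr.
apply: (le_trans (ler_normD _ _)); apply: lerD; first exact: (cross_small _ (chi_cross_norm n u x)).
have d0 := dpair_ge0 G (chi n) x.
rewrite normrM (ger0_norm (sqr_ge0 _)) (ger0_norm d0) mulrC; apply: ler_wpM2r; first exact: sqr_ge0.
exact: (le_trans (cut_d hchi n x) (cut_e2 n)).
Qed.

Lemma dpair_cut_cvg_at x : dpair (cut n) (cut n) x @[n --> \oo] --> dpair u u x.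
Proof.
apply: (cvg_of_bound (cut_e0 hchi)); apply: filterS (cut_one hchi x) => n E.
exact: dpair_cut_small.
Qed.

Lemma dpair_cut_cvg : (\int[mu]_x dpair (cut n) (cut n) x)%R @[n --> \oo] --> (\int[mu]_x dpair u u x)%R.
Proof.
pose g x := (dpair u u x + (u x * u x + dpair u u x)) + u x * u x.
have ig : intg g.
  exact: (integrable_EFinD (integrable_EFinD idu (integrable_EFinD iu idu)) iu).
apply: (proj2 (Rintegral_dominated (fun n => proj1 (integrable_cut n)) (dpair_measurable hu hu) ig _ _)).
  move=> n x; rewrite dpair_cutE; apply: (le_trans (ler_normD _ _)); apply: lerD.
    apply: (cross_dom _ (cut_ge0 hchi n x) (cut_le1 hchi n x) (cut_ege0 hchi n) (cut_ele1 hchi n)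
      (dpair_ge0 G u x) (chi_cross_norm n u x)).
    by rewrite (ger0_norm (dpair_ge0 G u x)).
  have d0 := dpair_ge0 G (chi n) x.
  rewrite normrM (ger0_norm (sqr_ge0 _)) (ger0_norm d0) -expr2; apply: ler_piMr; first exact: sqr_ge0.
  exact: (le_trans (cut_d hchi n x) (cut_e2_le1 n)).
by move=> x; exact: dpair_cut_cvg_at.
Qed.
End cut.

Lemma L4_limit (C Mu : R) u v : ricci_ge G (- C) -> fC2 u -> fC2 v ->
  intg (fun x => u x * u x) -> intg (fun x => v x * v x) ->
  intg (fun x => flap u x * flap u x) -> intg (fun x => flap v x * flap v x) ->
  0 <= Mu -> (forall x, u x ^+ 2 + v x ^+ 2 <= Mu ^+ 2) ->
  intg (fun x => energy u v x * energy u v x) /\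
  (\int[mu]_x (energy u v x * energy u v x) <= dim_const m * Mu ^+ 2 *
     (\int[mu]_x (flap u x * flap u x) + \int[mu]_x (flap v x * flap v x)
      + C * \int[mu]_x energy u v x))%R.
Proof.
move=> hR hu hv iu iv iLu iLv Mu0 uvM.
have idu := integrable_dpair hu iu iLu; have idv := integrable_dpair hv iv iLv.
pose U n := cut u n; pose W n := cut v n.
have ed n x : energy (U n) (W n) x = dpair (U n) (U n) x + dpair (W n) (W n) x by [].
have iU n := integrable_cut hu n; have iW n := integrable_cut hv n.
have ie n : intg (fun x => energy (U n) (W n) x * energy (U n) (W n) x).
  have [K cK h0] := cut_supp hchi n.
  have u0 x : ~ K x -> U n x = 0 by move=> /h0 E; rewrite /U /cut E mul0r.
  have v0 x : ~ K x -> W n x = 0 by move=> /h0 E; rewrite /W /cut E mul0r.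
  have [_ _ du0] := cc_integrable_dpair (fC2_cut hu n) cK u0.
  have [_ _ dv0] := cc_integrable_dpair (fC2_cut hv n) cK v0.
  have [hU _] := fC2_cut hu n; have [hW _] := fC2_cut hv n.
  apply: (cc_integrable_manifold muG _ cK) => [x|x Kx]; last first.
    by rewrite ed (du0 x Kx) (dv0 x Kx) addr0 mul0r.
  have c := ctsD (dpair_continuous hU hU (x:=x)) (dpair_continuous hW hW (x:=x)).
  exact: (ctsM c c).
have me : mfun (fun x => energy u v x * energy u v x).
  have h : mfun (energy u v) by apply: measurable_funD; exact: dpair_measurable.
  exact: measurable_funM.
apply: (Rintegral_fatou ie me (c_ := fun n => (dim_const m * Mu ^+ 2 *
     (\int[mu]_x (flap (U n) x * flap (U n) x) + \int[mu]_x (flap (W n) x * flap (W n) x)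
      + C * \int[mu]_x energy (U n) (W n) x))%R)).
- by move=> n x; rewrite -expr2 sqr_ge0.
- move=> n; have [K cK h0] := cut_supp hchi n.
  have u0 x : ~ K x -> U n x = 0 by move=> /h0 E; rewrite /U /cut E mul0r.
  have v0 x : ~ K x -> W n x = 0 by move=> /h0 E; rewrite /W /cut E mul0r.
  apply: (L4_compact muG hR (fC2_cut hu n) (fC2_cut hv n) cK u0 v0 Mu0) => x.
  rewrite /cut !exprMn -mulrDr; apply: le_trans (uvM x).
  have /andP[_ c1] := chi_sq_le1 n x.
  by rewrite ler_piMl // addr_ge0 // sqr_ge0.
- apply: cvgMr; apply: cvgD; first by apply: cvgD; exact: flap_cut_cvg.
  apply: cvgMr.
  have -> : (fun n => \int[mu]_x energy (U n) (W n) x)%R =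
     (fun n => \int[mu]_x dpair (U n) (U n) x + \int[mu]_x dpair (W n) (W n) x)%R.
    apply/funext => n; exact: (RintegralD measurableT (proj1 (iU n)) (proj1 (iW n))).
  have -> : (\int[mu]_x energy u v x = \int[mu]_x dpair u u x + \int[mu]_x dpair v v x)%R.
    exact: (RintegralD measurableT idu idv).
  by apply: cvgD; exact: dpair_cut_cvg.
move=> x; have c : energy (U n) (W n) x @[n --> \oo] --> energy u v x.
  by apply: cvgD; exact: dpair_cut_cvg_at.
exact: (cvgM c c).
Qed.
End cutoff_estimates.

(** * Complex-valued functions *)

Section complex_functions.
Context {R : realType} {m : nat} {M : ptopologicalType} (G : riemannian R m M).
Local Notation V := 'rV[R]_m.
Implicit Types (a : chart G) (x : M) (y : V) (i j k : 'I_m) (f : M -> R[i]).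
Local Notation re f := (@complex.Re _ \o f).
Local Notation im f := (@complex.Im _ \o f).
Local Notation fC2 := (fC2 G).
Local Notation dpair := (dpair G).
Local Notation flap := (flap G).
Local Notation energy := (energy G).

Lemma ReMl (c : R) (z : R[i]) : complex.Re (c%:C * z) = c * complex.Re z.
Proof. by case: z => a b /=; rewrite mul0r subr0. Qed.

Lemma ImMl (c : R) (z : R[i]) : complex.Im (c%:C * z) = c * complex.Im z.
Proof. by case: z => a b /=; rewrite mul0r addr0. Qed.

Lemma Re_sum (I : Type) (r : seq I) (F : I -> R[i]) :
  complex.Re (\sum_(i <- r) F i) = \sum_(i <- r) complex.Re (F i).
Proof. by elim/big_rec2: _ => [//|i a b _ <-]; case: (F i) b => p q [s t]. Qed.

Lemma Im_sum (I : Type) (r : seq I) (F : I -> R[i]) :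
  complex.Im (\sum_(i <- r) F i) = \sum_(i <- r) complex.Im (F i).
Proof. by elim/big_rec2: _ => [//|i a b _ <-]; case: (F i) b => p q [s t]. Qed.

Lemma Re_mulJ (z w : R[i]) :
  complex.Re (z * w^*) = complex.Re z * complex.Re w + complex.Im z * complex.Im w.
Proof. by case: z w => a b [c d] /=; rewrite mulrN opprK. Qed.

Lemma Ck_fun_fC2 f : Ck_fun G 2 f -> fC2 (re f) /\ fC2 (im f).
Proof.
move=> h; split; split=> a; have [h1 h2] := h a.
- exact: (proj1 (C1_Ck2 h1)).
- exact: (proj2 (C1_Ck2 h1)).
- exact: (proj1 (C1_Ck2 h2)).
- exact: (proj2 (C1_Ck2 h2)).
Qed.

Lemma laplacianE f x : laplacian G f x = flap (re f) x +i* flap (im f) x.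
Proof.
apply/eqP; rewrite eq_complex /=; apply/andP; split; apply/eqP.
  rewrite /laplacian /codiff opprK ReMl Re_sum; congr (_ * _); apply: eq_bigr => j _ /=.
  apply: (congr1 (fun F => pd j F (chart_map (chart_at G x) x))); apply/funext => z /=; rewrite ReMl Re_sum; congr (_ * _).
  by apply: eq_bigr => k _; rewrite ReMl mxE.
rewrite /laplacian /codiff opprK ImMl Im_sum; congr (_ * _); apply: eq_bigr => j _ /=.
apply: (congr1 (fun F => pd j F (chart_map (chart_at G x) x))); apply/funext => z /=; rewrite ImMl Im_sum; congr (_ * _).
by apply: eq_bigr => k _; rewrite ImMl mxE.
Qed.

(** The real part of $z\bar w$ has no mixed terms, so the Hermitian square splits into those of [du]
    and [dv]. *)
Lemma d_normE f x : d_norm G f x = Num.sqrt (energy (re f) (im f) x).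
Proof.
rewrite /d_norm; congr Num.sqrt; rewrite Re_sum /energy /dpair /dpair_at /pair -big_split /=.
apply: eq_bigr => j _; rewrite Re_sum /gradv !mulr_sumr -big_split /=; apply: eq_bigr => k _.
rewrite -mulrA ReMl Re_mulJ !mxE /= mulrDr; congr (_ + _); exact: mulrCA.
Qed.

Lemma normcE2 (z : R[i]) : normc z = Num.sqrt (complex.Re z ^+ 2 + complex.Im z ^+ 2).
Proof. by case: z. Qed.

Lemma normc_sq (z : R[i]) : normc z ^+ 2 = complex.Re z ^+ 2 + complex.Im z ^+ 2.
Proof. by rewrite normcE2 sqr_sqrtr // addr_ge0 ?sqr_ge0. Qed.

Lemma energy_ge0 f x : 0 <= energy (re f) (im f) x.
Proof. by rewrite addr_ge0 // dpair_ge0. Qed.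

Lemma ereal_sup_bound (g : nat -> M -> R) (eps : R) : 0 < eps ->
  ereal_sup [set (g n x)%:E | x in [set: M]] @[n --> \oo] --> 0%E ->
  \forall n \near \oo, forall x, g n x <= eps.
Proof.
move=> e0 /fine_cvgP[fin cv].
have lt : \forall n \near \oo, fine (ereal_sup [set (g n x)%:E | x in [set: M]]) < eps.
  exact: (cvgr_lt _ cv).
apply: filterS2 fin lt => n fn ln x; rewrite -lee_fin.
apply: (@le_trans _ _ (ereal_sup [set (g n x)%:E | x in [set: M]])).
  by apply: ereal_sup_ubound; exists x.
by rewrite -(fineK fn) lee_fin ltW.
Qed.

(** Passing to a subsequence gives the explicit rate [1 / (k + 1)]. Taking real parts does not
    increase the norms of the differential and of the Laplacian. *)
Lemma cutoffs_exist (chi : nat -> M -> R[i]) : laplacian_cutoff G chi ->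
  exists c : nat -> M -> R, cutoffs G c (fun k : nat => k.+1%:R^-1).
Proof.
move=> [csm csup cb cone cd cl].
have bnd (k : nat) : exists N, forall n, (N <= n)%N -> forall x,
    d_norm G (chi n) x <= k.+1%:R^-1 /\ normc (laplacian G (chi n) x) <= k.+1%:R^-1.
  have e0 : 0 < k.+1%:R^-1 :> R by rewrite invr_gt0.
  have [N _ hN] := filterI (ereal_sup_bound e0 cd) (ereal_sup_bound e0 cl).
  by exists N => n Nn x; have [h1 h2] := hN n Nn; split.
have [N hN] := choice bnd.
(* The maximum with [k] makes the indices tend to infinity, so that each point eventually has value
   1. *)
pose idx (k : nat) := maxn (N k) k.
have cC2 (k : nat) := proj1 (Ck_fun_fC2 (csm (idx k) 2)).
have hidx (k : nat) x := hN k (idx k) (leq_maxl _ _) x.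
exists (fun k : nat => re (chi (idx k))); split => //.
- move=> k; exists (closure [set x | chi (idx k) x != 0]); first exact: csup.
  move=> x Kx /=; have -> : chi (idx k) x = 0; last by [].
  by apply/eqP; apply: contra_notT Kx => h; exact: subset_closure.
- by move=> k x; have /andP[h _] := cb (idx k) x; move: h; rewrite lecE => /andP[_ h].
- by move=> k x; have /andP[_ h] := cb (idx k) x; move: h; rewrite lecE => /andP[_ h].
- move=> x; have [n0 h0] := cone [set x] (@compact_set1 _ x).
  exists n0 => // k /= nk; rewrite /= (h0 (idx k) _ x erefl) //.
  exact: (leq_trans nk (leq_maxr _ _)).
- move=> k x; have [h _] := hidx k x; rewrite d_normE in h.
  have E0 := energy_ge0 (chi (idx k)) x.
  have h2 : Num.sqrt (energy (re (chi (idx k))) (im (chi (idx k))) x) ^+ 2 <= k.+1%:R^-1 ^+ 2.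
    by rewrite ler_pXn2r ?nnegrE ?sqrtr_ge0 ?invr_ge0.
  rewrite sqr_sqrtr // in h2; apply: le_trans h2.
  by rewrite lerDl dpair_ge0.
- move=> k x; have [_ h] := hidx k x; rewrite laplacianE normcE2 /= in h; apply: le_trans h.
  rewrite -[leLHS]sqrtr_sqr ler_wsqrtr // lerDl; exact: sqr_ge0.
- exact: cvg_harmonic.
- by move=> k; rewrite invf_le1 // ler1n.
Qed.

End complex_functions.

(** * Norms of nonnegative functions as integrals of powers *)

Section Lnorm.
Context d (T : measurableType d) {R : realType} (mu : {measure set T -> \bar R}).
Context (g : T -> R) (mg : measurable_fun setT g) (g0 : forall x, 0 <= g x).
Local Notation intg f := (mu.-integrable setT (EFin \o f)).

Lemma integral_powR n : (\int[mu]_x (`|(g x)%:E| `^ n%:R) = \int[mu]_x (g x ^+ n)%:E)%E.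
Proof.
apply: eq_integral => x _; rewrite poweR_EFin ger0_norm //.
by rewrite powR_mulrn.
Qed.

Lemma Lnorm_integrable n : (0 < n)%N -> ('N[mu]_(n%:R%:E)[EFin \o g] < +oo)%E ->
  intg (fun x => g x ^+ n).
Proof.
move=> n0; have nn : (n%:R : R) != 0 by rewrite pnatr_eq0 -lt0n.
rewrite unlock integral_powR => /lty_poweRy; rewrite invr_neq0 // => /(_ isT) h.
apply/integrableP; split.
  by apply/measurable_EFinP; exact: measurable_funX.
under eq_integral do rewrite /= ger0_norm ?exprn_ge0 //.
exact: h.
Qed.

Lemma Lnorm_expn n : (0 < n)%N -> intg (fun x => g x ^+ n) ->
  ('N[mu]_(n%:R%:E)[EFin \o g] = ((\int[mu]_x (g x ^+ n))%R `^ (n%:R^-1))%:E)%E /\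
  ('N[mu]_(n%:R%:E)[EFin \o g] ^+ n = (\int[mu]_x (g x ^+ n))%R%:E)%E.
Proof.
move=> n0 i; have nn : (n%:R : R) != 0 by rewrite pnatr_eq0 -lt0n.
have E : ('N[mu]_(n%:R%:E)[EFin \o g] = ((\int[mu]_x (g x ^+ n))%R `^ (n%:R^-1))%:E)%E.
  rewrite unlock integral_powR -poweR_EFin; congr poweR.
  by rewrite /Rintegral fineK //; exact: (integrable_fin_num measurableT i).
split => //; rewrite E -EFin_expe; congr EFin.
rewrite -powR_mulrn ?powR_ge0 // -powRrM mulVf // powRr1 //.
by apply: Rintegral_ge0 => x _; rewrite exprn_ge0.
Qed.

(** Pointwise $g^q\le g^2+g^4$: compare with $g^2$ where $g\le1$ and with $g^4$ where $g>1$. *)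
Lemma Lfun_interpolation (q : R) : 2 <= q <= 4 -> intg (fun x => g x ^+ 2) -> intg (fun x => g x ^+ 4) ->
  g \in Lfun mu q%:E.
Proof.
move=> /andP[q2 q4] i2 i4; rewrite inE; apply/andP; split; first by rewrite inE.
rewrite inE /= /finite_norm unlock; apply: poweR_lty.
have i := integrable_EFinD i2 i4.
have /integrableP[_] := i; apply: le_lt_trans; apply: ge0_le_integral => //.
- by move=> x _; exact: poweR_ge0.
- apply: (measurableT_comp (measurable_poweR q)); apply: measurableT_comp => //.
  exact/measurable_EFinP.
- by apply: measurableT_comp => //; have /integrableP[] := i.
move=> x _; apply: (@le_trans _ _ (`|g x| `^ q)%:E); first by rewrite -poweR_EFin.
rewrite lee_fin (ger0_norm (g0 x)) ger0_norm ?addr_ge0 ?exprn_ge0 //.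
have [->|gn] := eqVneq (g x) 0.
  rewrite powR0 ?addr_ge0 // gt_eqF //; apply: lt_le_trans q2; exact: ltr0n.
have gp : 0 < g x by rewrite lt_def gn g0.
have [g1|g1] := leP (g x) 1.
  apply: (@le_trans _ _ (g x ^+ 2)); last by rewrite lerDl exprn_ge0.
  by rewrite -powR_mulrn //; apply: ger_powR => //; rewrite gp g1.
apply: (@le_trans _ _ (g x ^+ 4)); last by rewrite lerDr exprn_ge0.
by rewrite -powR_mulrn //; apply: ler_powR => //; exact: ltW.
Qed.

Lemma Lnorm_oo_ae : ('N[mu]_+oo[EFin \o g] < +oo)%E ->
  \forall x \ae mu, g x <= fine ('N[mu]_+oo[EFin \o g])%E.
Proof.
move=> foo; have f0 := Lnorm_ge0 mu +oo (EFin \o g).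
have ffin : ('N[mu]_+oo[EFin \o g])%E \is a fin_num by rewrite ge0_fin_numE.
have : \forall x \ae mu, ((g x)%:E <= 'N[mu]_+oo[EFin \o g])%E; last first.
  by apply: filterS => x; rewrite -{1}(fineK ffin) lee_fin.
rewrite unlock; case: ifPn => [m0|m0].
  have := ess_sup_ge mu (abse \o (EFin \o g)).
  by apply: filterS => x /=; rewrite ger0_norm.
(* In this branch the norm is not an essential supremum, but the whole space is null and any
   statement holds almost everywhere. *)
have mT : mu setT = 0 by apply/eqP; rewrite eq_le measure_ge0 andbT leNgt.
by exists setT; split.
Qed.
End Lnorm.

Lemma Rintegral_ae0 d (T : measurableType d) (R : realType) (mu : {measure set T -> \bar R})
    (h : T -> R) (P : T -> Prop) : mu.-integrable setT (EFin \o h) ->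
  (forall x, P x -> h x = 0) -> (\forall x \ae mu, P x) -> (\int[mu]_x h x)%R = 0.
Proof.
move=> ih Ph ae; rewrite -(@Rintegral_cst0 _ _ _ mu) /Rintegral; congr fine.
apply: ae_eq_integral => //; first by have /integrableP[] := ih.
by apply: filterS ae => x Px _; rewrite Ph.
Qed.

(** * From almost everywhere to everywhere *)

Section everywhere.
Context {R : realType} {m : nat} {M : ptopologicalType} (G : riemannian R m M).
Context (mu : {measure set (borel M) -> \bar R}) (muG : riemannian_volume G mu).
Local Notation V := 'rV[R]_m.
Implicit Types (x : M) (f : M -> R).

(** If $f(x_0)>c$, a bump function at $x_0$ times $(f-c)^+$ is almost everywhere zero, yet it has a
    positive integral because the volume density is positive. *)
Lemma ae_le_continuous f (c : R) : continuous f ->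
  (\forall x \ae mu, f x <= c) -> forall x, f x <= c.
Proof.
move=> cf ae x0; rewrite leNgt; apply/negP => lt.
have [p [dx hx]] := cell_exists G x0; set a := cell_chart p in dx hx.
pose h x := cfun p x * Num.max (f x - c) 0.
have ch : continuous h.
  move=> x; apply: ctsM; first exact: (@fC1_continuous _ _ _ G _ (@fC1_cfun _ _ _ G p) x).
  by apply: continuous_max; [apply: ctsB; [exact: cf|exact: cts_cst]|exact: cts_cst].
have h0 x : ~ ccell p x -> h x = 0 by move=> /cfun0 E; rewrite /h E mul0r.
have hge x : 0 <= h x by rewrite mulr_ge0 ?cfun_ge0 // le_max lexx orbT.
have cloc y : chart_range a y -> {for y, continuous (fun y => h (chart_inv a y))}.
  by move=> ry; exact: (loc_continuous ch ry).
have cK := @ccell_compact _ _ _ G p; have Kd : ccell p `<=` chart_dom a := @ccell_dom _ _ _ G p.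
have [ih E] := integral_chart muG cK Kd h0 cloc.
have z : (\int[mu]_x h x)%R = 0.
  apply: (Rintegral_ae0 ih _ ae) => x fx.
  by rewrite /h max_r ?mulr0 // subr_le0.
have [cK' Kr] := compact_map cK Kd.
have cl' : closed (chart_map a @` ccell p) by apply: compact_closed => //; exact: norm_hausdorff.
pose F y := restr a h y * vol (metric_mx a) y.
have F0 y : ~ (chart_map a @` ccell p) y -> F y = 0.
  by move=> ny; rewrite /F (restr_supp h0 ny) mul0r.
have cF : continuous F.
  apply: (continuous_ext (range_open a) cl' Kr F0) => y ry.
  apply: ctsM; last exact: (C1_continuous (C1_vol_metric a) ry).
  apply: near_continuous (cloc y ry).
  apply: filterS (open_nbhs_nbhs (conj (range_open a) ry)) => w rw.
  by rewrite restrE.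
have Fge y : 0 <= F y.
  have [ry|ry] := pselect (chart_range a y); last by rewrite /F restr0 // mul0r.
  by rewrite /F restrE // mulr_ge0 // ltW // vol_metric_gt0.
have pos : 0 < F (chart_map a x0).
  have ry := range_map dx; rewrite /F restrE // chart_mapK //.
  have c1 : cfun p x0 = 1 by apply: cfun1; split.
  by rewrite /h c1 mul1r mulr_gt0 ?vol_metric_gt0 // lt_max subr_gt0 lt.
have := integral_gt0 cF (bdsupp_compact cK' F0) Fge pos.
by rewrite -E z ltxx.
Qed.
End everywhere.

Lemma normc_laplacian_sq (R : realType) (m : nat) (M : ptopologicalType) (G : riemannian R m M)
    (f : M -> R[i]) (x : M) :
  let u := @complex.Re _ \o f in let v := @complex.Im _ \o f in
  normc (laplacian G f x) ^+ 2 = flap G u x * flap G u x + flap G v x * flap G v x.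
Proof.
move=> u v; rewrite laplacianE normc_sq -/u -/v.
by move: (flap G u x) (flap G v x) => a b; rewrite -!expr2.
Qed.

(** The real part is Green's formula for [u] and for [v]; the imaginary part integrates $v\Delta
    u-u\Delta v$, which is zero by symmetry of the pairing. *)
Lemma L2_dot_laplacian (R : realType) (m : nat) (M : ptopologicalType) (G : riemannian R m M)
    (mu : {measure set (borel M) -> \bar R}) (chi : nat -> M -> R) (e : nat -> R) (f : M -> R[i]) :
  riemannian_volume G mu -> cutoffs G chi e ->
  let u := @complex.Re _ \o f in let v := @complex.Im _ \o f in
  let intg (h : M -> R) := mu.-integrable setT (EFin \o (h : borel M -> R)) in
  fC2 G u -> fC2 G v -> intg (fun x => u x * u x) -> intg (fun x => v x * v x) ->
  intg (fun x => flap G u x * flap G u x) -> intg (fun x => flap G v x * flap G v x) ->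
  L2_dot mu f (fun x => - laplacian G f x) = ((\int[mu]_x energy G u v x)%R)%:C.
Proof.
move=> muG hchi u v intg hu hv iu iv ilu ilv.
have idu := integrable_dpair muG hchi hu iu ilu; have idv := integrable_dpair muG hchi hv iv ilv.
have [iuu [_ Euu]] := integral_mul_flap muG hchi hu hu iu ilu idu idu.
have [ivv [_ Evv]] := integral_mul_flap muG hchi hv hv iv ilv idv idv.
have [iuv [_ Euv]] := integral_mul_flap muG hchi hu hv iu ilv idu idv.
have [ivu [_ Evu]] := integral_mul_flap muG hchi hv hu iv ilu idv idu.
have re_ x : complex.Re ((f x)^* * - laplacian G f x) = -1 * (u x * flap G u x + v x * flap G v x).
  rewrite laplacianE -/u -/v; have -> : f x = u x +i* v x by rewrite /u /v /=; case: (f x).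
  by move: (u x) (v x) (flap G u x) (flap G v x) => a b c d /=; ring.
have im_ x : complex.Im ((f x)^* * - laplacian G f x) = v x * flap G u x - u x * flap G v x.
  rewrite laplacianE -/u -/v; have -> : f x = u x +i* v x by rewrite /u /v /=; case: (f x).
  by move: (u x) (v x) (flap G u x) (flap G v x) => a b c d /=; ring.
have Ere : (\int[mu]_x complex.Re ((f x)^* * - laplacian G f x) = \int[mu]_x energy G u v x)%R.
  transitivity (\int[mu]_x (-1 * (u x * flap G u x + v x * flap G v x)))%R.
    by apply: eq_Rintegral => x _; exact: re_.
  rewrite (RintegralZl (-1) measurableT (integrable_EFinD iuu ivv)) (RintegralD measurableT iuu ivv).
  have Een : (\int[mu]_x energy G u v x = \int[mu]_x dpair G u u x + \int[mu]_x dpair G v v x)%R.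
    exact: (RintegralD measurableT idu idv).
  have neg (a b : R) : -1 * (- a + - b) = a + b by ring.
  exact: (etrans (congr2 (fun s t => -1 * (s + t)) Euu Evv) (etrans (neg _ _) (esym Een))).
have Eim : (\int[mu]_x complex.Im ((f x)^* * - laplacian G f x) = 0)%R.
  transitivity (\int[mu]_x (v x * flap G u x - u x * flap G v x))%R.
    by apply: eq_Rintegral => x _; exact: im_.
  have sym : (\int[mu]_x dpair G v u x = \int[mu]_x dpair G u v x)%R.
    by apply: eq_Rintegral => x _; exact: dpairC.
  have E : (\int[mu]_x (v x * flap G u x) = \int[mu]_x (u x * flap G v x))%R.
    exact: (etrans Evu (etrans (congr1 -%R sym) (esym Euv))).
  exact: (etrans (RintegralB measurableT ivu iuv) (etrans (congr1 (fun t => t - _) E) (subrr _))).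
exact: (congr2 (@Complex R) Ere Eim).
Qed.

Theorem theorem2p3 (R : realType) (m : nat) (M : ptopologicalType)
    (G : riemannian R m M) (mu : {measure set (borel M) -> \bar R})
    (C : R) :
  connected [set: M] ->
  riemannian_volume G mu ->
  (exists chi : nat -> M -> R[i], laplacian_cutoff G chi) ->
  0 < C ->
  ricci_ge G (- C) ->
  forall Psi : M -> R[i], class_F G mu Psi ->
    [/\ (forall q : R, 2 <= q <= 4 -> (d_norm G Psi : borel M -> R) \in Lfun mu q%:E),
        (fine (d_Lp_norm G mu 2%:E Psi) ^+ 2)%:C =
          L2_dot mu Psi (fun x => - laplacian G Psi x) &
        (d_Lp_norm G mu 4%:E Psi ^+ 4 <=
          (dim_const m)%:E * Lp_norm mu +oo Psi ^+ 2 *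
          (Lp_norm mu 2%:E (laplacian G Psi) ^+ 2
           + C%:E * d_Lp_norm G mu 2%:E Psi ^+ 2))%E ].
Proof.
move=> _ muG [chi0 /cutoffs_exist[chi hchi]] _ hR Psi [hC2 [_ _ hoo] [_ _ h2] [_ _ hL]].
have [hu hv] := Ck_fun_fC2 hC2; set u : M -> R := _ \o Psi in hu; set v : M -> R := _ \o Psi in hv.
have cu := @fC1_continuous _ _ _ G _ (proj1 hu); have cv := @fC1_continuous _ _ _ G _ (proj1 hv).
have clu := @flap_continuous _ _ _ _ _ muG _ hu; have clv := @flap_continuous _ _ _ _ _ muG _ hv.
pose N x := normc (Psi x); pose L x := normc (laplacian G Psi x); pose d x := d_norm G Psi x.
have sqrtc (f h : M -> R) : continuous f -> continuous h ->
    measurable_fun [set: borel M] ((fun x => Num.sqrt (f x ^+ 2 + h x ^+ 2)) : borel M -> R).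
  move=> cf ch; apply: continuous_measurable => x.
  apply: (cts_comp (g := fun x => f x ^+ 2 + h x ^+ 2) (f := Num.sqrt)).
    exact: (ctsD (ctsM (cf x) (cf x)) (ctsM (ch x) (ch x))).
  exact: sqrt_continuous.
have mN : measurable_fun [set: borel M] (N : borel M -> R).
  have -> : N = fun x => Num.sqrt (u x ^+ 2 + v x ^+ 2) by apply/funext => x; exact: normcE2.
  exact: sqrtc.
have mL : measurable_fun [set: borel M] (L : borel M -> R).
  have -> : L = fun x => Num.sqrt (flap G u x ^+ 2 + flap G v x ^+ 2).
    by apply/funext => x; rewrite /L laplacianE normcE2.
  exact: sqrtc.
have N0 x : 0 <= N x by rewrite /N normcE2 sqrtr_ge0.
have L0 x : 0 <= L x by rewrite /L normcE2 sqrtr_ge0.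
have d0 x : 0 <= d x by rewrite /d d_normE sqrtr_ge0.
have N2 x : N x ^+ 2 = u x * u x + v x * v x by rewrite /N normc_sq -!expr2.
have L2 x : L x ^+ 2 = flap G u x * flap G u x + flap G v x * flap G v x.
  exact: normc_laplacian_sq.
have d2 x : d x ^+ 2 = energy G u v x by rewrite /d d_normE sqr_sqrtr // energy_ge0.
have iN := Lnorm_integrable mN N0 (isT : (0 < 2)%N) h2.
have iL := Lnorm_integrable mL L0 (isT : (0 < 2)%N) hL.
(* Square integrability of each component follows by domination from that of the complex
   function. *)
have sqi (f h : M -> R) g : continuous f -> (forall x, g x = f x * f x + h x * h x) ->
    mu.-integrable setT (EFin \o (g : borel M -> R)) -> mu.-integrable setT (EFin \o ((fun x => f x * f x) : borel M -> R)).
  move=> cf gE ig; apply: (integrable_le _ ig).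
    by apply: continuous_measurable => x; exact: (ctsM (cf x) (cf x)).
  by move=> x; rewrite ger0_norm -?expr2 ?sqr_ge0 // gE -!expr2 lerDl sqr_ge0.
have iu := sqi u v _ cu N2 iN; have ilu := sqi _ (flap G v) _ clu L2 iL.
have iv := sqi v u _ cv (fun x => etrans (N2 x) (addrC _ _)) iN.
have ilv := sqi _ (flap G u) _ clv (fun x => etrans (L2 x) (addrC _ _)) iL.
have idu := integrable_dpair muG hchi hu iu ilu; have idv := integrable_dpair muG hchi hv iv ilv.
(* A real number, since the norm is finite; [ae_le_continuous] turns it into the bound at every
   point that [L4_limit] requires. *)
pose Mu := fine (Lp_norm mu +oo Psi).
have Noo0 : (0 <= Lp_norm mu +oo Psi)%E by exact: Lnorm_ge0.
have Mu0 : 0 <= Mu by exact: fine_ge0.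
have cN : continuous N.
  have -> : N = fun x => Num.sqrt (u x ^+ 2 + v x ^+ 2) by apply/funext => x; exact: normcE2.
  move=> x; apply: (cts_comp (g := fun x => u x ^+ 2 + v x ^+ 2) (f := Num.sqrt)).
    exact: (ctsD (ctsM (cu x) (cu x)) (ctsM (cv x) (cv x))).
  exact: sqrt_continuous.
have NM := ae_le_continuous muG cN (@Lnorm_oo_ae _ (borel M) _ mu N N0 hoo).
have uvM x : u x ^+ 2 + v x ^+ 2 <= Mu ^+ 2.
  by have := N2 x; rewrite -!expr2 => <-; rewrite ler_pXn2r ?nnegrE //; exact: NM.
have [iE4 bound] := L4_limit muG hchi hR hu hv iu iv ilu ilv Mu0 uvM.
have mE : measurable_fun [set: borel M] (d : borel M -> R).
  have -> : d = fun x => Num.sqrt (energy G u v x) by apply/funext => x; exact: d_normE.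
  apply: continuous_measurable => x.
  apply: (cts_comp (g := energy G u v) (f := Num.sqrt)); last exact: sqrt_continuous.
  exact: (ctsD (dpair_continuous (proj1 hu) (proj1 hu) (x:=x)) (dpair_continuous (proj1 hv) (proj1 hv) (x:=x))).
have id2 : mu.-integrable setT (EFin \o ((fun x => d x ^+ 2) : borel M -> R)).
  have -> : (fun x => d x ^+ 2) = energy G u v by apply/funext => x; exact: d2.
  exact: (integrable_EFinD idu idv).
have d4 : (fun x => d x ^+ 4) = (fun x => energy G u v x * energy G u v x).
  by apply/funext => x; rewrite -d2 -exprD.
have id4 : mu.-integrable setT (EFin \o ((fun x => d x ^+ 4) : borel M -> R)) by rewrite d4.
have [_ e2] := @Lnorm_expn _ (borel M) _ mu d d0 2 isT id2.
have [_ e4] := @Lnorm_expn _ (borel M) _ mu d d0 4 isT id4.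
have [_ eL] := @Lnorm_expn _ (borel M) _ mu L L0 2 isT iL.
have E2 : (\int[mu]_x (d x ^+ 2) = \int[mu]_x energy G u v x)%R.
  by apply: eq_Rintegral => x _; exact: d2.
split.
- by move=> q hq; exact: (Lfun_interpolation mE d0 hq id2 id4).
- have -> : fine (d_Lp_norm G mu 2%:E Psi) ^+ 2 = (\int[mu]_x (d x ^+ 2))%R.
    (* The norm is finite, so [fine] loses nothing and commutes with squaring. *)
    have f2 : ('N[mu]_2%:E[EFin \o (d : borel M -> R)])%E \is a fin_num.
      by have [-> _] := @Lnorm_expn _ (borel M) _ mu d d0 2 isT id2.
    by apply: EFin_inj; rewrite -e2 -(fineK f2) -EFin_expe.
  rewrite E2; apply: esym; exact: (L2_dot_laplacian muG hchi hu hv iu iv ilu ilv).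
have Mfin : Lp_norm mu +oo Psi = Mu%:E by rewrite fineK // ge0_fin_numE.
(* Each power of a norm is now an embedded real number, so the extended inequality is the image of
   [bound']. *)
rewrite Mfin [X in (X <= _)%E]e4 [X in (_ <= _ * (X + _))%E]eL [X in (_ <= _ * (_ + _ * X))%E]e2.
have bound' : ((\int[mu]_x (d x ^+ 4))%R <=
    dim_const m * Mu ^+ 2 * ((\int[mu]_x (L x ^+ 2))%R + C * (\int[mu]_x (d x ^+ 2))%R)).
  rewrite d4 E2; apply: (le_trans bound); rewrite le_eqVlt; apply/orP; left; apply/eqP.
  congr (_ * (_ + _)); rewrite -(RintegralD measurableT ilu ilv).
  by apply: eq_Rintegral => x _; exact: (esym (L2 x)).
by rewrite -lee_fin EFinM EFinM EFinD EFinM EFin_expe in bound'.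
Qed.
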